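(* Suppose the number of hidden nodes satisfies $k_n \sim n^a$ for some $0<a<1$. In addition, suppose assumptions (A1) and (A2) hold for some $0\leq \delta<1-a$. Then, with the normal prior for each entry of $\boldsymbol{\omega}_n=\boldsymbol{\theta}_n$, $$p(\boldsymbol{\omega}_n)=\prod_{i=1}^{K(n)}\frac{1}{\sqrt{2\pi \zeta^2}}e^{-\frac{\theta_{in}^2}{2\zeta^2}},$$ we have, for every $\varepsilon>0$, $$\pi^*(\mathcal{V}_\varepsilon^c)=o_{P_0^n}(n^{-\delta}).$$
   Context: Data: $y_i=f_0(\boldsymbol{x}_i)+\xi_i$, $i=1,\dots,n$, with $\xi_i$ i.i.d. $N(0,\sigma_0^2)$, $\sigma_0$ known, and $\boldsymbol{x}_i\sim U(0,1)^p$ with $p$ fixed; $P_0^n$ is the true data distribution. The true conditional density is $l_0(y,\boldsymbol{x})=\frac{1}{\sqrt{2\pi\sigma_0^2}}\exp(-\frac{1}{2\sigma_0^2}(y-f_0(\boldsymbol{x}))^2)$. The model is the one-hidden-layer neural network $f_{\boldsymbol{\theta}_n}(\boldsymbol{x})=\beta_0+\sum_{j=1}^{k_n}\beta_j\psi(\gamma_j^\top\boldsymbol{x})$ with logistic $\psi(u)=1/(1+e^{-u})$, parameter vector $\boldsymbol{\theta}_n=(\beta_j,\gamma_{jh})$ of dimension $K(n)=1+k_n(p+1)$, and density $l_{\boldsymbol{\omega}_n}(y,\boldsymbol{x})=\frac{1}{\sqrt{2\pi\sigma_0^2}}\exp(-\frac{1}{2\sigma_0^2}(y-f_{\boldsymbol{\theta}_n}(\boldsymbol{x}))^2)$;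 likelihood $L(\boldsymbol{\omega}_n)=\prod_i l_{\boldsymbol{\omega}_n}(y_i,\boldsymbol{x}_i)$ and posterior $\pi(\cdot|\boldsymbol{y}_n,\boldsymbol{X}_n)\propto L(\boldsymbol{\omega}_n)p(\boldsymbol{\omega}_n)$. Assumption (A1): there is a neural network $f_{\boldsymbol{\theta}_{0n}}$ with $k_n$ nodes such that $\|f_{\boldsymbol{\theta}_{0n}}-f_0\|_2=o(n^{-\delta})$. Assumption (A2): its coefficients satisfy $\sum_{i=1}^{K(n)}\theta_{i0n}^2=o(n^{1-\delta})$. Variational family (Gaussian mean field): $\mathcal{Q}_n=\{q(\boldsymbol{\omega}_n)=\prod_{i=1}^{K(n)}N(\theta_{in};\tilde m_{in},\tilde s_{in}^2)\}$, and the variational posterior is $\pi^*=\arg\min_{q\in\mathcal{Q}_n} d_{KL}(q,\pi(\cdot|\boldsymbol{y}_n,\boldsymbol{X}_n))$. Hellinger neighborhood: $\mathcal{V}_\varepsilon=\{\boldsymbol{\omega}_n: d_H(l_0,l_{\boldsymbol{\omega}_n})<\varepsilon\}$ with $d_H(l_0,l_{\boldsymbol{\omega}_n})=\int\int(\sqrt{l_{\boldsymbol{\omega}_n}(\boldsymbol{x},y)}-\sqrt{l_0(\boldsymbol{x},y)})^2d\boldsymbol{x}\,dy$. *)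

(* Defs.v *)
From HB Require Import structures.
From mathcomp Require Import all_boot all_order all_algebra.
From mathcomp Require Import all_classical all_reals.
From mathcomp Require Import ereal topology normedtype sequences exp measure
  lebesgue_measure lebesgue_integral probability normal_distribution.
Unset Printing Implicit Defensive.
Import Order.TTheory GRing.Theory Num.Theory.
Import numFieldNormedType.Exports.
Local Open Scope classical_set_scope.
Local Open Scope ring_scope.

Section defs.
Variable R : realType.

(* Lebesgue integral over R^n (of an extended-real valued function), written
   as the iterated integral of one-dimensional Lebesgue integrals. *)
Fixpoint iint (n : nat) : (n.-tuple R -> \bar R) -> \bar R :=
  match n return (n.-tuple R -> \bar R) -> \bar R with
  | 0 => fun f => f [tuple]
  | n'.+1 => fun f =>
      (\int[@lebesgue_measure R]_x iint n' (fun t => f (cons_tuple x t)))%E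
  end.

Definition iintR (n : nat) (g : n.-tuple R -> R) : \bar R :=
  (iint n (fun t => (Num.max (g t) 0)%:E) - iint n (fun t => (Num.max (- g t) 0)%:E))%E.

Definition in_cube (p : nat) (x : p.-tuple R) : bool :=
  all (fun u => (0 <= u) && (u <= 1)) x.

(* integral over [0,1]^p (Lebesgue measure = law of U(0,1)^p) *)
Definition cube_int (p : nat) (f : p.-tuple R -> \bar R) : \bar R :=
  iint p (fun x => if in_cube p x then f x else 0%E).

Definition psi (u : R) : R := 1 / (1 + expR (- u)).

Definition Kdim (k p : nat) : nat := (1 + k * (p + 1))%N.

(* one-hidden-layer network; parameter layout:
   theta_0 = beta_0, theta_(1+j) = beta_(j+1) (j < k),
   theta_(1+k+j*p+h) = gamma_(j+1,h+1) (j < k, h < p). *)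
Definition nnet (k p : nat) (theta : seq R) (x : p.-tuple R) : R :=
  theta`_0 + \sum_(j < k) theta`_(j.+1) *
    psi (\sum_(h < p) theta`_(1 + k + j * p + h) * tnth x h).

Definition cond_dens (sigma0 : R) (p : nat) (f : p.-tuple R -> R)
  (y : R) (x : p.-tuple R) : R := normal_pdf (f x) sigma0 y.

Definition dH (sigma0 : R) (p : nat) (f0 : p.-tuple R -> R) (k : nat)
  (theta : seq R) : \bar R :=
  cube_int p (fun x => (\int[@lebesgue_measure R]_y
    ((Num.sqrt (cond_dens sigma0 p (nnet k p theta) y x)
      - Num.sqrt (cond_dens sigma0 p f0 y x)) ^+ 2)%:E)%E).

Definition prior_dens (zeta : R) (K : nat) (theta : K.-tuple R) : R :=
  \prod_(i < K) normal_pdf 0 zeta (tnth theta i).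

Definition mf_dens (K : nat) (m s : K.-tuple R) (theta : K.-tuple R) : R :=
  \prod_(i < K) normal_pdf (tnth m i) (tnth s i) (tnth theta i).

Definition mf_admissible (K : nat) (s : K.-tuple R) : Prop :=
  forall i : 'I_K, 0 < tnth s i.

Definition KLdiv (K : nat) (q pi : K.-tuple R -> R) : \bar R :=
  iintR K (fun t => q t * ln (q t / pi t)).

Definition L2cube (p : nat) (g : p.-tuple R -> R) : \bar R :=
  ((cube_int p (fun x => (g x ^+ 2)%:E)) `^ (2^-1))%E.

Section data.
Context (d : measure_display) (Omega : measurableType d)
  (P : probability Omega R).

(* outer probability (the event need not be measurable) *)
Definition outer_prob (A : set Omega) : \bar R :=
  ereal_inf [set P E | E in [set E | measurable E /\ A `<=` E]].

Definition mutually_independent (I : eqType) (Z : I -> Omega -> R) : Prop :=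
  (forall i, measurable_fun setT (Z i)) /\
  forall (s : seq I), uniq s -> forall B : I -> set R,
    (forall i, measurable (B i)) ->
    P (\bigcap_(i in [set j | j \in s]) (Z i @^-1` B i)) =
    (\prod_(i <- s) P (Z i @^-1` B i))%E.

Definition obs_family (p : nat) (X : nat -> 'I_p -> Omega -> R)
  (xi : nat -> Omega -> R) (ih : nat * option 'I_p) : Omega -> R :=
  match ih.2 with Some h => X ih.1 h | None => xi ih.1 end.

Definition xvec (p : nat) (X : nat -> 'I_p -> Omega -> R) (i : nat)
  (w : Omega) : p.-tuple R := [tuple X i h w | h < p].

Definition likelihood (sigma0 : R) (p k n : nat) (X : nat -> 'I_p -> Omega -> R)
  (y : nat -> Omega -> R) (w : Omega) (theta : seq R) : R :=
  \prod_(i < n) normal_pdf (nnet k p theta (xvec p X i w)) sigma0 (y i w).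

Definition post_dens (sigma0 zeta : R) (p k n : nat)
  (X : nat -> 'I_p -> Omega -> R) (y : nat -> Omega -> R) (w : Omega)
  (theta : (Kdim k p).-tuple R) : R :=
  likelihood sigma0 p k n X y w theta * prior_dens zeta (Kdim k p) theta /
  fine (iint (Kdim k p) (fun t : (Kdim k p).-tuple R =>
                (likelihood sigma0 p k n X y w t * prior_dens zeta (Kdim k p) t)%:E)).

Definition is_variational_posterior (sigma0 zeta : R) (p k n : nat)
  (X : nat -> 'I_p -> Omega -> R) (y : nat -> Omega -> R) (w : Omega)
  (m s : (Kdim k p).-tuple R) : Prop :=
  (mf_admissible (Kdim k p) s) /\
  (forall m' s' : (Kdim k p).-tuple R, mf_admissible (Kdim k p) s' ->
    (KLdiv (Kdim k p) (mf_dens (Kdim k p) m s) (post_dens sigma0 zeta p k n X y w)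
     <= KLdiv (Kdim k p) (mf_dens (Kdim k p) m' s') (post_dens sigma0 zeta p k n X y w))%E).

End data.

Definition mass_outside_hellinger (sigma0 : R) (p : nat) (f0 : p.-tuple R -> R)
  (k : nat) (eps : R) (m s : (Kdim k p).-tuple R) : \bar R :=
  iint (Kdim k p) (fun theta =>
    (if (eps%:E <= dH sigma0 p f0 k theta)%E
     then mf_dens (Kdim k p) m s theta else 0)%:E).
End defs.

Arguments iint {R} n f.
Arguments iintR {R} n g.
Arguments in_cube {R} p x.
Arguments cube_int {R} p f.
Arguments psi {R} u.
Arguments nnet {R} k p theta x.
Arguments cond_dens {R} sigma0 p f y x.
Arguments dH {R} sigma0 p f0 k theta.
Arguments prior_dens {R} zeta K theta.
Arguments mf_dens {R} K m s theta.
Arguments mf_admissible {R} K s.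
Arguments KLdiv {R} K q pi.
Arguments L2cube {R} p g.
Arguments outer_prob {R d Omega} P A.
Arguments mutually_independent {R d Omega} P {I} Z.
Arguments obs_family {R d Omega} p X xi ih.
Arguments xvec {R d Omega} p X i w.
Arguments likelihood {R d Omega} sigma0 p k n X y w theta.
Arguments post_dens {R d Omega} sigma0 zeta p k n X y w theta.
Arguments is_variational_posterior {R d Omega} sigma0 zeta p k n X y w m s.
Arguments mass_outside_hellinger {R} sigma0 p f0 k eps m s.

(* Main.v *)
Require Import Defs.
From HB Require Import structures.
From mathcomp Require Import all_boot all_order all_algebra.
From mathcomp Require Import ring lra.
From mathcomp Require Import all_classical all_reals.
From mathcomp Require Import ereal topology normedtype sequences exp measure
  measurable_realfun lebesgue_measure lebesgue_integral probability
  normal_distribution numfun trigo.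
Set Implicit Arguments.
Unset Strict Implicit.
Unset Printing Implicit Defensive.
Import Order.TTheory GRing.Theory Num.Theory.
Import numFieldNormedType.Exports.
Local Open Scope classical_set_scope.
Local Open Scope ring_scope.

(** Let [l_t] be the log-likelihood ratio of the parameter [t] against the truth.
    By the Gibbs variational principle, comparing the minimizer pi* with a single
    Gaussian q, centred at theta_0n with standard deviations n^-8, gives for every
    set B of parameters and every c >= 0

      c pi*(B) <= KL(q, prior) - \int l dq + log \int exp (l + c 1_B) d prior.

    Take for B the complement of the Hellinger neighborhood and c = n eps / 2. The last
    term is O(log n) with high probability. Outside of the sieve {|t_i| <= n} this
    is because E exp l_t = 1 and the prior mass is tiny; inside, because
    E exp (l_t / 2) = (affinity)^n <= (1 - eps / 2)^n <= exp (- n eps / 2) on B,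
    and because l varies so little on a small cell that a union bound over a grid
    of n^O(K) = e^o(n) cells suffices. By (A1), (A2) and K log n = o(n^(1 - delta)),
    the first two terms are o(n^(1 - delta)) in probability. *)

(** Two obstacles shape the estimates. [f0] is only measurable and close in L2 to a network, so
    residuals have no pointwise bound; at the centre they enter through [fit_stat], a sum over the
    sample whose mean is controlled by (A1) and whose size follows from Markov's inequality. The
    cross term between noise and residual must also be o(n^(1 - delta)): AM-GM with weight tau = e /
    n^delta leaves, after normalization by n^delta / n, a multiple of e for the noise and of n^(2
    delta) |f_theta0n - f0|^2 / e <= e for the approximation. So the rate (A1) for the norm
    suffices, and e is tied to the target probability only at the end. The deviations n^-8 and the
    grid mesh n^-10 are powers small enough to absorb every polynomial factor; they only change the
    constant in front of K log n. The minimizer may depend on the sample in a nonmeasurable way: the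
    argument is deterministic off a measurable exceptional event, and only that event is given a
    probability bound. Since [dH] is a squared distance, it is affine in the mean affinity: dH = 2 -
    2 E(affinity). *)

(* The library's sigma-finiteness instance for [m1 \x m2] is shadowed by its
   later instance for products of probability measures. *)
Lemma sigma_finite_product {d1 d2} {T1 : measurableType d1}
    {T2 : measurableType d2} {R : realType}
    (m1 : {sigma_finite_measure set T1 -> \bar R})
    (m2 : {sigma_finite_measure set T2 -> \bar R}) :
  sigma_finite setT (m1 \x m2)%E.
Proof.
have /sigma_finiteP[F [TF ndF Foo]] := sigma_finiteT m1.
have /sigma_finiteP[G [TG ndG Goo]] := sigma_finiteT m2.
exists (fun n => F n `*` G n).
  apply/esym; rewrite -subTset -setXTT TF TG => -[x y] [/= [n _ Fx] [l _ Gy]].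
  exists (maxn n l) => //; split.
  - by move: x Fx; exact/subsetPset/ndF/leq_maxl.
  - by move: y Gy; exact/subsetPset/ndG/leq_maxr.
move=> l; have [mF Fy] := Foo l; have [mG Gy] := Goo l.
split; first exact: measurableX.
by rewrite product_measure1E// lte_mul_pinfty// ge0_fin_numE.
Qed.

(** * Lebesgue measure on tuples *)

Section tuple_measure.
Context {R : realType}.

Lemma measurable_cons_pair n :
  measurable_fun setT (fun z : R * n.-tuple R => cons_tuple z.1 z.2).
Proof. exact: measurable_cons. Qed.

Lemma measurable_uncons n :
  measurable_fun setT (fun t : n.+1.-tuple R => (thead t, behead_tuple t)).
Proof.
apply/measurable_fun_pair.
  exact: (measurable_tnth ord0).
exact: measurable_behead.
Qed.

(* Realizes the iterated integral as the integral against a genuine measure, so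
   that Tonelli and the integration lemmas of the library apply to it. *)
Lemma iint_measure n : exists mu : {sigma_finite_measure set (n.-tuple R) -> \bar R},
  forall f : n.-tuple R -> \bar R, measurable_fun setT f -> (forall t, 0 <= f t)%E ->
  iint n f = (\int[mu]_t f t)%E.
Proof.
elim: n => [|n [mu IH]].
  exists (dirac ([tuple] : 0.-tuple R)) => f mf f0.
  by rewrite integral_dirac// diracE in_setT mul1e.
pose cons (z : R * n.-tuple R) : n.+1.-tuple R := cons_tuple z.1 z.2.
have mcons : measurable_fun setT cons by exact: measurable_cons_pair.
pose nu0 := pushforward (@lebesgue_measure R \x mu)%E cons.
pose nu : {measure set (n.+1.-tuple R) -> \bar R} :=
  measure_function_pushforward__canonical__measure_function_Measure
    (@lebesgue_measure R \x mu)%E mcons.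
have snu : sigma_finite setT nu.
  have [F UF mF] := sigma_finite_product (@lebesgue_measure R) mu.
  pose G k := (fun t : n.+1.-tuple R => (thead t, behead_tuple t)) @^-1` F k.
  exists G.
    by rewrite /G -preimage_bigcup -UF preimage_setT.
  move=> k; have [mFk Fk] := mF k; split.
    by rewrite -[G k]setTI; exact: measurable_uncons.
  rewrite /nu /nu0 /= /pushforward.
  suff -> : cons @^-1` G k = F k by [].
  apply/seteqP; split=> -[x t] /=; rewrite /G /cons /= theadE.
    by congr (F k (_, _)); exact/val_inj.
  by congr (F k (_, _)); exact/val_inj.
pose M := Measure_isSigmaFinite.Build _ _ _ nu snu.
pose nus : {sigma_finite_measure set (n.+1.-tuple R) -> \bar R} := HB.pack (Measure.sort nu) M.
exists nus => f mf f0 /=.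
transitivity (\int[lebesgue_measure]_x \int[mu]_t f (cons (x, t)))%E.
  apply: eq_integral => x _; rewrite IH//.
  exact: (measurableT_comp mf (measurableT_comp mcons (pair1_measurable x))).
rewrite ge0_integral_pushforward//= ?preimage_setT.
rewrite fubini_tonelli1//=.
exact: measurableT_comp.
Qed.

(** Everything known about this chosen measure is [iintE], which turns an iterated integral into a
    single one for nonnegative measurable integrands. *)
Definition tuple_leb n : {sigma_finite_measure set (n.-tuple R) -> \bar R} :=
  sval (cid (iint_measure n)).

Lemma iintE n (f : n.-tuple R -> \bar R) : measurable_fun setT f ->
  (forall t, 0 <= f t)%E -> iint n f = (\int[tuple_leb n]_t f t)%E.
Proof. exact: (svalP (cid (iint_measure n))). Qed.

Lemma measurable_prod_tnth n (f : 'I_n -> R -> R) :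
  (forall i, measurable_fun setT (f i)) ->
  measurable_fun setT (fun t : n.-tuple R => \prod_(i < n) f i (tnth t i)).
Proof.
move=> mf; apply: measurable_prod => i _.
by apply: measurableT_comp => //; exact: measurable_tnth.
Qed.

Lemma iint_prod n (f : 'I_n -> R -> R) :
  (forall i, measurable_fun setT (f i)) -> (forall i x, 0 <= f i x) ->
  iint n (fun t => (\prod_(i < n) f i (tnth t i))%:E) =
  (\prod_(i < n) \int[@lebesgue_measure R]_x (f i x)%:E)%E.
Proof.
elim: n f => [|n IH] f mf f0 /=; first by rewrite !big_ord0.
rewrite big_ord_recl -IH//.
have m0 : measurable_fun setT
    (fun t : n.-tuple R => (\prod_(i < n) f (lift ord0 i) (tnth t i))%:E).
  by apply/measurable_EFinP; exact: (@measurable_prod_tnth n (fun i => f (lift ord0 i))).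
have ge0 (t : n.-tuple R) : (0 <= (\prod_(i < n) f (lift ord0 i) (tnth t i))%:E)%E.
  by rewrite lee_fin prodr_ge0.
rewrite -ge0_integralZr//=; last 3 first.
- by apply/measurable_EFinP; exact: mf.
- by move=> x _; rewrite lee_fin.
- by rewrite iintE// integral_ge0.
apply: eq_integral => x _.
transitivity (iint n (fun t => (f ord0 x)%:E *
    (\prod_(i < n) f (lift ord0 i) (tnth t i))%:E)%E).
  congr iint; apply/funext => t; rewrite big_ord_recl -EFinM; congr (_ * _)%:E.
  by apply: eq_bigr => i _; rewrite tnthS.
rewrite !iintE//; last 2 first.
- exact: measurable_funeM.
- by move=> t; rewrite mule_ge0// lee_fin.
by rewrite ge0_integralZl// lee_fin.
Qed.
End tuple_measure.

(** * Gaussian densities and their moments *)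

Section normal_facts.
Context {R : realType}.
Implicit Types m s x z : R.

Lemma normal_pdf_gt0 m s x : s != 0 -> 0 < normal_pdf m s x.
Proof. by move=> s0; rewrite normal_pdfE// mulr_gt0 ?normal_peak_gt0 ?expR_gt0. Qed.

(** The extra factor cancels half of the exponent, which doubles the variance; [Num.sqrt 2] is the
    ratio of the two peaks. *)
Lemma normal_pdf_wider m s x : s != 0 ->
  normal_pdf m s x * expR ((x - m) ^+ 2 / (s ^+ 2 *+ 4)) =
  Num.sqrt 2 * normal_pdf m (Num.sqrt 2 * s) x.
Proof.
move=> s0; have r0 : Num.sqrt 2 != 0 :> R by rewrite gt_eqF// sqrtr_gt0.
rewrite !normal_pdfE ?mulf_neq0// -mulrA -expRD mulrA; congr (_ * _).
  rewrite /normal_peak exprMn sqr_sqrtr//.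
  have -> : 2 * s ^+ 2 * pi *+ 2 = 2 * (s ^+ 2 * pi *+ 2) by ring.
  by rewrite sqrtrM// invfM mulrA divff ?mul1r.
congr expR; rewrite exprMn sqr_sqrtr// mulNr.
have s2 : s ^+ 2 != 0 by rewrite expf_neq0.
by field.
Qed.

(* By [u <= expR u] at [u = (x - m) ^+ 2 / (4 s ^+ 2)], the square is absorbed
   into a wider Gaussian density. *)
Lemma normal_second_moment_le m s : s != 0 ->
  (\int[@lebesgue_measure R]_x (normal_pdf m s x * (x - m) ^+ 2)%:E
    <= (8 * s ^+ 2)%:E)%E.
Proof.
move=> s0; have s20 : 0 < s ^+ 2 by rewrite exprn_even_gt0.
have r2 : Num.sqrt 2 <= 2 :> R.
  by rewrite -[leRHS]ger0_norm// -sqrtr_sqr ler_sqrt ?sqr_ge0//; lra.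
have r0 : Num.sqrt 2 != 0 :> R by rewrite gt_eqF// sqrtr_gt0.
apply: (@le_trans _ _ (\int[@lebesgue_measure R]_x
    ((8 * s ^+ 2)%:E * (normal_pdf m (Num.sqrt 2 * s) x)%:E))%E).
  apply: ge0_le_integral => //.
  - by move=> x _; rewrite lee_fin mulr_ge0// ?normal_pdf_ge0 ?sqr_ge0.
  - apply/measurable_EFinP; apply: measurable_funM.
      exact: measurable_normal_pdf.
    by apply: measurable_funX; exact: measurable_funB.
  - by apply: measurable_funeM; apply/measurable_EFinP; exact: measurable_normal_pdf.
  move=> x _; rewrite -EFinM lee_fin.
  have H : (x - m) ^+ 2 <= s ^+ 2 *+ 4 * expR ((x - m) ^+ 2 / (s ^+ 2 *+ 4)).
    rewrite -ler_pdivrMl ?pmulrn_lgt0// mulrC.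
    by apply: le_trans (expR_ge1Dx _); rewrite lerDr.
  apply: le_trans (ler_wpM2l (normal_pdf_ge0 _ _ _) H) _.
  rewrite mulrCA normal_pdf_wider// mulrA ler_wpM2r ?normal_pdf_ge0//.
  have H2 : 0 <= (2 - Num.sqrt 2) * s ^+ 2 by rewrite mulr_ge0 ?subr_ge0// ltW.
  by nra.
rewrite ge0_integralZl//=; last 3 first.
- by apply/measurable_EFinP; exact: measurable_normal_pdf.
- by move=> x _; rewrite lee_fin normal_pdf_ge0.
- by rewrite lee_fin mulr_ge0// sqr_ge0.
by rewrite integral_normal_pdf mule1.
Qed.

(** The exponential moment behind the Gaussian tail estimate [prior_outside_sieve]. *)
Lemma integral_normal_expR z : z != 0 ->
  (\int[@lebesgue_measure R]_x
    (normal_pdf 0 z x * expR (x ^+ 2 / (z ^+ 2 *+ 4)))%:E = (Num.sqrt 2)%:E)%E.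
Proof.
move=> z0.
transitivity (\int[@lebesgue_measure R]_x
    ((Num.sqrt 2)%:E * (normal_pdf 0 (Num.sqrt 2 * z) x)%:E))%E.
  apply: eq_integral => x _; rewrite -EFinM -normal_pdf_wider// subr0//.
rewrite ge0_integralZl//=; last 2 first.
- by apply/measurable_EFinP; exact: measurable_normal_pdf.
- by move=> x _; rewrite lee_fin normal_pdf_ge0.
by rewrite integral_normal_pdf mule1.
Qed.

Lemma measurable_mf_dens K (m s : K.-tuple R) : measurable_fun setT (mf_dens K m s).
Proof.
rewrite /mf_dens.
apply: (@measurable_prod_tnth _ K (fun i => normal_pdf (tnth m i) (tnth s i))) => i.
exact: measurable_normal_pdf.
Qed.

Lemma mf_dens_gt0 K (m s t : K.-tuple R) : mf_admissible K s -> 0 < mf_dens K m s t.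
Proof. by move=> s0; apply: prodr_gt0 => i _; rewrite normal_pdf_gt0// gt_eqF. Qed.

(** The density is a product, so every factor but the [i]-th integrates to one. *)
Lemma iint_mf_dens_tnth K (m s : K.-tuple R) (i : 'I_K) (f : R -> R) :
  measurable_fun setT f -> (forall x, 0 <= f x) ->
  iint K (fun t => (mf_dens K m s t * f (tnth t i))%:E) =
  (\int[@lebesgue_measure R]_x (normal_pdf (tnth m i) (tnth s i) x * f x)%:E)%E.
Proof.
move=> mf f0.
pose g j x := normal_pdf (tnth m j) (tnth s j) x * (if j == i then f x else 1).
transitivity (iint K (fun t => (\prod_(j < K) g j (tnth t j))%:E)).
  congr iint; apply/funext => t; rewrite big_split/=; congr (_ * _)%:E.
  by rewrite -big_mkcond/= big_pred1_eq.
rewrite iint_prod.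
- rewrite (bigD1 i)//= big1 ?mule1 => [|j ji]; last first.
    rewrite -[RHS](integral_normal_pdf (tnth m j) (tnth s j)).
    by apply: eq_integral => x _; rewrite /g (negbTE ji) mulr1.
  by apply: eq_integral => x _; rewrite /g eqxx.
- move=> j; apply: measurable_funM; first exact: measurable_normal_pdf.
  by case: (j == i).
- by move=> j x; rewrite mulr_ge0 ?normal_pdf_ge0//; case: ifP.
Qed.

Lemma iint_mf_dens K (m s : K.-tuple R) : iint K (fun t => (mf_dens K m s t)%:E) = 1%E.
Proof.
rewrite /mf_dens (@iint_prod _ K (fun i => normal_pdf (tnth m i) (tnth s i))).
- by rewrite big1// => i _; exact: integral_normal_pdf.
- by move=> i; exact: measurable_normal_pdf.
- by move=> i x; exact: normal_pdf_ge0.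
Qed.
End normal_facts.

(** * Integration against a measure with a density *)

Section density.
Local Open Scope ereal_scope.
Import HBNNSimple.
Context d (T : measurableType d) (R : realType).
Variables (mu nu : {measure set T -> \bar R}) (g : T -> R).
Hypotheses (mg : measurable_fun setT g) (g0 : forall x, (0 <= g x)%R).
Hypothesis nuE : forall A, measurable A -> nu A = \int[mu]_(x in A) (g x)%:E.

(** Indicators are [nuE], simple functions follow by linearity, and monotone convergence along
    [nnsfun_approx] gives the general case. *)
Lemma ge0_integral_density (f : T -> \bar R) :
  measurable_fun setT f -> (forall x, 0 <= f x) ->
  \int[nu]_x f x = \int[mu]_x (f x * (g x)%:E).
Proof.
move=> mf f0.
pose f_ := nnsfun_approx measurableT mf.
have mEg : measurable_fun setT (EFin \o g) by exact/measurable_EFinP.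
have cvgf x : (f_ n x)%:E @[n --> \oo] --> f x by exact: cvg_nnsfun_approx.
transitivity (limn (fun n => \int[nu]_x (f_ n x)%:E)).
  rewrite -monotone_convergence//.
  - by apply: eq_integral => y _; apply/esym/cvg_lim => //; exact: cvgf.
  - by move=> n; exact/measurable_EFinP/measurable_funP.
  - by move=> n y _; rewrite lee_fin.
  - by move=> y _ m n mn; rewrite lee_fin; exact/lefP/nd_nnsfun_approx.
transitivity (limn (fun n => \int[mu]_x ((f_ n x)%:E * (g x)%:E))); last first.
  rewrite -monotone_convergence//.
  - apply: eq_integral => y _; apply/cvg_lim => //.
    apply: cvgeZr => //; exact: cvgf.
  - by move=> n; apply: emeasurable_funM => //; exact/measurable_EFinP/measurable_funP.
  - by move=> n y _; rewrite mule_ge0// lee_fin.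
  - move=> y _ m n mn; rewrite lee_wpmul2r ?lee_fin//.
    by exact/lefP/nd_nnsfun_approx.
congr (limn _); apply/funext => n.
rewrite integralT_nnsfun sintegralE.
transitivity (\int[mu]_x \sum_(k \in range (f_ n))
    ((k * \1_(f_ n @^-1` [set k]) x)%:E * (g x)%:E)); last first.
  apply: eq_integral => x _; rewrite fimfunE -fsumEFin// ge0_mule_fsuml//.
  by move=> r; exact: nnfun_muleindic_ge0.
rewrite ge0_integral_fsum//; last 2 first.
- move=> r; apply: emeasurable_funM => //; apply/measurable_EFinP.
  exact: measurable_funM.
- by move=> r x _; rewrite mule_ge0 ?lee_fin// -lee_fin; exact: nnfun_muleindic_ge0.
apply: eq_fsbigr => r; rewrite inE => -[x0 _ <-].
rewrite nuE// integral_mkcond epatch_indic -ge0_integralZl//; last 3 first.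
- apply: emeasurable_funM => //; exact/measurable_EFinP.
- by move=> x _; rewrite mule_ge0 ?lee_fin.
- by rewrite lee_fin.
by apply: eq_integral => x _ /=; rewrite EFinM -muleA; congr (_ * _); rewrite muleC.
Qed.
End density.

(** * From independent events to product integrals *)

Section independence.
Local Open Scope ereal_scope.
Context d (Omega : measurableType d) (R : realType) (P : probability Omega R).

(** The events independent of a fixed [B] form a Dynkin system, and the Dynkin system generated by
    the intersection-stable [G] is its sigma-algebra. *)
Lemma indep_dynkin (G : set (set Omega)) (B : set Omega) :
  setI_closed G -> G `<=` measurable -> measurable B ->
  (forall A, G A -> P (A `&` B) = P A * P B) ->
  forall A, <<s G >> A -> P (A `&` B) = P A * P B.
Proof.
move=> GI mG mB indG A sA.
pose H := [set A | measurable A /\ P (A `&` B) = P A * P B].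
suff : <<d G >> `<=` H by rewrite setI_closed_g_dynkin_g_sigma_algebra// => /(_ _ sA)[].
apply: smallest_sub; last by move=> C GC; split; [exact: mG|exact: indG].
split.
- by split=> //; rewrite setTI probability_setT mul1e.
- move=> C [mC PC]; split; first exact: measurableC.
  have -> : ~` C `&` B = B `\` C by rewrite setIC.
  rewrite measureD ?ltey_eq ?fin_num_measure// probability_setC// setIC.
  by rewrite [X in _ - X]PC muleBl ?fin_num_adde_defr ?fin_num_measure// mul1e.
- move=> F tF HF; split; first by apply: bigcupT_measurable => i; exact: (HF i).1.
  have mF i : setT i -> measurable (F i) by move=> _; exact: (HF i).1.
  have mFB i : setT i -> measurable (F i `&` B).
    by move=> _; apply: measurableI => //; exact: mF.
  have tFB : trivIset setT (fun i => F i `&` B) by exact: trivIset_setIr.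
  rewrite setI_bigcupl !measure_bigcup//=.
  have PB : P B = (fine (P B))%:E by rewrite fineK// fin_num_measure.
  rewrite [RHS]muleC PB -nneseriesZl//.
  by apply: eq_eseriesr => i _; rewrite (HF i).2 -PB muleC.
Qed.

(** One side is extended at a time: for a generator [A] the second event is enlarged from [G2] to
    its sigma-algebra, and then [A] itself is enlarged. *)
Lemma indep_g_sigma_algebra (G1 G2 : set (set Omega)) :
  setI_closed G1 -> setI_closed G2 -> G1 `<=` measurable -> G2 `<=` measurable ->
  (forall A B, G1 A -> G2 B -> P (A `&` B) = P A * P B) ->
  forall A B, <<s G1 >> A -> <<s G2 >> B -> P (A `&` B) = P A * P B.
Proof.
move=> G1I G2I mG1 mG2 ind A B sA sB.
have sub (G : set (set Omega)) : G `<=` measurable -> <<s G >> `<=` measurable.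
  by move=> mG; apply: smallest_sub => //; exact: sigma_algebra_measurable.
apply: (@indep_dynkin G1) sA => //; first exact: sub sB.
move=> {}A GA; rewrite setIC muleC; apply: (@indep_dynkin G2) sB => //; first exact: mG1.
by move=> {}B GB; rewrite setIC muleC; exact: ind.
Qed.

(** The joint law of [U] and [V] agrees with the product of the marginals on rectangles, hence
    everywhere by uniqueness of the product measure; Tonelli's theorem concludes. *)
Lemma indep_integral d1 d2 (T1 : measurableType d1) (T2 : measurableType d2)
    (U : Omega -> T1) (V : Omega -> T2) (F : T1 * T2 -> \bar R) :
  measurable_fun setT U -> measurable_fun setT V ->
  (forall A B, measurable A -> measurable B ->
    P (U @^-1` A `&` V @^-1` B) = P (U @^-1` A) * P (V @^-1` B)) ->
  measurable_fun setT F -> (forall z, 0 <= F z) ->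
  \int[P]_w F (U w, V w) = \int[P]_w \int[P]_v F (U w, V v).
Proof.
move=> mU mV ind mF F0.
pose U' : {mfun Omega >-> T1} := HB.pack U (isMeasurableFun.Build _ _ _ _ U mU).
pose V' : {mfun Omega >-> T2} := HB.pack V (isMeasurableFun.Build _ _ _ _ V mV).
pose PU : probability T1 R := distribution P U'.
pose PV : probability T2 R := distribution P V'.
pose W w := (U w, V w).
have mW : measurable_fun setT W by exact/measurable_fun_pair.
pose PW : {measure set (T1 * T2) -> \bar R} :=
  measure_function_pushforward__canonical__measure_function_Measure P mW.
transitivity (\int[PW]_z F z).
  by rewrite ge0_integral_pushforward//= preimage_setT.
transitivity (\int[PU \x PV]_z F z).
  apply: eq_measure_integral => A mA _.
  by apply/esym; apply: (@product_measure_unique _ _ _ _ _ PU PV PW) => // ? ? ? ?; exact: ind.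
rewrite fubini_tonelli1//.
have mFF : measurable_fun setT (fubini_F PV F) by exact: measurable_fun_fubini_tonelli_F.
rewrite ge0_integral_pushforward//; last first.
  by move=> x _; apply: integral_ge0.
rewrite preimage_setT; apply: eq_integral => w _ /=.
rewrite /fubini_F ge0_integral_pushforward//.
  exact: measurableT_comp.
Qed.
End independence.

(** * Independent blocks of coordinates *)

Section cylinders.
Local Open Scope ereal_scope.
Context d (Omega : measurableType d) (R : realType) (P : probability Omega R).
Context (I : choiceType) (Z : I -> Omega -> R).

(** A pi-system generating the information carried by the coordinates in [s]. The constraint [B] is
    total on [I], so that intersections are taken index by index. *)
Definition cylinders (s : seq I) : set (set Omega) :=
  [set A | exists2 B : I -> set R, (forall i, measurable (B i)) &
    A = \bigcap_(i in [set j | j \in s]) (Z i @^-1` B i)].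

Lemma sub_cylinders s t : {subset s <= t} -> cylinders s `<=` cylinders t.
Proof.
move=> st _ [B mB ->]; exists (fun i => if i \in s then B i else setT).
  by move=> i; case: ifP.
apply/seteqP; split=> w H i /= si.
  by case: ifPn => // is_; exact: H.
by have := H i (st _ si); rewrite /= si.
Qed.

Lemma setI_closed_cylinders s : setI_closed (cylinders s).
Proof.
move=> _ _ [B mB ->] [C mC ->]; exists (fun i => B i `&` C i).
  by move=> i; exact: measurableI.
by rewrite -bigcapI.
Qed.

Lemma cylinders_coord s i (B : set R) :
  i \in s -> measurable B -> cylinders s (Z i @^-1` B).
Proof.
move=> si mB; exists (fun j => if j == i then B else setT).
  by move=> j; case: ifP.
apply/seteqP; split=> [w Bw j /= _|w /(_ i si) /=]; last by rewrite eqxx.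
by case: eqP => // ->.
Qed.

(** Measurability for the sigma-algebra generated by the coordinates in [s], phrased through
    preimages, the form in which [indep_g_sigma_algebra] consumes it. *)
Definition block_measurable (s : seq I) d' (T : measurableType d') (f : Omega -> T) :=
  forall B, measurable B -> <<s cylinders s >> (f @^-1` B).

Lemma block_measurableP (s : seq I) d' (T : measurableType d') (f : Omega -> T) :
  block_measurable s f <->
  measurable_fun (setT : set (g_sigma_algebraType (cylinders s))) f.
Proof.
split=> H; first by move=> _ B mB; rewrite setTI; exact: H.
by move=> B mB; rewrite -[_ @^-1` _]setTI; exact: H.
Qed.

Lemma sub_block_measurable (s t : seq I) d' (T : measurableType d') (f : Omega -> T) :
  {subset s <= t} -> block_measurable s f -> block_measurable t f.
Proof.
move=> st mf B mB; have := mf _ mB; apply: sub_sigma_algebra2; exact: sub_cylinders.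
Qed.

Lemma block_measurable_coord s i : i \in s -> block_measurable s (Z i).
Proof. by move=> si B mB; apply: sub_sigma_algebra; exact: cylinders_coord. Qed.

Hypothesis indZ : mutually_independent P Z.

Lemma measurable_cylinders s : cylinders s `<=` measurable.
Proof.
move=> _ [B mB ->]; rewrite bigcap_seq; apply: bigsetI_measurable => i _.
by rewrite -[X in measurable X]setTI; exact: (indZ.1 i).
Qed.

(** As [s] and [t] are disjoint, the two families of constraints glue to a single family [c] over
    [s ++ t], to which mutual independence applies. *)
Lemma indep_cylinders s t A B : uniq (s ++ t) ->
  cylinders s A -> cylinders t B -> P (A `&` B) = P A * P B.
Proof.
move=> ust [a ma ->] [b mb ->].
have /and3P[us /hasPn ts ut] : [&& uniq s, ~~ has (mem s) t & uniq t].
  by rewrite -cat_uniq.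
pose c i := if i \in s then a i else b i.
have mc i : measurable (c i) by rewrite /c; case: ifP.
transitivity (P (\bigcap_(i in [set j | j \in s ++ t]) (Z i @^-1` c i))).
  congr (P _); apply/seteqP; split=> w.
    move=> [H1 H2] i /=; rewrite mem_cat /c; case: ifPn => [is_ _|_ /=]; first exact: H1.
    exact: H2.
  move=> H; split=> i /= ii; have := H i; rewrite /= mem_cat ii ?orbT/c.
    by rewrite ii; apply.
  by have /negbTE/= -> := ts i ii; apply.
rewrite !indZ.2// big_cat/=; congr (_ * _); rewrite !big_seq.
  by apply: eq_bigr => i is_; rewrite /c is_.
by apply: eq_bigr => i it; rewrite /c; have /negbTE/= -> := ts i it.
Qed.

Lemma block_measurable_measurable s d' (T : measurableType d') (f : Omega -> T) :
  block_measurable s f -> measurable_fun setT f.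
Proof.
move=> mf _ B mB; rewrite setTI; move: (mf _ mB); apply: smallest_sub.
  exact: sigma_algebra_measurable.
exact: measurable_cylinders.
Qed.

Lemma indep_blocks_integral s t d1 d2 (T1 : measurableType d1)
    (T2 : measurableType d2) (U : Omega -> T1) (V : Omega -> T2)
    (F : T1 * T2 -> \bar R) : uniq (s ++ t) ->
  block_measurable s U -> block_measurable t V ->
  measurable_fun setT F -> (forall z, 0 <= F z) ->
  \int[P]_w F (U w, V w) = \int[P]_w \int[P]_v F (U w, V v).
Proof.
move=> ust mU mV; apply: indep_integral.
- exact: block_measurable_measurable mU.
- exact: block_measurable_measurable mV.
- move=> A B mA mB; apply: (@indep_g_sigma_algebra _ _ _ P (cylinders s) (cylinders t)).
  + exact: setI_closed_cylinders.
  + exact: setI_closed_cylinders.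
  + exact: measurable_cylinders.
  + exact: measurable_cylinders.
  + by move=> ? ?; exact: indep_cylinders.
  + exact: mU.
  + exact: mV.
Qed.

(** Induction on [n]: the product of the first [n] factors depends only on the first [n] blocks,
    hence is independent of the next factor. *)
Lemma indep_prod_integral n (s : nat -> seq I) (f : nat -> Omega -> R) :
  (forall i w, (0 <= f i w)%R) -> (forall i, block_measurable (s i) (f i)) ->
  uniq (flatten [seq s i | i <- iota 0 n]) ->
  \int[P]_w (\prod_(i < n) f i w)%:E = \prod_(i < n) \int[P]_w (f i w)%:E.
Proof.
move=> f0 mf; elim: n => [_|n IH].
  rewrite big_ord0; under eq_integral do rewrite big_ord0.
  by rewrite integral_cst// mul1e; exact: probability_setT.
rewrite -addn1 iotaD map_cat flatten_cat/= cats0 add0n => ust.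
have us : uniq (flatten [seq s i | i <- iota 0 n]) by move: ust; rewrite cat_uniq => /andP[].
rewrite addn1 big_ord_recr/= -IH//.
pose U w := (\prod_(i < n) f i w)%R.
have mU : block_measurable (flatten [seq s i | i <- iota 0 n]) U.
  apply/block_measurableP; apply: measurable_prod => i _; apply/block_measurableP.
  apply: sub_block_measurable (mf i) => j ij; apply/flattenP; exists (s i) => //.
  by apply: map_f; rewrite mem_iota/= add0n.
have U0 w : (0 <= U w)%R by exact: prodr_ge0.
(* [F] has to be nonnegative on the whole plane, hence the absolute values; they are invisible on
   the values actually taken. *)
pose F (z : R * R) := (`|z.1| * `|z.2|)%:E.
transitivity (\int[P]_w F (U w, f n w)).
  by apply: eq_integral => w _; rewrite /F/= !ger0_norm// big_ord_recr.
rewrite (indep_blocks_integral ust mU (mf n)).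
- have mfn : measurable_fun setT (fun w => (f n w)%:E).
    by apply/measurable_EFinP; exact: block_measurable_measurable (mf n).
  have mUE : measurable_fun setT (fun w => (U w)%:E).
    by apply/measurable_EFinP; exact: block_measurable_measurable mU.
  rewrite -ge0_integralZr//; last 2 first.
    by move=> w _; rewrite lee_fin; exact: U0.
    by apply: integral_ge0 => w _; rewrite lee_fin.
  apply: eq_integral => w _; rewrite -ge0_integralZl//; last 2 first.
    by move=> v _; rewrite lee_fin.
    by rewrite lee_fin; exact: U0.
  by apply: eq_integral => v _; rewrite /F/= !ger0_norm ?U0.
- apply/measurable_EFinP; apply: measurable_funM; apply: measurableT_comp => //.
- by move=> z; rewrite lee_fin mulr_ge0.
Qed.
End cylinders.

(** * Integrals under one-dimensional laws and under the uniform law of the cube *)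

Lemma measurable_in_cube (R : realType) n :
  measurable_fun setT (in_cube n : n.-tuple R -> bool).
Proof.
elim: n => [|n IH].
  rewrite (_ : in_cube 0 = cst true)//; apply/funext => t.
  by rewrite (tuple0 t).
rewrite (_ : in_cube n.+1 = fun t : n.+1.-tuple R =>
    [&& 0 <= thead t, thead t <= 1 & in_cube n (behead_tuple t)]).
  have mt : measurable_fun setT (fun t : n.+1.-tuple R => thead t).
    exact: (measurable_tnth ord0).
  apply: measurable_and; first exact: measurable_fun_ler.
  apply: measurable_and; first exact: measurable_fun_ler.
  by apply: measurableT_comp => //; exact: measurable_behead.
by apply/funext; case/tupleP => x t; rewrite /in_cube/= theadE andbA.
Qed.

Section laws.
Local Open Scope ereal_scope.
Context d (Omega : measurableType d) (R : realType) (P : probability Omega R).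
Implicit Type Z : Omega -> R.

Lemma law_integral Z (g : R -> R) (f : R -> \bar R) :
  measurable_fun setT Z -> measurable_fun setT g -> (forall x, (0 <= g x)%R) ->
  (forall B : set R, measurable B ->
    P (Z @^-1` B) = \int[@lebesgue_measure R]_(x in B) (g x)%:E) ->
  measurable_fun setT f -> (forall x, 0 <= f x) ->
  \int[P]_w f (Z w) = \int[@lebesgue_measure R]_x (f x * (g x)%:E).
Proof.
move=> mZ mg g0 PZ mf f0.
have mZ' : measurable_fun setT (Z : Omega -> measurableTypeR R) by exact: mZ.
pose PZm : {measure set (measurableTypeR R) -> \bar R} :=
  measure_function_pushforward__canonical__measure_function_Measure P mZ'.
rewrite -(@ge0_integral_density _ _ _ lebesgue_measure PZm g)//.
by rewrite ge0_integral_pushforward//= preimage_setT.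
Qed.

Lemma uniform_integral Z (f : R -> \bar R) : measurable_fun setT Z ->
  (forall B : set R, measurable B ->
     P (Z @^-1` B) = lebesgue_measure (B `&` `[0%R, 1%R]%classic)) ->
  measurable_fun setT f -> (forall x, 0 <= f x) ->
  \int[P]_w f (Z w) =
  \int[@lebesgue_measure R]_x (if (0 <= x <= 1)%R then f x else 0).
Proof.
move=> mZ PZ mf f0; rewrite (law_integral mZ (g := \1_(`[0%R, 1%R]%classic)))//.
- apply: eq_integral => x _; rewrite indicE mem_setE in_itv/=.
  by case: ifP => _; rewrite ?mule1 ?mule0.
- by move=> B mB; rewrite PZ// integral_indic// setIC.
Qed.

Context (I : choiceType) (Z : I -> Omega -> R).
Hypothesis indZ : mutually_independent P Z.

Lemma block_measurable_tuple s m (js : m.-tuple I) : {subset js <= s} ->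
  block_measurable Z s (fun w => map_tuple (Z^~ w) js).
Proof.
move=> js_s; apply/block_measurableP/measurable_fun_tnthP => i /=.
have -> : (tnth (T:=R))^~ i \o (fun w => map_tuple (Z^~ w) js) = Z (tnth js i).
  by apply/funext => w /=; rewrite tnth_map.
apply/block_measurableP; apply: (@block_measurable_coord _ _ _ _ Z).
by apply: js_s; exact: mem_tnth.
Qed.

(** The recursion of [iint] is followed: independence splits off the first coordinate, and the
    remaining ones are integrated by induction. *)
Lemma uniform_tuple_integral m (js : m.-tuple I) (h : m.-tuple R -> \bar R) :
  uniq js ->
  (forall j (B : set R), j \in js -> measurable B ->
     P (Z j @^-1` B) = lebesgue_measure (B `&` `[0%R, 1%R]%classic)) ->
  measurable_fun setT h -> (forall x, 0 <= h x) ->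
  \int[P]_w h (map_tuple (Z^~ w) js) = cube_int m h.
Proof.
elim: m js h => [|m IH] js h ujs law mh h0.
  rewrite /cube_int/=.
  under eq_integral do rewrite (tuple0 (map_tuple _ _)).
  by rewrite integral_cst//= probability_setT mule1.
case/tupleP: js ujs law => j js ujs law.
pose H (z : R * m.-tuple R) := h (cons_tuple z.1 z.2).
have mH : measurable_fun setT H by exact: (measurableT_comp mh (@measurable_cons_pair R m)).
transitivity (\int[P]_w H (Z j w, map_tuple (Z^~ w) js)).
  by apply: eq_integral => w _; congr h; exact: val_inj.
have uj : uniq ([:: j] ++ js) by [].
rewrite (indep_blocks_integral indZ uj)//; last 3 first.
- by apply: (@block_measurable_coord _ _ _ _ Z [:: j] j); rewrite inE.
- exact: block_measurable_tuple.
- by move=> z; exact: h0.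
under eq_integral => w _.
  rewrite (IH _ (fun x => H (Z j w, x))); first over.
  - by move: uj => /andP[].
  - by move=> i B ijs; apply: law; rewrite inE ijs orbT.
  - exact: (measurableT_comp mH).
  - by move=> x; exact: h0.
have mC : measurable_fun setT
    (fun z : R * m.-tuple R => if in_cube m z.2 then H z else 0).
  apply: measurable_fun_ifT => //; apply: measurableT_comp => //.
  exact: measurable_in_cube.
have C0 (z : R * m.-tuple R) : 0 <= (if in_cube m z.2 then H z else 0).
  by case: ifP => // _; exact: h0.
rewrite (uniform_integral (f := fun u => cube_int m (fun x => H (u, x)))).
- rewrite /cube_int /=; apply: eq_integral => x _.
  (* Once the first entry leaves [0, 1], the whole tuple is outside the cube and the inner integral
     vanishes; this is the cutoff produced by [uniform_integral]. *)
  case: ifP => x01.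
    by congr iint; apply/funext => t; rewrite /in_cube/= x01.
  transitivity (iint m (fun=> 0 : \bar R)).
    by rewrite iintE// integral0.
  by congr iint; apply/funext => t; rewrite /in_cube/= x01.
- exact: (indZ.1 j).
- by move=> B mB; apply: law => //; rewrite inE eqxx.
- rewrite /cube_int.
  under eq_fun => u.
    rewrite iintE; first over.
      exact: (measurableT_comp mC).
    by move=> t; exact: (C0 (u, t)).
  exact: (measurable_fun_fubini_tonelli_F _ mC C0).
- move=> u; rewrite /cube_int iintE ?integral_ge0//.
    by move=> t _; exact: (C0 (u, t)).
    exact: (measurableT_comp mC).
  by move=> t; exact: (C0 (u, t)).
Qed.
End laws.

(** * The Gibbs variational bound *)

Section gibbs.
Local Open Scope ereal_scope.
Context d (T : measurableType d) (R : realType) (mu : {measure set T -> \bar R}).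

Lemma ge0_integrable (f : T -> R) (a : R) :
  measurable_fun setT f -> (forall t, 0 <= f t)%R ->
  \int[mu]_t (f t)%:E <= a%:E -> mu.-integrable setT (EFin \o f).
Proof.
move=> mf f0 fa; apply/integrableP; split; first exact/measurable_EFinP.
under eq_integral => t _ do rewrite /= ger0_norm//.
by rewrite (le_lt_trans fa)// ltry.
Qed.

(** If the integral vanished, [l * p] and hence [p] would vanish almost everywhere, against its
    total mass one. *)
Lemma integral_density_gt0 (p : T -> R) (l : T -> R) :
  measurable_fun setT p -> measurable_fun setT l -> (forall t, 0 <= p t)%R ->
  (forall t, 0 < l t)%R -> \int[mu]_t (p t)%:E = 1 ->
  0 < \int[mu]_t (l t * p t)%:E.
Proof.
move=> mp ml p0 l0 p1.
have lp0 t : (0 <= l t * p t)%R by rewrite mulr_ge0// ltW.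
have mlp : measurable_fun setT (fun t => (l t * p t)%:E).
  by apply/measurable_EFinP; exact: measurable_funM.
rewrite lt_neqAle integral_ge0 ?andbT; last by move=> t _; rewrite lee_fin.
apply/eqP => H.
have : ae_eq mu setT (fun t => (l t * p t)%:E) (cst 0).
  apply/ae_eq_integral_abs => //.
  by rewrite H; apply: eq_integral => t _; rewrite /= ger0_norm.
move=> H0.
have : ae_eq mu setT (EFin \o p) (cst 0).
  apply: filterS H0 => t /(_ I) [] /eqP; rewrite mulf_eq0 gt_eqF//= => /eqP pt _.
  by rewrite /= pt.
move=> /ae_eq_integral H1.
have := p1; rewrite H1//.
  by rewrite integral0 => /esym/eqP; rewrite onee_eq0.
exact/measurable_EFinP.
Qed.

(** Kept as a difference of two nonnegative integrals, the shape to which [KLdiv] unfolds;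
    [rel_entropyE] identifies it with a signed Lebesgue integral. *)
Definition rel_entropy (q r : T -> R) : \bar R :=
  \int[mu]_t (Num.max (q t * ln (q t / r t)) 0)%:E -
  \int[mu]_t (Num.max (- (q t * ln (q t / r t))) 0)%:E.

Lemma rel_entropyE q r :
  rel_entropy q r = \int[mu]_t (q t * ln (q t / r t))%:E.
Proof.
rewrite [RHS]integralE; congr (_ - _); apply: eq_integral => t _.
  by rewrite funeposE EFin_max.
by rewrite funenegE EFin_max EFinN.
Qed.

(** This is ln u <= u - 1 at u = b / a. It dominates the negative part of a relative entropy and,
    once integrated, plays the role of Jensen's inequality. *)
Lemma mul_ln_ge (a b : R) : (0 < a)%R -> (0 < b)%R -> (a - b <= a * ln (a / b))%R.
Proof.
move=> a0 b0; have ba0 : (0 < b / a)%R by rewrite divr_gt0.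
have -> : (ln (a / b) = - ln (b / a))%R by rewrite -lnV ?posrE// invf_div.
have : (ln (b / a) <= b / a - 1)%R.
  by rewrite -ler_expR lnK ?posrE//; apply: le_trans (expR_ge1Dx _); rewrite addrC subrK.
move=> /(ler_wpM2l (ltW a0)); rewrite mulrBr mulrCA divff ?gt_eqF// mulr1 mulr1 mulrN.
by rewrite lerNr opprB.
Qed.

Variables (p q qs l h : T -> R) (B : set T) (c F W : R).
Hypotheses (mp : measurable_fun setT p) (mq : measurable_fun setT q)
  (mqs : measurable_fun setT qs) (ml : measurable_fun setT l)
  (mh : measurable_fun setT h) (mB : measurable B).
Hypotheses (p0 : forall t, (0 < p t)%R) (q0 : forall t, (0 < q t)%R)
  (qs0 : forall t, (0 < qs t)%R) (h0 : forall t, (0 <= h t)%R).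
Hypotheses (p1 : \int[mu]_t (p t)%:E = 1) (q1 : \int[mu]_t (q t)%:E = 1)
  (qs1 : \int[mu]_t (qs t)%:E = 1).
Hypothesis qh : forall t, (ln (q t / p t) - l t <= h t)%R.
Hypothesis hF : \int[mu]_t (q t * h t)%:E <= F%:E.
Hypothesis lW : \int[mu]_t (expR (l t + c * \1_B t) * p t)%:E <= W%:E.

Variable Z : R.
Hypothesis hZ : \int[mu]_t (expR (l t) * p t)%:E = Z%:E.

Let post t := (expR (l t) * p t / Z)%R.

Let Z_gt0 : (0 < Z)%R.
Proof.
rewrite -lte_fin -hZ; apply: integral_density_gt0 => //.
- exact: measurableT_comp.
- by move=> t; rewrite ltW.
- by move=> t; rewrite expR_gt0.
Qed.

Let post_gt0 t : (0 < post t)%R.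
Proof. by rewrite divr_gt0// mulr_gt0// expR_gt0. Qed.

Let mpost : measurable_fun setT post.
Proof.
by apply: measurable_funM => //; apply: measurable_funM => //; exact: measurableT_comp.
Qed.

Let ipost : mu.-integrable setT (EFin \o post).
Proof.
apply: (@ge0_integrable _ 1) => //; first by move=> t; exact: ltW.
rewrite /post; under eq_integral => t _ do rewrite EFinM.
rewrite ge0_integralZr//; last 3 first.
- by apply/measurable_EFinP; apply: measurable_funM => //; exact: measurableT_comp.
- by move=> t _; rewrite lee_fin mulr_ge0 ?expR_ge0 ?ltW.
- by rewrite lee_fin invr_ge0 ltW.
by rewrite hZ -EFinM divff// gt_eqF.
Qed.

Let g (r : T -> R) t := (r t * ln (r t / post t))%R.

Let gE r t : (0 < r t)%R -> g r t = (r t * (ln (r t) - ln (post t)))%R.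
Proof. by move=> r0; rewrite /g ln_div ?posrE. Qed.

Let mg (r : T -> R) : measurable_fun setT r -> (forall t, (0 < r t)%R) ->
  measurable_fun setT (g r).
Proof.
move=> mr r0; rewrite (_ : g r = fun t => r t * (ln (r t) - ln (post t)))%R.
  by apply: measurable_funM => //; apply: measurable_funB; exact: measurableT_comp.
by apply/funext => t; exact: gE.
Qed.

(** The negative part of the entropy integrand is dominated by the integrable [post], so that
    [rel_entropy r post] is never of the form oo - oo. *)
Let gN_le (r : T -> R) t : (0 < r t)%R -> (Num.max (- g r t) 0 <= post t)%R.
Proof.
move=> r0; rewrite ge_max (ltW (post_gt0 t)) andbT.
have := mul_ln_ge r0 (post_gt0 t); rewrite -/(g r t) => H.
by rewrite lerNl (le_trans _ H)// lerDr ltW.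
Qed.

Let igN (r : T -> R) : measurable_fun setT r -> (forall t, (0 < r t)%R) ->
  \int[mu]_t (Num.max (- g r t) 0)%:E < +oo.
Proof.
move=> mr r0; apply: (@le_lt_trans _ _ (\int[mu]_t (post t)%:E)).
  apply: ge0_le_integral => //.
  - by move=> t _; rewrite lee_fin le_max lexx orbT.
  - by apply/measurable_EFinP; apply: measurable_maxr => //;
      apply: measurableT_comp => //; exact: mg.
  - exact/measurable_EFinP.
  - by move=> t _; rewrite lee_fin gN_le.
by have /integrable_lty := ipost; apply.
Qed.

Let ig (r : T -> R) : measurable_fun setT r -> (forall t, (0 < r t)%R) ->
  rel_entropy r post < +oo -> mu.-integrable setT (EFin \o g r).
Proof.
move=> mr r0 roo; have mgr := mg mr r0.
have mgE : measurable_fun setT (EFin \o g r) by exact/measurable_EFinP.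
have pos : \int[mu]_t (Num.max (g r t) 0)%:E < +oo.
  rewrite ltNge leye_eq; apply/negP => /eqP H; move: roo.
  rewrite /rel_entropy -/(g r) H addye ?ltxx//.
  by rewrite -ltNye lteNr igN.
apply/integrableP; split => //.
have -> : (fun t => `|(EFin \o g r) t|) =
    (fun t => (Num.max (g r t) 0)%:E + (Num.max (- g r t) 0)%:E).
  apply/funext => t /=; rewrite -EFinD; congr EFin.
  by case: (leP 0%R (g r t)) => H; case: (leP 0%R (- g r t)%R) => H2;
    rewrite ?(ger0_norm H)?(ltr0_norm H); lra.
have mM (f : T -> R) : measurable_fun setT f -> measurable_fun setT (fun t => (Num.max (f t) 0)%:E).
  by move=> mf; apply/measurable_EFinP; exact: measurable_maxr.
rewrite ge0_integralD//.
- by rewrite lte_add_pinfty// igN.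
- by move=> t _; rewrite lee_fin le_max lexx orbT.
- exact: mM.
- by move=> t _; rewrite lee_fin le_max lexx orbT.
- by apply: mM; exact: measurableT_comp.
Qed.

Let ln_post t : ln (post t) = (l t + ln (p t) - ln Z)%R.
Proof.
by rewrite /post ln_div ?posrE ?mulr_gt0 ?expR_gt0// lnM ?posrE ?expR_gt0// expRK.
Qed.

Let iq : mu.-integrable setT (EFin \o q).
Proof. by apply: (@ge0_integrable _ 1); rewrite ?q1// => t; exact: ltW. Qed.

Let iqs : mu.-integrable setT (EFin \o qs).
Proof. by apply: (@ge0_integrable _ 1); rewrite ?qs1// => t; exact: ltW. Qed.

Let integral_affine (f1 f2 : T -> R) (a : R) :
  mu.-integrable setT (EFin \o f1) -> mu.-integrable setT (EFin \o f2) ->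
  mu.-integrable setT (EFin \o (fun t => f1 t + a * f2 t)%R) /\
  \int[mu]_t (f1 t + a * f2 t)%:E = \int[mu]_t (f1 t)%:E + a%:E * \int[mu]_t (f2 t)%:E.
Proof.
move=> i1 i2.
have i3 : mu.-integrable setT (fun t => a%:E * (f2 t)%:E) by exact: integrableZl.
split; first by apply: eq_integrable (integrableD measurableT i1 i3).
by rewrite -integralZl// -integralD//; apply: eq_integral.
Qed.

(** Since ln (q / post) = (ln (q / p) - l) + ln Z, hypothesis [qh] bounds the integrand. The
    finiteness obtained here passes to [qs] by optimality. *)
Let rel_entropy_q_le : rel_entropy q post <= (F + ln Z)%:E.
Proof.
have iqh : mu.-integrable setT (EFin \o (fun t => q t * h t)%R).
  apply: ge0_integrable hF => //; first exact: measurable_funM.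
  by move=> t; rewrite mulr_ge0// ltW.
have gq t : (g q t <= q t * h t + ln Z * q t)%R.
  have := ler_wpM2l (ltW (q0 t)) (qh t); rewrite gE// ln_post ln_div ?posrE//; lra.
have [iM _] := integral_affine `|ln Z|%R iqh iq.
have [iM' eM'] := integral_affine (ln Z) iqh iq.
have igq : mu.-integrable setT (EFin \o g q).
  apply: ig => //; apply: (@le_lt_trans _ _ (\int[mu]_t (Num.max (g q t) 0)%:E)).
    rewrite /rel_entropy -[leRHS]adde0 leeD2l// leeNl oppe0.
    by apply: integral_ge0 => t _; rewrite lee_fin le_max lexx orbT.
  apply: le_lt_trans (integrable_lty measurableT iM).
  apply: ge0_le_integral => //.
  - by move=> t _; rewrite lee_fin le_max lexx orbT.
  - by apply/measurable_EFinP; apply: measurable_maxr => //; exact: mg.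
  - by apply/measurable_EFinP; apply: measurable_funD; apply: measurable_funM.
  move=> t _; rewrite lee_fin ge_max (le_trans (gq t))/=; last first.
    by rewrite lerD2l; apply: ler_wpM2r; [exact: ltW|exact: ler_norm].
  by rewrite addr_ge0// mulr_ge0// ltW.
rewrite rel_entropyE; apply: (@le_trans _ _ (\int[mu]_t (q t * h t + ln Z * q t)%:E)).
  by apply: le_integral => // t _; rewrite lee_fin gq.
by rewrite eM' q1 mule1 EFinD leeD2r.
Qed.

(* The Gibbs variational principle: [qs] is compared with the density proportional
   to [expR (l t + c * \1_B t) * p t], and optimality of [qs] with [q]; the
   normalizing constant [Z] cancels. *)
Lemma gibbs_bound : rel_entropy qs post <= rel_entropy q post ->
  c%:E * \int[mu]_t (qs t * \1_B t)%:E <= (F + ln W)%:E.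
Proof.
move=> opt; have KLs := le_trans opt rel_entropy_q_le.
have igs : mu.-integrable setT (EFin \o g qs).
  by apply: ig => //; rewrite (le_lt_trans KLs)// ltry.
pose b' t := (expR (l t + c * \1_B t) * p t)%R.
have mB1 : measurable_fun setT (fun t => l t + c * \1_B t)%R.
  by apply: measurable_funD => //; apply: measurable_funM => //.
have mb' : measurable_fun setT b'.
  by apply: measurable_funM => //; exact: measurableT_comp.
have b'0 t : (0 <= b' t)%R by rewrite mulr_ge0 ?expR_ge0 ?ltW.
have ib' : mu.-integrable setT (EFin \o b') by apply: ge0_integrable lW.
(* The exact normalizing constant of the tilted density; its upper bound [W] enters only at the end,
   by monotonicity of [ln]. *)
pose W' := fine (\int[mu]_t (b' t)%:E).
have W'E : \int[mu]_t (b' t)%:E = W'%:E.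
  by rewrite fineK//; exact: (integrable_fin_num measurableT ib').
have W'0 : (0 < W')%R.
  rewrite -lte_fin -W'E; apply: integral_density_gt0 => //.
  - exact: measurableT_comp.
  - by move=> t; rewrite ltW.
  - by move=> t; rewrite expR_gt0.
have W'W : (W' <= W)%R by rewrite -lee_fin -W'E.
have iB : mu.-integrable setT (EFin \o (fun t => qs t * \1_B t)%R).
  apply: (@ge0_integrable _ 1).
  - exact: measurable_funM.
  - by move=> t; rewrite mulr_ge0// ltW.
  rewrite -qs1; apply: ge0_le_integral => //.
  - by move=> t _; rewrite lee_fin mulr_ge0// ltW.
  - by apply/measurable_EFinP; exact: measurable_funM.
  - exact/measurable_EFinP.
  - move=> t _; rewrite lee_fin; apply: ler_piMr; first exact: ltW.
    by rewrite indicE; case: (t \in B).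
(* [mul_ln_ge] for [qs t] against the normalized tilted density [b' t / W']. After integration the
   two total masses, both equal to one, cancel. *)
have key t : (qs t + c * (qs t * \1_B t) <=
    (g qs t + (ln W' - ln Z) * qs t) + W'^-1 * b' t)%R.
  have bt0 : (0 < W'^-1 * b' t)%R by rewrite !mulr_gt0 ?invr_gt0 ?expR_gt0.
  have := mul_ln_ge (qs0 t) bt0.
  rewrite gE// ln_post ln_div ?posrE// lnM ?posrE ?invr_gt0 ?mulr_gt0 ?expR_gt0//.
  rewrite lnV ?posrE// lnM ?posrE ?expR_gt0// expRK.
  set u := \1_B t; lra.
have [i1 e1] := integral_affine c iqs iB.
have [i2 e2] := integral_affine (ln W' - ln Z) igs iqs.
have [i3 e3] := integral_affine W'^-1 i2 ib'.
have : \int[mu]_t (qs t + c * (qs t * \1_B t))%:E <=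
    \int[mu]_t ((g qs t + (ln W' - ln Z) * qs t) + W'^-1 * b' t)%:E.
  by apply: le_integral => // t _; rewrite lee_fin.
rewrite e1 e3 e2 -rel_entropyE qs1 W'E mule1 -EFinM mulVf ?gt_eqF// addeC leeD2rE//.
move/le_trans; apply; rewrite -[leRHS]/(_%:E).
apply: (@le_trans _ _ ((F + ln Z)%:E + (ln W' - ln Z)%:E)); first exact: leeD2r.
have : (ln W' <= ln W)%R by rewrite ler_ln ?posrE// (lt_le_trans W'0).
by rewrite -EFinD lee_fin; lra.
Qed.
End gibbs.

(** * Boundedness, Lipschitz continuity and measurability of the network *)

Section network.
Context {R : realType}.
Implicit Types (u v C D : R).

(** With only [expR] and [ln] left, the bounds and the measurability of [psi] come from those of its
    building blocks. *)
Lemma psi_expR u : psi u = expR (- ln (1 + expR (- u))).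
Proof.
rewrite /psi div1r [RHS]expRN lnK// posrE.
by rewrite addr_gt0// expR_gt0.
Qed.

Lemma psi_norm_le1 u : `|psi u| <= 1.
Proof.
rewrite psi_expR ger0_norm ?expR_ge0// -[leRHS]expR0 ler_expR oppr_le0 ln_ge0//.
by rewrite lerDl expR_ge0.
Qed.

(** For v <= u the numerator exp(-v) - exp(-u) is at most exp(-v) (u - v), by the tangent inequality
    for exp, and the denominator is at least exp(-v). *)
Lemma psi_lipschitz u v : `|psi u - psi v| <= `|u - v|.
Proof.
wlog vu : u v / v <= u.
  move=> H; have [/H//|/ltW /H] := leP v u.
  by rewrite distrC [in leRHS]distrC.
have eu : 0 < expR (- u) by exact: expR_gt0.
have ev : 0 < expR (- v) by exact: expR_gt0.
have euv : expR (- u) <= expR (- v) by rewrite ler_expR lerN2.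
have -> : psi u - psi v =
    (expR (- v) - expR (- u)) / ((1 + expR (- u)) * (1 + expR (- v))).
  by rewrite /psi; field; rewrite !gt_eqF ?addr_gt0.
have pos : 0 < (1 + expR (- u)) * (1 + expR (- v)) by rewrite mulr_gt0 ?addr_gt0.
rewrite !ger0_norm ?subr_ge0//; last by rewrite divr_ge0 ?subr_ge0// ltW.
rewrite ler_pdivrMr//.
have H1 : expR (- v) - expR (- u) <= expR (- v) * (u - v).
  have -> : expR (- u) = expR (- v) * expR (v - u) by rewrite -expRD; congr expR; ring.
  rewrite -{1}[expR (- v)]mulr1 -mulrBr ler_pM2l//.
  by have := expR_ge1Dx (v - u); lra.
apply: (le_trans H1); rewrite mulrC; apply: ler_wpM2l; first by rewrite subr_ge0.
nra.
Qed.

(** There is no condition on [x]: a hidden unit is bounded by one whatever its input. *)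
Lemma nnet_norm_le k p (theta : seq R) (x : p.-tuple R) C :
  (forall i, `|theta`_i| <= C) -> `|nnet k p theta x| <= (Kdim k p)%:R * C.
Proof.
move=> tC; have C0 : 0 <= C by apply: le_trans (tC 0%N).
apply: (@le_trans _ _ (C + \sum_(j < k) C)).
  apply: (le_trans (ler_normD _ _)); apply: lerD => //.
  apply: (le_trans (ler_norm_sum _ _ _)); apply: ler_sum => j _.
  rewrite normrM -[leRHS]mulr1; apply: ler_pM => //; exact: psi_norm_le1.
have -> : C + \sum_(j < k) C = (1 + k)%:R * C.
  by rewrite sumr_const card_ord natrD mulrDl mul1r mulr_natl.
apply: ler_wpM2r => //; rewrite ler_nat /Kdim leq_add2l.
by rewrite leq_pmulr// addn1.
Qed.

(** Only [theta'] is bounded by [C]: each product is split so that the increment of the outer weight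
    meets the bounded [psi], and the increment of [psi] meets a weight of [theta']. Thus [theta] may
    be an unbounded Gaussian draw around [theta']. *)
Lemma nnet_lipschitz k p (theta theta' : seq R) (x : p.-tuple R) C D :
  in_cube p x -> (forall i, `|theta'`_i| <= C) ->
  (forall i, `|theta`_i - theta'`_i| <= D) ->
  `|nnet k p theta x - nnet k p theta' x| <= (Kdim k p)%:R * (1 + C) * D.
Proof.
move=> /allP x01 tC tD.
have C0 : 0 <= C by apply: le_trans (tC 0%N).
have D0 : 0 <= D by apply: le_trans (tD 0%N).
have x1 h : `|tnth x h| <= 1.
  by have /andP[a b] := x01 _ (mem_tnth h x); rewrite ger0_norm.
rewrite /nnet opprD addrACA -sumrB.
apply: (@le_trans _ _ (D + \sum_(j < k) (D + C * (p%:R * D)))).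
  apply: (le_trans (ler_normD _ _)); apply: lerD => //.
  apply: (le_trans (ler_norm_sum _ _ _)); apply: ler_sum => j _.
  set a := \sum_(h < p) _; set b := \sum_(h < p) _.
  have -> : theta`_j.+1 * psi a - theta'`_j.+1 * psi b =
      (theta`_j.+1 - theta'`_j.+1) * psi a + theta'`_j.+1 * (psi a - psi b) by ring.
  apply: (le_trans (ler_normD _ _)).
  rewrite [`|_ * psi a|]normrM [`|_ * (_ - _)|]normrM; apply: lerD.
    by rewrite -[leRHS]mulr1; apply: ler_pM => //; exact: psi_norm_le1.
  apply: ler_pM => //; apply: (le_trans (psi_lipschitz _ _)).
  rewrite /a /b -sumrB; apply: (le_trans (ler_norm_sum _ _ _)).
  apply: (@le_trans _ _ (\sum_(h < p) D)); last by rewrite sumr_const card_ord mulr_natl.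
  apply: ler_sum => h _; rewrite -mulrBl normrM -[leRHS]mulr1.
  exact: ler_pM.
rewrite sumr_const card_ord -mulr_natl /Kdim natrD natrM natrD.
have k0 : 0 <= k%:R :> R by [].
have p0 : 0 <= p%:R :> R by [].
have CD : 0 <= C * D by rewrite mulr_ge0.
have kD : 0 <= k%:R * D by rewrite mulr_ge0.
have h1 : 0 <= k%:R * (C * D) by rewrite mulr_ge0.
have h2 : 0 <= k%:R * (p%:R * D) by rewrite !mulr_ge0.
lra.
Qed.

Lemma measurable_nth d (T : measurableType d) K (t : T -> K.-tuple R) i :
  measurable_fun setT t -> measurable_fun setT (fun z => (t z)`_i).
Proof.
move=> mt; have [iK|Ki] := ltnP i K; last first.
  rewrite (_ : (fun z => _) = cst 0)//; apply/funext => z.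
  by rewrite nth_default// size_tuple.
rewrite (_ : (fun z => _) = (@tnth K R ^~ (Ordinal iK)) \o t).
  by apply: measurableT_comp => //; exact: measurable_tnth.
by apply/funext => z /=; rewrite (tnth_nth 0).
Qed.

Lemma measurable_psi : measurable_fun setT (psi : R -> R).
Proof.
rewrite (_ : psi = (fun u => expR (- ln (1 + expR (- u))))); last first.
  by apply/funext => u; exact: psi_expR.
have mN (f : R -> R) : measurable_fun setT f -> measurable_fun setT (fun u => - f u).
  by move=> mf; apply: measurableT_comp.
have ml : measurable_fun setT (fun u : R => 1 + expR (- u)).
  by apply: measurable_funD => //; apply: (measurableT_comp (@measurable_expR R)).
exact: (measurableT_comp (@measurable_expR R) (mN _ (measurableT_comp (@measurable_ln R) ml))).
Qed.

Lemma measurable_nnet d (T : measurableType d) k p K (t : T -> K.-tuple R)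
    (x : T -> p.-tuple R) : measurable_fun setT t -> measurable_fun setT x ->
  measurable_fun setT (fun z => nnet k p (t z) (x z)).
Proof.
move=> mt mx; apply: measurable_funD; first exact: measurable_nth.
apply: measurable_sum => j; apply: measurable_funM; first exact: measurable_nth.
apply: (measurableT_comp measurable_psi).
apply: measurable_sum => h; apply: measurable_funM; first exact: measurable_nth.
exact: (measurableT_comp (measurable_tnth h) mx).
Qed.
End network.

(** * Exponential tilting of Gaussian densities *)

Section gaussian_tilt.
Context {R : realType}.
Implicit Types (m s u z a b y : R).

Lemma normal_pdf_expR m s z : s != 0 ->
  normal_pdf m s z = normal_peak s * expR (- (z - m) ^+ 2 / (s ^+ 2 *+ 2)).
Proof. by move=> s0; rewrite normal_pdfE. Qed.

Lemma normal_pdf_tilt u s z : s != 0 ->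
  normal_pdf 0 s z * expR ((2 * u * z - u ^+ 2) / (s ^+ 2 *+ 2)) = normal_pdf u s z.
Proof.
move=> s0; rewrite !normal_pdf_expR//.
rewrite -[_ * expR _ * _]mulrA -expRD; congr (_ * expR _).
have s2 : s ^+ 2 != 0 by rewrite expf_neq0.
by field.
Qed.

(** Half of the log-likelihood ratio of mean [u] against mean 0: completing the square recentres the
    density at u / 2 and leaves the affinity of the two Gaussians as a prefactor. *)
Lemma normal_pdf_half_tilt u s z : s != 0 ->
  normal_pdf 0 s z * expR ((2 * u * z - u ^+ 2) / (s ^+ 2 *+ 4)) =
  expR (- (u ^+ 2 / (s ^+ 2 *+ 8))) * normal_pdf (u / 2) s z.
Proof.
move=> s0; rewrite !normal_pdf_expR//.
rewrite -[_ * expR _ * _]mulrA [RHS]mulrCA -!expRD; congr (_ * expR _).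
have s2 : s ^+ 2 != 0 by rewrite expf_neq0.
by field.
Qed.

Lemma sqrt_normal_pdfM a b s y : s != 0 ->
  Num.sqrt (normal_pdf a s y) * Num.sqrt (normal_pdf b s y) =
  expR (- ((a - b) ^+ 2 / (s ^+ 2 *+ 8))) * normal_pdf ((a + b) / 2) s y.
Proof.
move=> s0; rewrite -sqrtrM ?normal_pdf_ge0//.
rewrite -[RHS]ger0_norm ?mulr_ge0 ?expR_ge0 ?normal_pdf_ge0// -sqrtr_sqr.
congr Num.sqrt; rewrite !normal_pdf_expR//.
rewrite [LHS]mulrACA [RHS]exprMn exprMn [RHS]mulrCA -!expr2; congr (_ * _).
rewrite -!expRM_natl -!expRD; congr expR.
have s2 : s ^+ 2 != 0 by rewrite expf_neq0.
by field.
Qed.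

Lemma hellinger_normal a b s : s != 0 ->
  (\int[@lebesgue_measure R]_y
    ((Num.sqrt (normal_pdf a s y) - Num.sqrt (normal_pdf b s y)) ^+ 2)%:E =
  (2 - 2 * expR (- ((a - b) ^+ 2 / (s ^+ 2 *+ 8))))%:E)%E.
Proof.
move=> s0; set e := expR _; have e0 : 0 <= e by exact: expR_ge0.
have i c : (\int[@lebesgue_measure R]_y (normal_pdf c s y)%:E = 1)%E.
  exact: integral_normal_pdf.
have ii (c : R) := integrable_normal_pdf c s.
transitivity (\int[@lebesgue_measure R]_y
   (((normal_pdf a s y)%:E + (normal_pdf b s y)%:E) -
     (2 * e)%:E * (normal_pdf ((a + b) / 2) s y)%:E))%E.
  apply: eq_integral => y _.
  suff -> : (Num.sqrt (normal_pdf a s y) - Num.sqrt (normal_pdf b s y)) ^+ 2 =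
      normal_pdf a s y + normal_pdf b s y - 2 * e * normal_pdf ((a + b) / 2) s y by [].
  rewrite sqrrB !sqr_sqrtr ?normal_pdf_ge0// sqrt_normal_pdfM// -/e.
  by ring.
rewrite integralB//=; last 2 first.
- exact: integrableD.
- exact: integrableZl.
by rewrite integralD// integralZl// !i mule1.
Qed.
End gaussian_tilt.

(** * Expectations over the sample *)

Section data.
Local Open Scope ereal_scope.
Context d (Omega : measurableType d) (R : realType) (P : probability Omega R).
Variables (p : nat) (sigma0 : R) (f0 : p.-tuple R -> R).
Variables (X : nat -> 'I_p -> Omega -> R) (xi : nat -> Omega -> R).
Hypotheses (sigma0_gt0 : (0 < sigma0)%R) (mf0 : measurable_fun setT f0).
Hypothesis ind : mutually_independent P (obs_family p X xi).
Hypothesis lawX : forall i h (B : set R), measurable B ->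
  P (X i h @^-1` B) = lebesgue_measure (B `&` `[0%R, 1%R]%classic).
Hypothesis lawxi : forall i (B : set R), measurable B ->
  P (xi i @^-1` B) = normal_prob 0 sigma0 B.

Definition residual k (theta : seq R) (x : p.-tuple R) : R :=
  (nnet k p theta x - f0 x)%R.

(* The log-likelihood ratio of one observation, as a function of the regression
   error [u] and of the noise [z]. *)
Definition llr_term (u z : R) : R := ((2 * u * z - u ^+ 2) / (sigma0 ^+ 2 *+ 2))%R.

Definition llr n k (theta : seq R) (w : Omega) : R :=
  (\sum_(i < n) llr_term (residual k theta (xvec p X i w)) (xi i w))%R.

Let s0 : sigma0 != 0%R. Proof. by rewrite gt_eqF. Qed.

(** The first factor is the likelihood of the truth; free of [theta], it cancels in the posterior
    density. *)
Lemma likelihood_llr n k (y : nat -> Omega -> R) w (theta : seq R) :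
  (forall i w, y i w = (f0 (xvec p X i w) + xi i w)%R) ->
  likelihood sigma0 p k n X y w theta =
  ((\prod_(i < n) normal_pdf 0 sigma0 (xi i w)) * expR (llr n k theta w))%R.
Proof.
move=> yE; rewrite expR_sum -big_split/=; apply: eq_bigr => i _.
rewrite yE /llr_term /residual; move: (nnet _ _ _ _) (f0 _) (xi i w) => a b z.
rewrite (normal_pdf_tilt (a - b) z s0) !normal_pdf_expR//.
by rewrite (_ : b + z - a = z - (a - b))%R; last by ring.
Qed.

Lemma measurable_xi i : measurable_fun setT (xi i).
Proof. exact: (ind.1 (i, None)). Qed.

Let coordX i : p.-tuple (nat * option 'I_p) :=
  map_tuple (fun h => (i, Some h)) (ord_tuple p).

Let xvecE i w : xvec p X i w = map_tuple ((obs_family p X xi)^~ w) (coordX i).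
Proof. by apply: eq_from_tnth => h; rewrite !tnth_map tnth_ord_tuple. Qed.

Let uniq_coordX i : uniq (coordX i).
Proof. by rewrite map_inj_uniq ?val_ord_tuple ?enum_uniq// => a b []. Qed.

Let block_xvec i : block_measurable (obs_family p X xi) (coordX i) (xvec p X i).
Proof.
rewrite (_ : xvec p X i = (fun w => map_tuple ((obs_family p X xi)^~ w) (coordX i))).
  exact: block_measurable_tuple.
by apply/funext => w; exact: xvecE.
Qed.

Let block_xi i : block_measurable (obs_family p X xi) [:: (i, None)] (xi i).
Proof.
by apply: (@block_measurable_coord _ _ _ _ (obs_family p X xi) [:: (i, None)] (i, None));
  rewrite inE.
Qed.

Lemma measurable_xvec i : measurable_fun setT (xvec p X i).
Proof. exact: (block_measurable_measurable ind (@block_xvec i)). Qed.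

Lemma xvec_integral i (h : p.-tuple R -> \bar R) : measurable_fun setT h ->
  (forall x, 0 <= h x) -> \int[P]_w h (xvec p X i w) = cube_int p h.
Proof.
move=> mh h0; rewrite -(uniform_tuple_integral ind (uniq_coordX i))//.
  by apply: eq_integral => w _; rewrite xvecE.
by move=> j B /mapP[h' _ ->] mB; exact: lawX.
Qed.

Lemma xi_integral i (f : R -> \bar R) : measurable_fun setT f ->
  (forall x, 0 <= f x) ->
  \int[P]_w f (xi i w) = \int[@lebesgue_measure R]_z (f z * (normal_pdf 0 sigma0 z)%:E).
Proof.
move=> mf ff0; apply: law_integral => //.
- exact: measurable_xi.
- exact: measurable_normal_pdf.
- by move=> x; exact: normal_pdf_ge0.
- by move=> B mB; rewrite lawxi.
Qed.

Let obs_uniq i : uniq (coordX i ++ [:: (i, None)]).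
Proof.
rewrite cat_uniq uniq_coordX/= andbT orbF; apply/negP => /mapP[h _].
by [].
Qed.

(** The noise, independent of the design point, is integrated first with the design point frozen. *)
Lemma obs_integral i (F : p.-tuple R * R -> \bar R) : measurable_fun setT F ->
  (forall z, 0 <= F z) ->
  \int[P]_w F (xvec p X i w, xi i w) =
  \int[P]_w \int[@lebesgue_measure R]_z (F (xvec p X i w, z) * (normal_pdf 0 sigma0 z)%:E).
Proof.
move=> mF F0.
rewrite (indep_blocks_integral ind (obs_uniq i) (@block_xvec i) (@block_xi i))//.
apply: eq_integral => w _; rewrite (xi_integral i (f := fun z => F (xvec p X i w, z)))//.
exact: (measurableT_comp mF).
Qed.

Lemma obs_prod_integral n (g : p.-tuple R -> R -> R) :
  measurable_fun setT (fun z : p.-tuple R * R => g z.1 z.2) ->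
  (forall x z, (0 <= g x z)%R) ->
  \int[P]_w (\prod_(i < n) g (xvec p X i w) (xi i w))%:E =
  \prod_(i < n) \int[P]_w (g (xvec p X i w) (xi i w))%:E.
Proof.
move=> mg g0.
rewrite (indep_prod_integral ind (n := n) (s := fun i => coordX i ++ [:: (i, None)])
  (f := fun i w => g (xvec p X i w) (xi i w)))//.
  move=> i; apply/block_measurableP.
  set Gi := cylinders _ _.
  suff mp : measurable_fun (setT : set (g_sigma_algebraType Gi))
      (fun w => (xvec p X i w, xi i w)) by exact: (measurableT_comp mg mp).
  apply/measurable_fun_pair => /=.
    apply/block_measurableP; apply: sub_block_measurable (@block_xvec i).
    by move=> j; rewrite mem_cat => ->.
  apply/block_measurableP; apply: sub_block_measurable (@block_xi i).
  by move=> j; rewrite mem_cat orbC => ->.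
(* The blocks are disjoint because every index carries its observation number as first component. *)
elim: n => // n IH; rewrite -addn1 iotaD map_cat flatten_cat/= cats0 add0n.
rewrite cat_uniq IH obs_uniq/= andbT; apply/hasPn => j jn; apply/negP => /flattenP[s /mapP[i]].
rewrite mem_iota add0n => /andP[_ ilt] -> ji.
have fstE i' : j \in coordX i' ++ [:: (i', None)] -> j.1 = i'.
  by rewrite mem_cat inE => /orP[/mapP[h _ ->]//|/eqP ->].
by have := fstE _ jn; rewrite (fstE _ ji) => E; move: ilt; rewrite E ltnn.
Qed.

Lemma measurable_residual k d' (T : measurableType d') (t : T -> (Kdim k p).-tuple R)
    (x : T -> p.-tuple R) : measurable_fun setT t -> measurable_fun setT x ->
  measurable_fun setT (fun z => residual k (t z) (x z)).
Proof.
by move=> mt mx; apply: measurable_funB; [exact: measurable_nnet|exact: measurableT_comp].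
Qed.

Lemma measurable_llr_term d' (T : measurableType d') (u z : T -> R) :
  measurable_fun setT u -> measurable_fun setT z ->
  measurable_fun setT (fun t => llr_term (u t) (z t)).
Proof.
move=> mu mz; apply: measurable_funM => //; apply: measurable_funB.
  by apply: measurable_funM => //; exact: measurable_funM.
exact: measurable_funX.
Qed.

Lemma measurable_llr n k d' (T : measurableType d') (t : T -> (Kdim k p).-tuple R)
    (om : T -> Omega) : measurable_fun setT t -> measurable_fun setT om ->
  measurable_fun setT (fun z => llr n k (t z) (om z)).
Proof.
move=> mt mo; apply: measurable_sum => i; apply: measurable_llr_term.
  apply: measurable_residual => //.
  exact: (measurableT_comp (measurable_xvec i) mo).
exact: (measurableT_comp (measurable_xi i) mo).
Qed.

(** Given the design, each factor turns the centred noise density into a shifted one, which still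
    has mass one. *)
Lemma integral_expR_llr n k (theta : (Kdim k p).-tuple R) :
  \int[P]_w (expR (llr n k theta w))%:E = 1.
Proof.
pose g x z := expR (llr_term (residual k theta x) z).
have mg : measurable_fun setT (fun z : p.-tuple R * R => g z.1 z.2).
  apply: (measurableT_comp (@measurable_expR R)); apply: measurable_llr_term => //.
  exact: measurable_residual.
transitivity (\int[P]_w (\prod_(i < n) g (xvec p X i w) (xi i w))%:E).
  by apply: eq_integral => w _; rewrite /llr expR_sum.
rewrite obs_prod_integral//; last by move=> x z; exact: expR_ge0.
apply: big1 => i _.
rewrite (obs_integral i (F := fun z => (g z.1 z.2)%:E)); last 2 first.
- exact/measurable_EFinP.
- by move=> z; rewrite lee_fin expR_ge0.
transitivity (\int[P]_w (cst 1 w)); last by rewrite integral_cst//= mul1e; exact: probability_setT.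
apply: eq_integral => w _.
rewrite -[RHS](integral_normal_pdf (residual k theta (xvec p X i w)) sigma0).
by apply: eq_integral => z _; rewrite -EFinM mulrC normal_pdf_tilt.
Qed.

(* The integral over y of the geometric mean of the two conditional densities. *)
Definition affinity k (theta : seq R) (x : p.-tuple R) : R :=
  expR (- (residual k theta x ^+ 2 / (sigma0 ^+ 2 *+ 8))).

Lemma measurable_affinity k d' (T : measurableType d') (t : T -> (Kdim k p).-tuple R)
    (x : T -> p.-tuple R) : measurable_fun setT t -> measurable_fun setT x ->
  measurable_fun setT (fun z => affinity k (t z) (x z)).
Proof.
move=> mt mx; apply: (measurableT_comp (@measurable_expR R)).
apply: measurable_funN; apply: measurable_funM => //; apply: measurable_funX.
exact: measurable_residual.
Qed.

Lemma dHE k (theta : seq R) :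
  dH sigma0 p f0 k theta = cube_int p (fun x => (2 - 2 * affinity k theta x)%:E).
Proof.
by congr (cube_int p _); apply/funext => x; exact: hellinger_normal.
Qed.

Lemma affinity_le1 k theta x : (affinity k theta x <= 1)%R.
Proof.
rewrite -[leRHS]expR0 ler_expR oppr_le0 divr_ge0 ?sqr_ge0//.
by rewrite mulrn_wge0// sqr_ge0.
Qed.

(** The cube integral in [dHE] is the expectation over one design point, so that dH equals 2 minus
    twice the mean affinity. *)
Lemma integral_affinity_le k (theta : (Kdim k p).-tuple R) (eps : R) i :
  eps%:E <= dH sigma0 p f0 k theta ->
  \int[P]_w (affinity k theta (xvec p X i w))%:E <= (1 - eps / 2)%:E.
Proof.
have ma : measurable_fun setT (affinity k theta) by exact: measurable_affinity.
have max : measurable_fun setT (fun w => affinity k theta (xvec p X i w)).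
  exact: (measurableT_comp ma (measurable_xvec i)).
have a0 x : (0 <= affinity k theta x)%R by exact: expR_ge0.
have i1 : P.-integrable setT (EFin \o (fun w => affinity k theta (xvec p X i w))).
  apply: (@ge0_integrable _ _ _ _ _ 1) => //.
  apply: (@le_trans _ _ (\int[P]_w (cst 1 w))); last first.
    by rewrite integral_cst//= mul1e probability_le1.
  apply: ge0_le_integral => //.
  - by move=> w _; rewrite lee_fin.
  - exact/measurable_EFinP.
  - by move=> w _; rewrite lee_fin affinity_le1.
have := integrable_fin_num measurableT i1.
rewrite dHE -(xvec_integral i); last 2 first.
- by apply/measurable_EFinP; apply: measurable_funB => //; exact: measurable_funM.
- by move=> x; rewrite lee_fin; have := affinity_le1 k theta x; lra.
rewrite (_ : \int[P]_w (2 - _)%:E =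
    \int[P]_w (2%:E - 2%:E * (affinity k theta (xvec p X i w))%:E)); last first.
  by apply: eq_integral.
rewrite integralB//; last 2 first.
- exact: finite_measure_integrable_cst.
- exact: integrableZl.
rewrite integralZl// integral_cst//= probability_setT mule1.
case: (\int[P]_w _) => // r _.
by rewrite -EFinM -EFinB !lee_fin; lra.
Qed.

(** Given the design, each factor integrates to the affinity by [normal_pdf_half_tilt]; then 1 - eps
    / 2 <= exp (- eps / 2). *)
Lemma integral_expR_half_llr n k (theta : (Kdim k p).-tuple R) (eps : R) :
  eps%:E <= dH sigma0 p f0 k theta ->
  \int[P]_w (expR (llr n k theta w / 2))%:E <= (expR (- (n%:R * (eps / 2))))%:E.
Proof.
move=> epsd.
pose g x z := expR (llr_term (residual k theta x) z / 2).
have mg : measurable_fun setT (fun z : p.-tuple R * R => g z.1 z.2).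
  apply: (measurableT_comp (@measurable_expR R)); apply: measurable_funM => //.
  by apply: measurable_llr_term => //; exact: measurable_residual.
have -> : \int[P]_w (expR (llr n k theta w / 2))%:E =
    \int[P]_w (\prod_(i < n) g (xvec p X i w) (xi i w))%:E.
  by apply: eq_integral => w _; rewrite /llr mulr_suml expR_sum.
rewrite obs_prod_integral//; last by move=> x z; exact: expR_ge0.
have step (i : 'I_n) : 0 <= \int[P]_w (g (xvec p X i w) (xi i w))%:E <= (expR (- (eps / 2)))%:E.
  rewrite integral_ge0/=; last by move=> w _; rewrite lee_fin expR_ge0.
  rewrite (obs_integral i (F := fun z => (g z.1 z.2)%:E)); last 2 first.
  - exact/measurable_EFinP.
  - by move=> z; rewrite lee_fin expR_ge0.
  apply: (@le_trans _ _ (1 - eps / 2)%:E); last by rewrite lee_fin; exact: expR_ge1Dx.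
  apply: le_trans (integral_affinity_le i epsd).
  rewrite le_eqVlt; apply/orP; left; apply/eqP; apply: eq_integral => w _ /=.
  set u := residual k theta (xvec p X i w).
  transitivity (\int[@lebesgue_measure R]_z
     ((affinity k theta (xvec p X i w))%:E * (normal_pdf (u / 2) sigma0 z)%:E)).
    apply: eq_integral => z _; rewrite -!EFinM; congr EFin.
    rewrite /affinity -/u -(normal_pdf_half_tilt u z s0) mulrC /g /llr_term -/u.
    rewrite (_ : (_ / (sigma0 ^+ 2 *+ 2) / 2)%R = ((2 * u * z - u ^+ 2) / (sigma0 ^+ 2 *+ 4))%R)//.
    by move: (sigma0 ^+ 2)%R (expf_neq0 2 s0) => v v0; field.
  rewrite ge0_integralZl//=; last 3 first.
  - by apply/measurable_EFinP; exact: measurable_normal_pdf.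
  - by move=> z _; rewrite lee_fin normal_pdf_ge0.
  - by rewrite lee_fin expR_ge0.
  by rewrite integral_normal_pdf mule1.
apply: (@le_trans _ _ (\prod_(i < n) (expR (- (eps / 2)))%:E)).
  suff /andP[] : 0 <= \prod_(i < n) \int[P]_w (g (xvec p X i w) (xi i w))%:E <=
      \prod_(i < n) (expR (- (eps / 2)))%:E by [].
  elim/big_ind2 : _ => //; first by rewrite lee01 lexx.
  move=> x1 x2 y1 y2 /andP[x0 x12] /andP[y0 y12].
  by rewrite mule_ge0//= lee_pmul.
by rewrite prodEFin prodr_const card_ord -[(- (n%:R * _))%R]mulrN expRM_natl.
Qed.

Lemma prob_outside_cube i h : P (X i h @^-1` (~` `[0%R, 1%R]%classic)) = 0.
Proof.
rewrite lawX; last by apply: measurableC.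
by rewrite setICl measure0.
Qed.

Lemma integral_xi_sqr i : \int[P]_w (xi i w ^+ 2)%:E <= (8 * sigma0 ^+ 2)%:E.
Proof.
rewrite (xi_integral i (f := fun z => (z ^+ 2)%:E)); last 2 first.
- by apply/measurable_EFinP; exact: measurable_funX.
- by move=> z; rewrite lee_fin sqr_ge0.
apply: le_trans (normal_second_moment_le 0 s0).
rewrite le_eqVlt; apply/orP; left; apply/eqP; apply: eq_integral => z _.
by rewrite -EFinM subr0 mulrC.
Qed.
End data.

(** * Deterministic bound for a fixed sample *)

Section sample_bound.
Context d (Omega : measurableType d) (R : realType) (P : probability Omega R).
Variables (p : nat) (sigma0 zeta : R) (f0 : p.-tuple R -> R).
Variables (X : nat -> 'I_p -> Omega -> R) (xi y : nat -> Omega -> R).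
Hypotheses (sigma0_gt0 : 0 < sigma0) (zeta_gt0 : 0 < zeta).
Hypothesis mf0 : measurable_fun setT f0.
Hypothesis ind : mutually_independent P (obs_family p X xi).
Hypothesis yE : forall i w, y i w = f0 (xvec p X i w) + xi i w.

Lemma KLdivE K (q r : K.-tuple R -> R) :
  measurable_fun setT q -> measurable_fun setT r ->
  (forall t, 0 < q t) -> (forall t, 0 < r t) ->
  KLdiv K q r = rel_entropy (tuple_leb K) q r.
Proof.
move=> mq mr q0 r0.
have mqr : measurable_fun setT (fun t => q t * ln (q t / r t)).
  rewrite (_ : (fun t => _) = fun t => q t * (ln (q t) - ln (r t))).
    by apply: measurable_funM => //; apply: measurable_funB; exact: measurableT_comp.
  by apply/funext => t; rewrite ln_div ?posrE.
rewrite /KLdiv /iintR /rel_entropy !iintE//.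
- by apply/measurable_EFinP; apply: measurable_maxr => //; exact: measurable_funN.
- by move=> t; rewrite lee_fin le_max lexx orbT.
- by apply/measurable_EFinP; exact: measurable_maxr.
- by move=> t; rewrite lee_fin le_max lexx orbT.
Qed.

(** [g] stands for the residual at the centre and [D] for the Lipschitz error. The cross term is
    handled by - 2 u z <= u^2 / tau + tau z^2. *)
Lemma neg_llr_term_le (u z g D tau : R) : 0 < tau -> `|u| <= g + D ->
  - llr_term sigma0 u z <=
  ((1 + tau^-1) * (2 * g ^+ 2 + 2 * D ^+ 2) + tau * z ^+ 2) / (sigma0 ^+ 2 *+ 2).
Proof.
move=> tau0 ugD; rewrite /llr_term -mulNr; apply: ler_wpM2r.
  by rewrite invr_ge0 mulrn_wge0// sqr_ge0.
have u2 : u ^+ 2 <= 2 * g ^+ 2 + 2 * D ^+ 2.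
  have : u ^+ 2 <= (g + D) ^+ 2.
    by rewrite -[u ^+ 2]ger0_norm ?sqr_ge0// normrX lerXn2r// nnegrE (le_trans _ ugD).
  by have := sqr_ge0 (g - D); nra.
have ti0 : 0 < tau^-1 by rewrite invr_gt0.
have uz : - (2 * u * z) <= tau^-1 * u ^+ 2 + tau * z ^+ 2.
  have : 0 <= tau^-1 * (u + tau * z) ^+ 2 by rewrite mulr_ge0 ?sqr_ge0// ltW.
  have -> : tau^-1 * (u + tau * z) ^+ 2 = tau^-1 * u ^+ 2 + 2 * u * z + tau * z ^+ 2.
    by field; rewrite gt_eqF.
  lra.
have : (1 + tau^-1) * u ^+ 2 <= (1 + tau^-1) * (2 * g ^+ 2 + 2 * D ^+ 2).
  by apply: ler_wpM2l => //; rewrite addr_ge0// ltW.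
lra.
Qed.

(** The difference of the numerators factors as (u - v) (2 z - u - v); 2 |z| <= 1 + z^2 and 2 g <= 1
    + g^2 turn the second factor into squares, which [fit_stat] controls. *)
Lemma llr_termB_le (u v z g B D : R) : `|u - v| <= D -> `|u| <= g + B -> `|v| <= g + B ->
  llr_term sigma0 u z - llr_term sigma0 v z <=
  D * (2 + 2 * B + z ^+ 2 + g ^+ 2) / (sigma0 ^+ 2 *+ 2).
Proof.
move=> uvD ug vg; rewrite /llr_term -mulrBl; apply: ler_wpM2r.
  by rewrite invr_ge0 mulrn_wge0// sqr_ge0.
have D0 : 0 <= D by exact: le_trans uvD.
have -> : 2 * u * z - u ^+ 2 - (2 * v * z - v ^+ 2) = (u - v) * (2 * z - u - v) by ring.
apply: le_trans (ler_norm _) _; rewrite normrM; apply: ler_pM => //.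
apply: (@le_trans _ _ (2 * `|z| + `|u| + `|v|)).
  apply: (le_trans (ler_normB _ _)); rewrite lerD2r; apply: (le_trans (ler_normB _ _)).
  by rewrite lerD2r normrM ger0_norm.
have z2 : 2 * `|z| <= 1 + z ^+ 2.
  by rewrite -(real_normK (num_real z)); have := sqr_ge0 (`|z| - 1); lra.
by have := sqr_ge0 (g - 1); lra.
Qed.

Definition sq_dist K (t0 t : K.-tuple R) : R := \sum_(i < K) (tnth t i - tnth t0 i) ^+ 2.

Lemma sq_dist_ge0 K (t0 t : K.-tuple R) : 0 <= sq_dist t0 t.
Proof. by apply: sumr_ge0 => i _; exact: sqr_ge0. Qed.

Lemma nth_tuple_le K (t : K.-tuple R) C : 0 <= C ->
  (forall i : 'I_K, `|tnth t i| <= C) -> forall i, `|t`_i| <= C.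
Proof.
move=> C0 tC i; have [iK|Ki] := ltnP i K; last by rewrite nth_default ?size_tuple// normr0.
by have := tC (Ordinal iK); rewrite (tnth_nth 0).
Qed.

Lemma nth_tupleB_le K (t t' : K.-tuple R) C : 0 <= C ->
  (forall i : 'I_K, `|tnth t i - tnth t' i| <= C) -> forall i, `|t`_i - t'`_i| <= C.
Proof.
move=> C0 tC i; have [iK|Ki] := ltnP i K; last first.
  by rewrite !nth_default ?size_tuple// subr0 normr0.
by have := tC (Ordinal iK); rewrite !(tnth_nth 0).
Qed.

Lemma tnth_sq_dist K (t0 t : K.-tuple R) i :
  `|tnth t i - tnth t0 i| <= Num.sqrt (sq_dist t0 t).
Proof.
rewrite -sqrtr_sqr ler_sqrt ?sq_dist_ge0//.
rewrite /sq_dist (bigD1 i)//= lerDl; apply: sumr_ge0 => j _; exact: sqr_ge0.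
Qed.

Lemma sum_sqr_le K (t0 t : K.-tuple R) :
  \sum_(i < K) tnth t i ^+ 2 <= 2 * \sum_(i < K) tnth t0 i ^+ 2 + 2 * sq_dist t0 t.
Proof.
rewrite /sq_dist !mulr_sumr -big_split/=; apply: ler_sum => i _.
by have := sqr_ge0 (tnth t i - 2 * tnth t0 i); nra.
Qed.

(** The Gaussian at [t0] is bounded by its peak, which leaves the ratio of peaks zeta / s and the
    exponent of the prior; [sum_sqr_le] recentres the latter at [t0]. *)
Lemma ln_mf_dens_prior_le K (t0 t : K.-tuple R) (s : R) : 0 < s <= zeta ->
  ln (mf_dens K t0 (nseq_tuple K s) t / prior_dens zeta K t) <=
  K%:R * ln (zeta / s) +
  (\sum_(i < K) tnth t0 i ^+ 2 + sq_dist t0 t) / zeta ^+ 2.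
Proof.
move=> /andP[s0 sz].
have s0' : s != 0 by rewrite gt_eqF.
have z0' : zeta != 0 by rewrite gt_eqF.
have z2 : 0 < zeta ^+ 2 by rewrite exprn_gt0.
have pd0 (i : 'I_K) : 0 < normal_pdf 0 zeta (tnth t i) by exact: normal_pdf_gt0.
apply: (@le_trans _ _ (ln (\prod_(i < K) (zeta / s * expR (tnth t i ^+ 2 / (zeta ^+ 2 *+ 2)))))).
  rewrite /mf_dens /prior_dens -prodf_div ler_ln ?posrE.
  - apply: ler_prod => i _; rewrite tnth_nseq.
    rewrite divr_ge0 ?normal_pdf_ge0//= ler_pdivrMr//.
    apply: (le_trans (normal_pdf_ub _ _ s0')).
    rewrite normal_pdf_expR// subr0 mulrACA -expRD.
    rewrite (_ : _ / _ + _ = 0) ?expR0 ?mulr1; last by field.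
    rewrite le_eqVlt; apply/orP; left; apply/eqP.
    have peakE (z : R) : 0 < z -> normal_peak z = z^-1 * normal_peak 1.
      move=> z0; rewrite /normal_peak expr1n mul1r -mulrnAr sqrtrM ?sqr_ge0//.
      by rewrite sqrtr_sqr gtr0_norm// invfM.
    by rewrite !(peakE s)// (peakE zeta)//; field; rewrite z0'.
  - by apply: prodr_gt0 => i _; rewrite divr_gt0 ?normal_pdf_gt0// tnth_nseq.
  - by apply: prodr_gt0 => i _; rewrite mulr_gt0 ?expR_gt0// divr_gt0.
rewrite big_split/= prodr_const card_ord -expR_sum.
rewrite [ln (_ * expR _)]lnM ?posrE ?expR_gt0 ?exprn_gt0 ?divr_gt0//.
rewrite expRK lnXn ?divr_gt0// mulr_natl lerD2l.
set A := \sum_(i < K) tnth t0 i ^+ 2.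
have -> : (A + sq_dist t0 t) / zeta ^+ 2 =
    (2 * A + 2 * sq_dist t0 t) / (zeta ^+ 2 *+ 2) by field; rewrite gt_eqF.
rewrite -mulr_suml; apply: ler_wpM2r; last exact: sum_sqr_le.
by rewrite invr_ge0 pmulrn_lge0// ltW.
Qed.

Definition sieve K (C : R) (t : K.-tuple R) : bool := [forall i, `|tnth t i| <= C].

Lemma measurable_sieve K C : measurable_fun setT (@sieve K C).
Proof.
apply: (@measurable_fun_bool _ _ _ _ true); rewrite setTI.
have -> : sieve C @^-1` [set true] =
    \bigcap_(i in [set: 'I_K]) ((fun t => tnth t i) @^-1` [set x | `|x| <= C]).
  apply/seteqP; split=> t /=; first by move=> /forallP H i _; exact: H.
  by move=> H; apply/forallP => i; exact: H.
apply: fin_bigcap_measurable; first exact: finite_finset.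
move=> i _.
have mi : measurable_fun setT (fun t : K.-tuple R => `|tnth t i| <= C).
  apply: measurable_fun_ler => //; apply: measurableT_comp => //.
  exact: measurable_tnth.
by have := mi measurableT [set true] I; rewrite setTI.
Qed.

Lemma measurable_dH k : measurable_fun setT
  (fun t : (Kdim k p).-tuple R => dH sigma0 p f0 k t).
Proof.
pose F (z : (Kdim k p).-tuple R * p.-tuple R) : \bar R :=
  if in_cube p z.2 then (2 - 2 * affinity sigma0 f0 k z.1 z.2)%:E else 0%E.
have mF : measurable_fun setT F.
  apply: measurable_fun_ifT => //.
    by apply: measurableT_comp => //; exact: measurable_in_cube.
  apply/measurable_EFinP; apply: measurable_funB => //; apply: measurable_funM => //.
  exact: measurable_affinity.
have F0 z : (0 <= F z)%E.
  rewrite /F; case: ifP => // _; rewrite lee_fin.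
  by have := affinity_le1 sigma0 f0 k z.1 z.2; lra.
rewrite (_ : (fun t => _) = (fun t => \int[tuple_leb p]_x F (t, x))%E).
  exact: (measurable_fun_fubini_tonelli_F _ mF F0).
apply/funext => t; rewrite dHE// /cube_int iintE//.
- exact: (measurableT_comp mF (pair1_measurable t)).
- by move=> x; exact: (F0 (t, x)).
Qed.

Lemma likelihood_prior_E n k w (t : (Kdim k p).-tuple R) :
  likelihood sigma0 p k n X y w t * prior_dens zeta (Kdim k p) t =
  (\prod_(i < n) normal_pdf 0 sigma0 (xi i w)) *
  (expR (llr sigma0 f0 X xi n k t w) * prior_dens zeta (Kdim k p) t).
Proof. by rewrite (likelihood_llr (f0 := f0) (X := X) (xi := xi) sigma0_gt0)// mulrA. Qed.

Lemma prior_densE K (t : K.-tuple R) :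
  prior_dens zeta K t = mf_dens K (nseq_tuple K 0) (nseq_tuple K zeta) t.
Proof. by apply: eq_bigr => i _; rewrite !tnth_nseq. Qed.

Lemma prior_dens_gt0 K (t : K.-tuple R) : 0 < prior_dens zeta K t.
Proof. by rewrite prior_densE mf_dens_gt0// => i; rewrite tnth_nseq. Qed.

Lemma measurable_prior_dens K : measurable_fun setT (prior_dens zeta K).
Proof.
rewrite (_ : prior_dens zeta K = mf_dens K (nseq_tuple K 0) (nseq_tuple K zeta)).
  exact: measurable_mf_dens.
by apply/funext => t; exact: prior_densE.
Qed.

Lemma iint_mf_dens_sq_dist K (t0 : K.-tuple R) (s a b : R) : 0 < s -> 0 <= a -> 0 <= b ->
  (\int[tuple_leb K]_t
     (mf_dens K t0 (nseq_tuple K s) t * (a + b * sq_dist t0 t))%:E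
   <= (a + b * (K%:R * (8 * s ^+ 2)))%:E)%E.
Proof.
move=> s0 a0 b0; set q := mf_dens K t0 (nseq_tuple K s).
have q0 t : 0 <= q t by apply: ltW; apply: mf_dens_gt0 => i; rewrite tnth_nseq.
have mq : measurable_fun setT q by exact: measurable_mf_dens.
have msq i : measurable_fun setT (fun t : K.-tuple R => (tnth t i - tnth t0 i) ^+ 2).
  apply: measurable_funX; apply: measurable_funB => //; exact: measurable_tnth.
have mqs i : measurable_fun setT (fun t => q t * (tnth t i - tnth t0 i) ^+ 2).
  exact: measurable_funM.
have qi i : (\int[tuple_leb K]_t (q t * (tnth t i - tnth t0 i) ^+ 2)%:E
    <= (8 * s ^+ 2)%:E)%E.
  rewrite -iintE.
  - rewrite (iint_mf_dens_tnth t0 (nseq_tuple K s) i (f := fun x => (x - tnth t0 i) ^+ 2)).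
    + by rewrite tnth_nseq; apply: normal_second_moment_le; rewrite gt_eqF.
    + by apply: measurable_funX; exact: measurable_funB.
    + by move=> x; exact: sqr_ge0.
  - exact/measurable_EFinP.
  - by move=> t; rewrite lee_fin mulr_ge0 ?sqr_ge0.
under eq_integral => t _.
  rewrite (_ : _%:E = a%:E * (q t)%:E +
    b%:E * \sum_(i < K) (q t * (tnth t i - tnth t0 i) ^+ 2)%:E)%E; last first.
    rewrite sumEFin -!EFinM -EFinD; congr EFin; rewrite /sq_dist -mulr_sumr; ring.
  over.
have mqsE i : measurable_fun setT (fun t => (q t * (tnth t i - tnth t0 i) ^+ 2)%:E).
  exact/measurable_EFinP.
have mS : measurable_fun setT
    (fun t => (\sum_(i < K) (q t * (tnth t i - tnth t0 i) ^+ 2)%:E)%E).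
  exact: emeasurable_sum.
have qs0 i t : (0 <= (q t * (tnth t i - tnth t0 i) ^+ 2)%:E)%E.
  by rewrite lee_fin mulr_ge0 ?sqr_ge0.
have S0 t : (0 <= \sum_(i < K) (q t * (tnth t i - tnth t0 i) ^+ 2)%:E)%E.
  exact: sume_ge0.
rewrite ge0_integralD//; last 4 first.
- by move=> t _; rewrite mule_ge0// lee_fin.
- by apply: measurable_funeM; exact/measurable_EFinP.
- by move=> t _; rewrite mule_ge0// lee_fin.
- exact: measurable_funeM.
rewrite !ge0_integralZl//; last 2 first.
- exact/measurable_EFinP.
- by move=> t _; rewrite lee_fin.
rewrite -iintE; last 2 first.
- exact/measurable_EFinP.
- by move=> t; rewrite lee_fin.
rewrite iint_mf_dens mule1 EFinD leeD2l// EFinM lee_wpmul2l ?lee_fin//.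
rewrite ge0_integral_sum//.
apply: (@le_trans _ _ (\sum_(i < K) (8 * s ^+ 2)%:E)%E); first exact: lee_sum.
by rewrite sumEFin sumr_const card_ord [K%:R * _]mulr_natl.
Qed.

Variables (n k : nat) (t0 ms ss : (Kdim k p).-tuple R) (s tau C c T eps : R) (w : Omega).
Local Notation K := (Kdim k p).
Local Notation prior := (prior_dens zeta K).
Local Notation ell t := (llr sigma0 f0 X xi n k t w).

(** The part of the bound of [neg_llr_term_le] that is free of the drawn parameter; [kl_const]
    depends on the sample through it alone. *)
Definition fit_stat : R :=
  \sum_(i < n) ((1 + tau^-1) * (2 * residual f0 k t0 (xvec p X i w) ^+ 2) +
    tau * xi i w ^+ 2).

(* [kl_const + kl_slope * sq_dist t0 t] dominates [ln (q t / prior t)] minus the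
   log-likelihood ratio at [t], for [q] centred at [t0] with deviations [s]; [tau]
   is the AM-GM weight separating noise from approximation error. *)
Definition kl_const : R :=
  K%:R * ln (zeta / s) + (\sum_(i < K) tnth t0 i ^+ 2) / zeta ^+ 2 +
  fit_stat / (sigma0 ^+ 2 *+ 2).

Definition kl_slope : R :=
  (zeta ^+ 2)^-1 +
  n%:R * (1 + tau^-1) * (2 * (K%:R * (1 + C)) ^+ 2) / (sigma0 ^+ 2 *+ 2).

Hypotheses (s_range : 0 < s <= zeta) (tau_gt0 : 0 < tau) (C_ge0 : 0 <= C).
Hypothesis t0C : sieve C t0.
Hypothesis x_cube : forall i, (i < n)%N -> in_cube p (xvec p X i w).

Lemma ln_mf_dens_llr_le (t : K.-tuple R) :
  ln (mf_dens K t0 (nseq_tuple K s) t / prior t) - ell t <=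
  kl_const + kl_slope * sq_dist t0 t.
Proof.
have H1 := ln_mf_dens_prior_le t0 t s_range.
set D := K%:R * (1 + C) * Num.sqrt (sq_dist t0 t).
have H2 : - ell t <= \sum_(i < n) (((1 + tau^-1) *
    (2 * residual f0 k t0 (xvec p X i w) ^+ 2 + 2 * D ^+ 2) + tau * xi i w ^+ 2) /
    (sigma0 ^+ 2 *+ 2)).
  rewrite /llr -sumrN; apply: ler_sum => i _.
  rewrite -(real_normK (num_real (residual f0 k t0 _))); apply: neg_llr_term_le => //.
  rewrite -lerBlDl; apply: (le_trans (lerB_dist _ _)).
  rewrite /residual opprD addrACA opprK addNr addr0.
  apply: nnet_lipschitz; first exact: x_cube.
    by apply: nth_tuple_le => //; apply/forallP.
  by apply: nth_tupleB_le; [exact: sqrtr_ge0|move=> j; exact: tnth_sq_dist].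
apply: (le_trans (lerD H1 H2)); rewrite -mulr_suml.
have -> : D ^+ 2 = (K%:R * (1 + C)) ^+ 2 * sq_dist t0 t.
  by rewrite /D exprMn sqr_sqrtr// sq_dist_ge0.
under [X in _ + X / _ <= _]eq_bigr => i _.
  rewrite (_ : _ + tau * _ = ((1 + tau^-1) * (2 * residual f0 k t0 (xvec p X i w) ^+ 2) +
     tau * xi i w ^+ 2) + (1 + tau^-1) * (2 * ((K%:R * (1 + C)) ^+ 2 * sq_dist t0 t))); last by ring.
  over.
rewrite big_split/= sumr_const card_ord -[_ *+ n]mulr_natl /kl_const /fit_stat /kl_slope.
set S := \sum_(i < n) _; set S0 := \sum_(i < K) _; set Q := sq_dist _ _.
set sg := (sigma0 ^+ 2 *+ 2)^-1; set z := (zeta ^+ 2)^-1.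
by rewrite le_eqVlt; apply/orP; left; apply/eqP; ring.
Qed.

Lemma kl_const_ge0 : 0 <= kl_const.
Proof.
have /andP[s0 sz] := s_range.
have ti0 : 0 < 1 + tau^-1 by rewrite addr_gt0// invr_gt0.
rewrite !addr_ge0//.
- by rewrite mulr_ge0// ln_ge0// ler_pdivlMr// mul1r.
- by rewrite divr_ge0 ?sqr_ge0// sumr_ge0// => i _; exact: sqr_ge0.
- rewrite divr_ge0//; last by rewrite mulrn_wge0// sqr_ge0.
  apply: sumr_ge0 => i _; rewrite addr_ge0//.
    by rewrite mulr_ge0 ?(ltW ti0)// mulr_ge0// sqr_ge0.
  by rewrite mulr_ge0 ?(ltW tau_gt0)// sqr_ge0.
Qed.

Lemma kl_slope_ge0 : 0 <= kl_slope.
Proof.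
have ti0 : 0 < 1 + tau^-1 by rewrite addr_gt0// invr_gt0.
rewrite addr_ge0 ?invr_ge0 ?sqr_ge0// divr_ge0//; last by rewrite mulrn_wge0// sqr_ge0.
by rewrite mulr_ge0//; rewrite mulr_ge0 ?(ltW ti0) ?sqr_ge0.
Qed.

Hypothesis mass_le : (iint K (fun t => (expR (ell t) * prior t *
  (1 + expR c * (~~ sieve C t)%:R))%:E) <= T%:E)%E.
Hypothesis sup_le : forall t : K.-tuple R, sieve C t ->
  (eps%:E <= dH sigma0 p f0 k t)%E -> ell t + c <= 1.
Hypothesis vp : is_variational_posterior sigma0 zeta p k n X y w ms ss.

(** [mass_le] and [sup_le] are what makes [w] a good sample: they bound the tilted evidence by T +
    e, which is the [W] of [gibbs_bound]. *)
Lemma good_sample_bound :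
  (c%:E * mass_outside_hellinger sigma0 p f0 k eps ms ss <=
   (kl_const + kl_slope * (K%:R * (8 * s ^+ 2)) + ln (T + expR 1))%:E)%E.
Proof.
have /andP[s0 sz] := s_range.
have [ss0 opt] := vp.
have mell : measurable_fun setT (fun t : K.-tuple R => ell t).
  have mid : measurable_fun setT (id : K.-tuple R -> K.-tuple R) by [].
  exact: (measurable_llr sigma0 mf0 ind n mid (measurable_cst w)).
have mp : measurable_fun setT prior by exact: measurable_prior_dens.
have p0 (t : K.-tuple R) : 0 < prior t by exact: prior_dens_gt0.
have adm : mf_admissible K (nseq_tuple K s) by move=> i; rewrite tnth_nseq.
pose q := mf_dens K t0 (nseq_tuple K s).
have q0 t : 0 < q t by exact: mf_dens_gt0.
pose qs := mf_dens K ms ss.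
have qs0 t : 0 < qs t by exact: mf_dens_gt0.
have dens1 (f : K.-tuple R -> R) : measurable_fun setT f -> (forall t, 0 < f t) ->
    iint K (fun t => (f t)%:E) = 1%E -> (\int[tuple_leb K]_t (f t)%:E = 1)%E.
  move=> mf fp <-; rewrite iintE//; first exact/measurable_EFinP.
  by move=> t; rewrite lee_fin ltW.
pose B : set (K.-tuple R) := [set t | (eps%:E <= dH sigma0 p f0 k t)%E].
have mB : measurable B.
  rewrite -[B]setTI; apply: emeasurable_fun_c_infty => //; exact: measurable_dH.
pose sv (t : K.-tuple R) : R := (~~ sieve C t)%:R.
have msv : measurable_fun setT sv.
  rewrite (_ : sv = fun t => if sieve C t then 0 else 1).
    by apply: measurable_fun_ifT => //; exact: measurable_sieve.
  by apply/funext => t; rewrite /sv; case: sieve.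
have me : measurable_fun setT (fun t : K.-tuple R => expR (ell t)) by exact: measurableT_comp.
have mep : measurable_fun setT (fun t : K.-tuple R => expR (ell t) * prior t).
  by exact: measurable_funM.
have mM : measurable_fun setT (fun t : K.-tuple R => expR (ell t) * prior t * (1 + expR c * sv t)).
  by apply: measurable_funM => //; apply: measurable_funD => //; exact: measurable_funM.
have ep0 (t : K.-tuple R) : 0 < expR (ell t) * prior t by rewrite mulr_gt0 ?expR_gt0.
have sv0 t : 0 <= sv t by [].
have M1 t : 1 <= 1 + expR c * sv t by rewrite lerDl mulr_ge0 ?expR_ge0.
have M0 (t : K.-tuple R) : 0 <= expR (ell t) * prior t * (1 + expR c * sv t).
  by apply: mulr_ge0; [exact: ltW (ep0 t)|exact: le_trans ler01 (M1 t)].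
have p1 : (\int[tuple_leb K]_t (prior t)%:E = 1)%E.
  apply: dens1 => //; rewrite -[RHS](iint_mf_dens (nseq_tuple K 0) (nseq_tuple K zeta)).
  by congr iint; apply/funext => t; rewrite prior_densE.
have q1 : (\int[tuple_leb K]_t (q t)%:E = 1)%E.
  by apply: dens1 => //; [exact: measurable_mf_dens|exact: iint_mf_dens].
have qs1 : (\int[tuple_leb K]_t (qs t)%:E = 1)%E.
  by apply: dens1 => //; [exact: measurable_mf_dens|exact: iint_mf_dens].
have ML : (\int[tuple_leb K]_t (expR (ell t) * prior t * (1 + expR c * sv t))%:E <= T%:E)%E.
  by rewrite -iintE//; exact/measurable_EFinP.
have ZL : (\int[tuple_leb K]_t (expR (ell t) * prior t)%:E <= T%:E)%E.
  apply: le_trans ML; apply: ge0_le_integral => //.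
  - by move=> t _; rewrite lee_fin ltW.
  - exact/measurable_EFinP.
  - exact/measurable_EFinP.
  - by move=> t _; rewrite lee_fin ler_peMr// ltW.
pose Z := fine (\int[tuple_leb K]_t (expR (ell t) * prior t)%:E)%E.
have hZ : (\int[tuple_leb K]_t (expR (ell t) * prior t)%:E = Z%:E)%E.
  rewrite fineK// ge0_fin_numE; first by rewrite (le_lt_trans ZL)// ltry.
  by apply: integral_ge0 => t _; rewrite lee_fin ltW.
have Z0 : 0 < Z.
  rewrite -lte_fin -hZ.
  by apply: (integral_density_gt0 mp me _ _ p1) => t; [exact: ltW|exact: expR_gt0].
have mh : measurable_fun setT (fun t => kl_const + kl_slope * sq_dist t0 t).
  apply: measurable_funD => //; apply: measurable_funM => //.
  apply: measurable_sum => i; apply: measurable_funX; apply: measurable_funB => //.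
  exact: measurable_tnth.
have h0 t : 0 <= kl_const + kl_slope * sq_dist t0 t.
  by rewrite addr_ge0 ?kl_const_ge0// mulr_ge0 ?kl_slope_ge0 ?sq_dist_ge0.
have hF := iint_mf_dens_sq_dist t0 s0 kl_const_ge0 kl_slope_ge0.
have mB1 : measurable_fun setT (fun t : K.-tuple R => expR (ell t + c * \1_B t) * prior t).
  apply: measurable_funM => //; apply: (measurableT_comp (@measurable_expR R)).
  by apply: measurable_funD => //; exact: measurable_funM.
(* Off [B] there is no tilt; on [B] outside of the sieve the factor exp c is paid for by [mass_le];
   on [B] inside the sieve [sup_le] caps the exponential by e, and the prior has mass one. *)
have lW : (\int[tuple_leb K]_t (expR (ell t + c * \1_B t) * prior t)%:E
    <= (T + expR 1)%:E)%E.
  apply: (@le_trans _ _ (\int[tuple_leb K]_t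
      ((expR (ell t) * prior t * (1 + expR c * sv t))%:E + (expR 1)%:E * (prior t)%:E))%E).
    apply: ge0_le_integral => //.
    - by move=> t _; rewrite lee_fin mulr_ge0 ?expR_ge0 ?ltW.
    - exact/measurable_EFinP.
    - apply: emeasurable_funD; first exact/measurable_EFinP.
      by apply: measurable_funeM; exact/measurable_EFinP.
    - move=> t _; rewrite -EFinM -EFinD lee_fin mulrAC -mulrDl ler_wpM2r ?ltW//.
      have e0 := expR_gt0 (ell t); have e1 := expR_gt0 (1 : R); have ec := expR_gt0 c.
      rewrite indicE; case: (boolP (t \in B)) => tB; last first.
        rewrite mulr0 addr0.
        by have := mulr_ge0 (ltW e0) (mulr_ge0 (ltW ec) (sv0 t)); lra.
      rewrite mulr1 expRD /sv; case: (boolP (sieve C t)) => tC /=.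
        have : expR (ell t + c) <= expR 1.
          by rewrite ler_expR; apply: sup_le => //; rewrite inE in tB.
        by rewrite expRD; lra.
      have := mulr_gt0 e0 ec; lra.
  rewrite ge0_integralD//; last 4 first.
  - by move=> t _; rewrite lee_fin.
  - exact/measurable_EFinP.
  - by move=> t _; rewrite mule_ge0// lee_fin ?expR_ge0 ?ltW.
  - by apply: measurable_funeM; exact/measurable_EFinP.
  rewrite ge0_integralZl//; last 2 first.
  - exact/measurable_EFinP.
  - by move=> t _; rewrite lee_fin ltW.
  by rewrite p1 mule1 EFinD leeD2r.
have postE : post_dens sigma0 zeta p k n X y w = (fun t => expR (ell t) * prior t / Z).
  apply/funext => t; rewrite /post_dens [X in X / _](likelihood_prior_E n w t).
  set L0 := \prod_(i < n) _.
  have L00 : 0 < L0 by apply: prodr_gt0 => i _; rewrite normal_pdf_gt0 ?gt_eqF.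
  have -> : iint K (fun t => (likelihood sigma0 p k n X y w t * prior t)%:E) = (L0 * Z)%:E.
    under [X in iint _ X]eq_fun => t' do rewrite likelihood_prior_E EFinM.
    rewrite iintE; last 2 first.
    - by apply: measurable_funeM; exact/measurable_EFinP.
    - by move=> t'; rewrite -EFinM lee_fin mulr_ge0// ltW.
    rewrite ge0_integralZl//; last 3 first.
    - exact/measurable_EFinP.
    - by move=> t' _; rewrite lee_fin ltW.
    - by rewrite lee_fin ltW.
    by rewrite hZ EFinM.
  by rewrite /= -mulf_div divff ?gt_eqF// mul1r.
have post0 (t : K.-tuple R) : 0 < expR (ell t) * prior t / Z by rewrite divr_gt0.
have mpost : measurable_fun setT (fun t : K.-tuple R => expR (ell t) * prior t / Z).
  exact: measurable_funM.
have mq : measurable_fun setT q by exact: measurable_mf_dens.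
have mqs : measurable_fun setT qs by exact: measurable_mf_dens.
have KLle := opt t0 (nseq_tuple K s) adm.
rewrite postE !KLdivE// in KLle.
have := gibbs_bound mp mq mqs mell mh mB p0 q0 qs0 h0 p1 q1 qs1 ln_mf_dens_llr_le
  hF lW hZ KLle.
suff -> : mass_outside_hellinger sigma0 p f0 k eps ms ss =
  (\int[tuple_leb K]_t (qs t * \1_B t)%:E)%E by [].
rewrite -iintE.
- congr iint; apply/funext => t; congr EFin; rewrite indicE.
  by case: ifP => H; [rewrite mem_set// mulr1|rewrite memNset ?mulr0//; exact/negP/negbT].
- by apply/measurable_EFinP; exact: measurable_funM.
- by move=> t; rewrite lee_fin mulr_ge0// ltW.
Qed.
End sample_bound.

(** * Markov and union bounds *)

Section probability_bounds.
Local Open Scope ereal_scope.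
Context d (Omega : measurableType d) (R : realType) (P : probability Omega R).

Lemma markov_ge0 (f : Omega -> \bar R) (a b : R) : (0 < a)%R ->
  measurable_fun setT f -> (forall w, 0 <= f w) ->
  \int[P]_w f w <= b%:E ->
  measurable [set w | a%:E < f w] /\ P [set w | a%:E < f w] <= (b / a)%:E.
Proof.
move=> a0 mf ff0 fb; set A := [set w | _].
have mA : measurable A.
  by rewrite -[A]setTI; apply: emeasurable_fun_o_infty.
split=> //.
have H : a%:E * P A <= b%:E.
  apply: le_trans fb; rewrite -(integral_cst P mA).
  apply: (@le_trans _ _ (\int[P]_(w in A) f w)).
    apply: ge0_le_integral => //.
    - by move=> w _; rewrite lee_fin ltW.
    - exact: measurable_funTS.
    - by move=> w; exact: ltW.
  by apply: ge0_subset_integral.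
rewrite -(fineK (fin_num_measure P A mA)) lee_fin ler_pdivlMr// mulrC.
by rewrite -lee_fin EFinM fineK// fin_num_measure.
Qed.

Lemma prob_bigsetU_le (I : Type) (r : seq I) (A : I -> set Omega) :
  (forall i, measurable (A i)) ->
  P (\big[setU/set0]_(i <- r) A i) <= \sum_(i <- r) P (A i).
Proof.
move=> mA; elim: r => [|i r IH]; first by rewrite !big_nil measure0.
rewrite !big_cons; apply: (le_trans (measureU2 _ _ _)) => //.
  exact: bigsetU_measurable.
exact: leeD2l.
Qed.
End probability_bounds.

(** * Exceptional events for a fixed sample size *)

Section finite_sample.
Context d (Omega : measurableType d) (R : realType) (P : probability Omega R).
Variables (p : nat) (sigma0 zeta : R) (f0 : p.-tuple R -> R).
Variables (X : nat -> 'I_p -> Omega -> R) (xi y : nat -> Omega -> R).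
Hypotheses (sigma0_gt0 : 0 < sigma0) (zeta_gt0 : 0 < zeta).
Hypothesis mf0 : measurable_fun setT f0.
Hypothesis ind : mutually_independent P (obs_family p X xi).
Hypothesis lawX : forall i h (B : set R), measurable B ->
  P (X i h @^-1` B) = lebesgue_measure (B `&` `[0, 1]%classic).
Hypothesis lawxi : forall i (B : set R), measurable B ->
  P (xi i @^-1` B) = normal_prob 0 sigma0 B.
Hypothesis yE : forall i w, y i w = f0 (xvec p X i w) + xi i w.

Variables (n k : nat).
Local Notation K := (Kdim k p).
Local Notation prior := (prior_dens zeta K).
Local Notation ell t w := (llr sigma0 f0 X xi n k t w).

(** The uniform law places the design in the cube only almost surely; discarding this null event
    makes [nnet_lipschitz] applicable at every observation. *)
Definition outside_cube : set Omega :=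
  \big[setU/set0]_(z <- [seq (i, h) | i <- iota 0 n, h <- enum 'I_p])
    (X z.1 z.2 @^-1` (~` `[0, 1]%classic)).

Lemma measurable_X i h : measurable_fun setT (X i h).
Proof. exact: (ind.1 (i, Some h)). Qed.

Lemma measurable_outside_cube : measurable outside_cube.
Proof.
apply: bigsetU_measurable => z _; rewrite -[X in measurable X]setTI.
by apply: measurable_X => //; exact: measurableC.
Qed.

Lemma prob_outside_cubes : P outside_cube = 0%E.
Proof.
apply/eqP; rewrite eq_le measure_ge0 andbT.
apply: (le_trans (prob_bigsetU_le P _ _)).
  move=> z; rewrite -[X in measurable X]setTI.
  by apply: measurable_X => //; exact: measurableC.
by rewrite big1// => z _; exact: (prob_outside_cube lawX).
Qed.

Lemma in_cube_xvec w i : ~ outside_cube w -> (i < n)%N -> in_cube p (xvec p X i w).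
Proof.
move=> wo ilt; apply/allP => u /tnthP[h ->]; rewrite tnth_mktuple.
apply/negPn/negP => ux; apply: wo; rewrite /outside_cube -bigcup_seq.
exists (i, h) => /=; last by rewrite in_itv/=; exact/negP.
by apply/allpairsP; exists (i, h); rewrite /= mem_iota mem_enum.
Qed.

Variables (c C : R).

(** The evidence relative to the truth, with an extra weight exp c outside of the sieve; this is the
    quantity that [mass_le] bounds. *)
Definition sieved_evidence (w : Omega) : \bar R :=
  iint K (fun t => (expR (ell t w) * prior t * (1 + expR c * (~~ sieve C t)%:R))%:E).

Let G (z : Omega * K.-tuple R) : \bar R :=
  (expR (ell z.2 z.1) * prior z.2 * (1 + expR c * (~~ sieve C z.2)%:R))%:E.

Let mnsieve : measurable_fun setT (fun t : K.-tuple R => (~~ sieve C t)%:R : R).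
Proof.
rewrite (_ : (fun t => _) = fun t : K.-tuple R => if sieve C t then 0 else 1).
  by apply: measurable_fun_ifT => //; exact: measurable_sieve.
by apply/funext => t; case: sieve.
Qed.

Let mG : measurable_fun setT G.
Proof.
apply/measurable_EFinP; apply: measurable_funM; first apply: measurable_funM.
- apply: (measurableT_comp (@measurable_expR R)).
  exact: (measurable_llr sigma0 mf0 ind n measurable_snd measurable_fst).
- exact: (measurableT_comp (@measurable_prior_dens R zeta K) measurable_snd).
- apply: measurable_funD => //; apply: measurable_funM => //.
  exact: (measurableT_comp mnsieve measurable_snd).
Qed.

Let G0 z : (0 <= G z)%E.
Proof.
rewrite lee_fin; apply: mulr_ge0; first by rewrite mulr_ge0 ?expR_ge0// ltW// prior_dens_gt0.
by rewrite addr_ge0// mulr_ge0 ?expR_ge0.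
Qed.

Let sieved_evidenceE : sieved_evidence = (fun w => \int[tuple_leb K]_t G (w, t))%E.
Proof.
apply/funext => w; rewrite /sieved_evidence iintE//.
- exact: (measurableT_comp mG (pair1_measurable w)).
- by move=> t; exact: (G0 (w, t)).
Qed.

Lemma measurable_sieved_evidence : measurable_fun setT sieved_evidence.
Proof. by rewrite sieved_evidenceE; exact: (measurable_fun_fubini_tonelli_F _ mG G0). Qed.

Lemma sieved_evidence_ge0 w : (0 <= sieved_evidence w)%E.
Proof. by rewrite sieved_evidenceE integral_ge0. Qed.

Hypothesis C_ge0 : 0 <= C.

(** Chernoff's bound in each coordinate: an entry beyond [C] makes the weight [f] at least one, and
    the prior mean of [f] is given by [integral_normal_expR]. The [K] coordinates are then
    summed. *)
Lemma prior_outside_sieve :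
  (\int[tuple_leb K]_t (prior t * (~~ sieve C t)%:R)%:E <=
   (K%:R * (expR (- (C ^+ 2 / (zeta ^+ 2 *+ 4))) * Num.sqrt 2))%:E)%E.
Proof.
pose f (x : R) := expR (- (C ^+ 2 / (zeta ^+ 2 *+ 4))) * expR (x ^+ 2 / (zeta ^+ 2 *+ 4)).
have z4 : 0 < zeta ^+ 2 *+ 4 by rewrite pmulrn_lgt0// exprn_gt0.
have mf : measurable_fun setT f.
  apply: measurable_funM => //; apply: (measurableT_comp (@measurable_expR R)).
  by apply: measurable_funM => //; exact: measurable_funX.
have ff0 x : 0 <= f x by rewrite mulr_ge0 ?expR_ge0.
have mp : measurable_fun setT prior by exact: measurable_prior_dens.
have p0 t : 0 < prior t by exact: prior_dens_gt0.
have mpf (i : 'I_K) : measurable_fun setT (fun t => (prior t * f (tnth t i))%:E).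
  apply/measurable_EFinP; apply: measurable_funM => //.
  exact: (measurableT_comp mf (measurable_tnth i)).
have pf0 (i : 'I_K) t : (0 <= (prior t * f (tnth t i))%:E)%E.
  by rewrite lee_fin mulr_ge0// ltW.
have pfE (i : 'I_K) : (\int[tuple_leb K]_t (prior t * f (tnth t i))%:E =
    (expR (- (C ^+ 2 / (zeta ^+ 2 *+ 4))) * Num.sqrt 2)%:E)%E.
  rewrite -iintE//.
  transitivity (iint K (fun t => (mf_dens K (nseq_tuple K 0) (nseq_tuple K zeta) t *
      f (tnth t i))%:E)).
    by congr iint; apply/funext => t; rewrite prior_densE.
  rewrite iint_mf_dens_tnth// !tnth_nseq.
  under eq_integral => x _ do rewrite /f mulrCA EFinM.
  rewrite ge0_integralZl//; last 2 first.
  - apply/measurable_EFinP; apply: measurable_funM; first exact: measurable_normal_pdf.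
    apply: (measurableT_comp (@measurable_expR R)).
    by apply: measurable_funM => //; exact: measurable_funX.
  - by move=> x _; rewrite lee_fin mulr_ge0 ?normal_pdf_ge0 ?expR_ge0.
  by rewrite integral_normal_expR ?gt_eqF.
apply: (@le_trans _ _ (\int[tuple_leb K]_t (\sum_(i < K) (prior t * f (tnth t i))%:E))%E).
  apply: ge0_le_integral => //.
  - by move=> t _; rewrite lee_fin mulr_ge0// ltW.
  - by apply/measurable_EFinP; exact: measurable_funM.
  - exact: emeasurable_sum.
  - move=> t _; case: (boolP (sieve C t)) => /= tC.
      by rewrite mulr0; apply: sume_ge0.
    move: tC; rewrite negb_forall => /existsP[i]; rewrite -ltNge => Ci.
    rewrite mulr1 (bigD1 i)//= -[leLHS]adde0 leeD//; last exact: sume_ge0.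
    rewrite lee_fin; apply: ler_peMr; first exact: ltW.
    rewrite /f -expRD -[leLHS]expR0 ler_expR addrC subr_ge0.
    apply: ler_wpM2r; first by rewrite invr_ge0 ltW.
    by rewrite -(real_normK (num_real (tnth t i))) lerXn2r ?nnegrE// ltW.
rewrite ge0_integral_sum//.
apply: (@le_trans _ _ (\sum_(i < K) (expR (- (C ^+ 2 / (zeta ^+ 2 *+ 4))) * Num.sqrt 2)%:E)%E).
  by apply: lee_sum => i _; rewrite pfE.
by rewrite sumEFin sumr_const card_ord [K%:R * _]mulr_natl.
Qed.

(** Tonelli lets the sample be integrated first; the likelihood ratio has mean one, and only prior
    masses remain. *)
Lemma integral_sieved_evidence :
  (\int[P]_w sieved_evidence w <=
   (1 + expR c * (K%:R * (expR (- (C ^+ 2 / (zeta ^+ 2 *+ 4))) * Num.sqrt 2)))%:E)%E.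
Proof.
have mp : measurable_fun setT prior by exact: measurable_prior_dens.
have p0 t : 0 < prior t by exact: prior_dens_gt0.
rewrite sieved_evidenceE -[leLHS]/(\int[P]_w (fubini_F (tuple_leb K) G w))%E.
rewrite (fubini_tonelli _ mG G0) /fubini_G.
have mpn : measurable_fun setT (fun t => (prior t * (~~ sieve C t)%:R)%:E).
  by apply/measurable_EFinP; exact: measurable_funM.
have pn0 t : (0 <= (prior t * (~~ sieve C t)%:R)%:E)%E.
  by rewrite lee_fin mulr_ge0// ltW.
rewrite (_ : (\int[_]_t _)%E = (\int[tuple_leb K]_t
    ((prior t)%:E + (expR c)%:E * (prior t * (~~ sieve C t)%:R)%:E))%E); last first.
  apply: eq_integral => t _.
  transitivity (\int[P]_w ((prior t * (1 + expR c * (~~ sieve C t)%:R))%:E *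
      (expR (ell t w))%:E))%E.
    by apply: eq_integral => w _; rewrite /G/= -EFinM; congr EFin; ring.
  rewrite ge0_integralZl//; last 2 first.
  - apply/measurable_EFinP; apply: (measurableT_comp (@measurable_expR R)).
    by apply: (measurable_llr sigma0 mf0 ind n (measurable_cst t)).
  - rewrite lee_fin; apply: mulr_ge0; first exact: ltW.
    by rewrite addr_ge0// mulr_ge0 ?expR_ge0.
  rewrite (integral_expR_llr sigma0_gt0 mf0 ind lawxi) mule1 -EFinM -EFinD.
  by congr EFin; ring.
rewrite ge0_integralD//; last 4 first.
- by move=> t _; rewrite lee_fin ltW.
- exact/measurable_EFinP.
- by move=> t _; rewrite mule_ge0// lee_fin expR_ge0.
- exact: measurable_funeM.
rewrite ge0_integralZl//.
rewrite EFinD leeD//; last by rewrite EFinM lee_wpmul2l ?lee_fin ?expR_ge0// prior_outside_sieve.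
rewrite -iintE; last 2 first.
- exact/measurable_EFinP.
- by move=> t; rewrite lee_fin ltW.
rewrite -(iint_mf_dens (nseq_tuple K 0) (nseq_tuple K zeta)) le_eqVlt; apply/orP; left.
by apply/eqP; congr iint; apply/funext => t; rewrite prior_densE.
Qed.

Variables (t0 : K.-tuple R) (tau gsq : R).
Hypothesis tau_gt0 : 0 < tau.
Hypothesis t0C : sieve C t0.
Hypothesis gsq_le : (cube_int p (fun x => (residual f0 k t0 x ^+ 2)%:E) <= gsq%:E)%E.
Local Notation fit w := (fit_stat f0 X xi n t0 tau w).

Let tau1_gt0 : 0 < 1 + tau^-1. Proof. by rewrite addr_gt0// invr_gt0. Qed.

Let mres i : measurable_fun setT (fun w => residual f0 k t0 (xvec p X i w)).
Proof.
exact: (measurable_residual mf0 (measurable_cst t0) (measurable_xvec ind i)).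
Qed.

Let fit_term_ge0 i w : 0 <= (1 + tau^-1) * (2 * residual f0 k t0 (xvec p X i w) ^+ 2).
Proof. by rewrite mulr_ge0 ?(ltW tau1_gt0)// mulr_ge0 ?sqr_ge0. Qed.

Lemma fit_stat_ge0 w : 0 <= fit w.
Proof.
apply: sumr_ge0 => i _; rewrite addr_ge0//.
by rewrite mulr_ge0 ?sqr_ge0// ltW.
Qed.

Let mterm1 i : measurable_fun setT (fun w =>
  ((1 + tau^-1) * (2 * residual f0 k t0 (xvec p X i w) ^+ 2))%:E).
Proof.
by apply/measurable_EFinP; do 2 apply: measurable_funM => //; exact: measurable_funX.
Qed.

Let mterm2 i : measurable_fun setT (fun w => (tau * xi i w ^+ 2)%:E).
Proof.
apply/measurable_EFinP; apply: measurable_funM => //; apply: measurable_funX.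
exact: (measurable_xi ind).
Qed.

Lemma measurable_fit_stat : measurable_fun setT (fun w => fit w).
Proof.
apply: measurable_sum => i; apply: measurable_funD; apply/measurable_EFinP.
- exact: mterm1.
- exact: mterm2.
Qed.

Lemma integral_fit_stat : (\int[P]_w (fit w)%:E <=
  (n%:R * ((1 + tau^-1) * (2 * gsq) + tau * (8 * sigma0 ^+ 2)))%:E)%E.
Proof.
under eq_integral => w _.
  rewrite /fit_stat -sumEFin.
  over.
rewrite ge0_integral_sum//; last 2 first.
- by move=> i; apply/measurable_EFinP; apply: measurable_funD; apply/measurable_EFinP;
    [exact: mterm1|exact: mterm2].
- move=> i w _; rewrite lee_fin addr_ge0//.
  by rewrite mulr_ge0 ?sqr_ge0// ltW.
apply: (@le_trans _ _ (\sum_(i < n) ((1 + tau^-1) * (2 * gsq) + tau * (8 * sigma0 ^+ 2))%:E)%E).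
  apply: lee_sum => i _.
  under eq_integral => w _ do rewrite EFinD.
  rewrite ge0_integralD//; last 2 first.
  - by move=> w _; rewrite lee_fin.
  - by move=> w _; rewrite lee_fin mulr_ge0 ?sqr_ge0// ltW.
  rewrite EFinD; apply: leeD.
    under eq_integral => w _ do rewrite mulrA EFinM.
    rewrite ge0_integralZl//; last 3 first.
    - by apply/measurable_EFinP; exact: measurable_funX.
    - by move=> w _; rewrite lee_fin sqr_ge0.
    - by rewrite lee_fin mulr_ge0// ltW.
    rewrite [_ * (2 * gsq)]mulrA [in leRHS]EFinM.
    apply: lee_wpmul2l; first by rewrite lee_fin mulr_ge0// ltW.
    rewrite (xvec_integral ind lawX i (h := fun x => (residual f0 k t0 x ^+ 2)%:E))//.
      apply/measurable_EFinP; apply: measurable_funX.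
      exact: (measurable_residual mf0 (measurable_cst t0)).
    by move=> x; rewrite lee_fin sqr_ge0.
  under eq_integral => w _ do rewrite EFinM.
  rewrite ge0_integralZl//; last 3 first.
  - by apply/measurable_EFinP; apply: measurable_funX; exact: (measurable_xi ind).
  - by move=> w _; rewrite lee_fin sqr_ge0.
  - by rewrite lee_fin ltW.
  rewrite [in leRHS]EFinM; apply: lee_wpmul2l; first by rewrite lee_fin ltW.
  exact: (integral_xi_sqr sigma0_gt0 ind lawxi).
by rewrite sumEFin sumr_const card_ord [n%:R * _]mulr_natl.
Qed.

Variables (M : nat) (r eps : R).
Hypotheses (r_gt0 : 0 < r) (CMr : 2 * C < M%:R * r).

(** A box of side [r] of the grid over [-C, C]^K, cut down to the sieve outside of the Hellinger
    neighborhood. The shift by [C] makes the box indices natural numbers. *)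
Definition cell (kap : {ffun 'I_K -> 'I_M}) : set (K.-tuple R) :=
  [set t | [/\ sieve C t, (eps%:E <= dH sigma0 p f0 k t)%E &
    forall i, (kap i)%:R * r <= tnth t i + C <= (kap i).+1%:R * r]].

Lemma cellP (t : K.-tuple R) : sieve C t -> (eps%:E <= dH sigma0 p f0 k t)%E ->
  exists kap, cell kap t.
Proof.
move=> tC td; have tC' i := forallP tC i.
have b0 i : 0 <= (tnth t i + C) / r.
  apply: divr_ge0; last exact: ltW.
  by have := tC' i; rewrite ler_norml => /andP[]; lra.
(* The strict inequality [CMr] keeps the index of the extreme value tnth t i = C below [M]. *)
have bM i : (Num.trunc ((tnth t i + C) / r) < M)%N.
  rewrite -(ltr_nat R); have /andP[h _] := truncn_itv (b0 i).
  apply: le_lt_trans h _; rewrite ltr_pdivrMr//; apply: le_lt_trans CMr.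
  by have := tC' i; rewrite ler_norml => /andP[]; lra.
exists [ffun i => Ordinal (bM i)]; split => // i; rewrite ffunE /=.
have /andP[h1 h2] := truncn_itv (b0 i).
by rewrite -ler_pdivlMr// h1 -ler_pdivrMr// ltW.
Qed.

(* The centre is taken inside the cell, so that it lies outside the Hellinger ball
   whenever the cell is nonempty ([t0] is a junk value otherwise). *)
Definition center kap : K.-tuple R := xget t0 (cell kap).

(** The clause on [cell] makes the event empty for an empty cell, whose centre says nothing about
    [dH]. *)
Definition center_event kap : set Omega :=
  [set w | cell kap (center kap) /\ - c < ell (center kap) w].

(* Chernoff's bound at exponent 1/2: the expectation of [expR (llr / 2)] is the
   n-th power of the affinity. *)
Lemma center_eventP kap : measurable (center_event kap) /\
  (P (center_event kap) <= (expR (c / 2 - n%:R * (eps / 2)))%:E)%E.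
Proof.
have [ck|nck] := pselect (cell kap (center kap)); last first.
  have -> : center_event kap = set0 by apply/seteqP; split=> w // [].
  by rewrite measure0 lee_fin expR_ge0.
have -> : center_event kap =
    [set w | ((expR (- c / 2))%:E < (expR (ell (center kap) w / 2))%:E)%E].
  apply/seteqP; split=> w /=; rewrite lte_fin ltr_expR ltr_pM2r ?invr_gt0//.
    by case.
have [_ dk _] := ck.
have [||mA PA] := markov_ge0 (f := fun w => (expR (ell (center kap) w / 2))%:E)
  (expR_gt0 (- c / 2)) _ _ (integral_expR_half_llr sigma0_gt0 mf0 ind lawX lawxi n dk).
- apply/measurable_EFinP; apply: (measurableT_comp (@measurable_expR R)).
  apply: measurable_funM => //.
  by apply: (measurable_llr sigma0 mf0 ind n (measurable_cst _)).
- by move=> w; rewrite lee_fin expR_ge0.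
split=> //; apply: (le_trans PA); rewrite lee_fin -expRN -expRD ler_expR; lra.
Qed.

Definition bad_centers : set Omega :=
  \big[setU/set0]_(kap <- enum {ffun 'I_K -> 'I_M}) center_event kap.

Lemma measurable_bad_centers : measurable bad_centers.
Proof. by apply: bigsetU_measurable => kap _; have [] := center_eventP kap. Qed.

Lemma prob_bad_centers :
  (P bad_centers <= ((M ^ K)%:R * expR (c / 2 - n%:R * (eps / 2)))%:E)%E.
Proof.
apply: (le_trans (prob_bigsetU_le P _ _)); first by move=> kap; have [] := center_eventP kap.
apply: (@le_trans _ _ (\sum_(kap <- enum {ffun 'I_K -> 'I_M})
    (expR (c / 2 - n%:R * (eps / 2)))%:E)%E).
  by apply: lee_sum => kap _; have [] := center_eventP kap.
rewrite big_enum sumEFin sumr_const lee_fin cardT -cardE card_ffun !card_ord.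
by rewrite [leRHS]mulr_natl.
Qed.

Variables (v T : R).
Hypotheses (v_gt0 : 0 < v) (T_gt0 : 0 < T).
Hypothesis grid_fine : K%:R * (1 + C) * r *
  (n%:R * (2 + 4 * (K%:R * C)) + v * (1 + tau^-1)) <= sigma0 ^+ 2 *+ 2.

(** The centre of the cell of [t] has log-likelihood ratio at most - c, and [grid_fine] limits its
    variation over the cell to one. *)
Lemma llr_sieve_le w : ~ outside_cube w -> ~ bad_centers w -> fit w <= v ->
  forall t : K.-tuple R, sieve C t -> (eps%:E <= dH sigma0 p f0 k t)%E ->
  ell t w + c <= 1.
Proof.
move=> wo wb wv t tC td; have [kap tk] := cellP tC td.
have ck : cell kap (center kap) by exact: (xgetPex t0 (ex_intro _ t tk)).
have cl : ell (center kap) w <= - c.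
  rewrite leNgt; apply/negP => lt_c; apply: wb.
  rewrite /bad_centers -bigcup_seq; exists kap; first by rewrite /= mem_enum.
  by split.
have [cC _ cr] := ck; have [_ _ tr] := tk.
set D := K%:R * (1 + C) * r; set B := 2 * (K%:R * C).
have D0 : 0 <= D by rewrite mulr_ge0 ?(ltW r_gt0)// mulr_ge0// addr_ge0.
have tcr i : `|tnth t i - tnth (center kap) i| <= r.
  have /andP[a1 a2] := cr i; have /andP[b1 b2] := tr i.
  have e : (kap i).+1%:R * r = (kap i)%:R * r + r by rewrite -addn1 natrD; ring.
  by rewrite ler_norml; apply/andP; split; lra.
have nnB (u : K.-tuple R) x : sieve C u -> `|nnet k p u x| <= K%:R * C.
  by move=> uC; apply: nnet_norm_le; apply: nth_tuple_le => //; exact/forallP.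
have resB (u : K.-tuple R) x : sieve C u ->
    `|residual f0 k u x| <= `|residual f0 k t0 x| + B.
  move=> uC.
  have -> : residual f0 k u x = residual f0 k t0 x + (nnet k p u x - nnet k p t0 x).
    by rewrite /residual; ring.
  apply: (le_trans (ler_normD _ _)); rewrite lerD2l; apply: (le_trans (ler_normB _ _)).
  by have := nnB u x uC; have := nnB t0 x t0C; rewrite /B; lra.
have diff : ell t w - ell (center kap) w <=
    \sum_(i < n) (D * (2 + 2 * B + xi i w ^+ 2 + residual f0 k t0 (xvec p X i w) ^+ 2) /
      (sigma0 ^+ 2 *+ 2)).
  rewrite /llr -sumrB; apply: ler_sum => i _.
  rewrite -(real_normK (num_real (residual f0 k t0 _))); apply: llr_termB_le.
  - rewrite (_ : _ - _ = nnet k p t (xvec p X i w) - nnet k p (center kap) (xvec p X i w));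
      last by rewrite /residual; ring.
    apply: nnet_lipschitz.
    + exact: (in_cube_xvec wo).
    + by apply: nth_tuple_le => //; exact/forallP.
    + by apply: nth_tupleB_le => //; exact: ltW.
  - exact: resB.
  - exact: resB.
(* The factor 1 + 1 / tau undoes the weight tau on the noise, so that every square is recovered with
   coefficient at least one. *)
have sum_le : \sum_(i < n) (xi i w ^+ 2 + residual f0 k t0 (xvec p X i w) ^+ 2) <=
    v * (1 + tau^-1).
  apply: (@le_trans _ _ (fit w * (1 + tau^-1))); last by apply: ler_wpM2r => //; exact: ltW.
  rewrite /fit_stat mulr_suml; apply: ler_sum => i _.
  set a := xi i w ^+ 2; set b := residual _ _ _ _ ^+ 2.
  have a0 : 0 <= a by exact: sqr_ge0.
  have b0 : 0 <= b by exact: sqr_ge0.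
  have ti : 0 < tau^-1 by rewrite invr_gt0.
  have e : tau * a * tau^-1 = a by rewrite mulrAC divff ?mul1r// gt_eqF.
  have h1 : 0 <= tau^-1 * b by rewrite mulr_ge0// ltW.
  have h2 : 0 <= tau * a by rewrite mulr_ge0// ltW.
  have h3 : 0 <= tau^-1 * (tau^-1 * b) by rewrite mulr_ge0// ltW.
  lra.
suff : ell t w - ell (center kap) w <= 1 by lra.
apply: (le_trans diff); rewrite -mulr_suml ler_pdivrMr ?pmulrn_lgt0 ?exprn_gt0// mul1r.
apply: le_trans grid_fine; rewrite -mulr_sumr; apply: ler_wpM2l => //.
have -> : \sum_(i < n) (2 + 2 * B + xi i w ^+ 2 + residual f0 k t0 (xvec p X i w) ^+ 2) =
    n%:R * (2 + 2 * B) + \sum_(i < n) (xi i w ^+ 2 + residual f0 k t0 (xvec p X i w) ^+ 2).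
  under eq_bigr do rewrite -addrA.
  by rewrite big_split/= sumr_const card_ord [n%:R * _]mulr_natl.
by rewrite lerD//; apply: ler_wpM2l => //; rewrite /B; lra.
Qed.

Variables (ms ss : Omega -> K.-tuple R) (s nd eta : R).
Hypothesis s_range : 0 < s <= zeta.
Hypothesis vp : forall w,
  is_variational_posterior sigma0 zeta p k n X y w (ms w) (ss w).
Hypotheses (nd_ge0 : 0 <= nd) (c_gt0 : 0 < c).
Hypothesis rate : nd * (K%:R * ln (zeta / s) +
  (\sum_(i < K) tnth t0 i ^+ 2) / zeta ^+ 2 + v / (sigma0 ^+ 2 *+ 2) +
  kl_slope p sigma0 zeta n k tau C * (K%:R * (8 * s ^+ 2)) + ln (T + expR 1)) <= eta * c.

(** [good_sample_bound] applies off four events: a design point outside of the cube (null), a large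
    evidence, a centre with too large a likelihood, a large [fit_stat]. The other three account for
    the three summands, in this order. *)
Lemma finite_sample_bound :
  (outer_prob P [set w | (eta%:E < nd%:E *
     mass_outside_hellinger sigma0 p f0 k eps (ms w) (ss w))%E] <=
   ((1 + expR c * (K%:R * (expR (- (C ^+ 2 / (zeta ^+ 2 *+ 4))) * Num.sqrt 2))) / T +
    (M ^ K)%:R * expR (c / 2 - n%:R * (eps / 2)) +
    n%:R * ((1 + tau^-1) * (2 * gsq) + tau * (8 * sigma0 ^+ 2)) / v)%:E)%E.
Proof.
have [mW PW] := markov_ge0 T_gt0 measurable_sieved_evidence sieved_evidence_ge0
  integral_sieved_evidence.
have [||mV PV] := markov_ge0 (f := fun w => (fit w)%:E) v_gt0 _ _ integral_fit_stat.
- by apply/measurable_EFinP; exact: measurable_fit_stat.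
- by move=> w; rewrite lee_fin fit_stat_ge0.
set A1 := [set w | (T%:E < sieved_evidence w)%E] in mW PW.
set A3 := [set w | (v%:E < (fit w)%:E)%E] in mV PV.
set E := outside_cube `|` (A1 `|` (bad_centers `|` A3)).
have mE : measurable E.
  apply: measurableU; first exact: measurable_outside_cube.
  apply: measurableU => //; apply: measurableU => //; exact: measurable_bad_centers.
apply: (@le_trans _ _ (P E)).
  apply: ereal_inf_lbound; exists E => //; split=> // w /= Hw.
  apply: contrapT; rewrite /E => /not_orP[wo /not_orP[wA1 /not_orP[wb wA3]]].
  have wv : fit w <= v by rewrite leNgt -lte_fin; exact/negP.
  have wT : (sieved_evidence w <= T%:E)%E by rewrite leNgt; exact/negP.
  have := good_sample_bound sigma0_gt0 zeta_gt0 mf0 ind yE s_range tau_gt0 C_ge0 t0C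
    (fun i => in_cube_xvec wo (i := i)) wT (llr_sieve_le wo wb wv) (vp w).
  set b := (X in (_ <= X%:E)%E) => cb.
  have bc : (mass_outside_hellinger sigma0 p f0 k eps (ms w) (ss w) <= (b / c)%:E)%E.
    by rewrite mulrC EFinM lee_pdivlMl.
  move: Hw; rewrite ltNge => /negP; apply.
  apply: (le_trans (lee_wpmul2l _ bc)); first by rewrite lee_fin.
  rewrite -EFinM lee_fin mulrA ler_pdivrMr//; apply: le_trans rate.
  apply: ler_wpM2l => //; rewrite /b /kl_const.
  have : fit w / (sigma0 ^+ 2 *+ 2) <= v / (sigma0 ^+ 2 *+ 2).
    by apply: ler_wpM2r => //; rewrite invr_ge0 mulrn_wge0// sqr_ge0.
  lra.
apply: (le_trans (measureU2 _ _ _)) => //; first exact: measurable_outside_cube.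
  by apply: measurableU => //; apply: measurableU => //; exact: measurable_bad_centers.
rewrite [X in (X + _ <= _)%E]prob_outside_cubes add0e.
apply: (le_trans (measureU2 _ _ _)) => //.
  by apply: measurableU => //; exact: measurable_bad_centers.
rewrite -addrA EFinD; apply: leeD => //.
apply: (le_trans (measureU2 _ _ _)) => //; first exact: measurable_bad_centers.
by rewrite EFinD; apply: leeD => //; exact: prob_bad_centers.
Qed.
End finite_sample.

(** * Choice of the free parameters as powers of n *)

Section explicit_bound.
Context d (Omega : measurableType d) (R : realType) (P : probability Omega R).
Variables (p : nat) (sigma0 zeta : R) (f0 : p.-tuple R -> R).
Variables (X : nat -> 'I_p -> Omega -> R) (xi y : nat -> Omega -> R).
Hypotheses (sigma0_gt0 : 0 < sigma0) (zeta_gt0 : 0 < zeta).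
Hypothesis mf0 : measurable_fun setT f0.
Hypothesis ind : mutually_independent P (obs_family p X xi).
Hypothesis lawX : forall i h (B : set R), measurable B ->
  P (X i h @^-1` B) = lebesgue_measure (B `&` `[0, 1]%classic).
Hypothesis lawxi : forall i (B : set R), measurable B ->
  P (xi i @^-1` B) = normal_prob 0 sigma0 B.
Hypothesis yE : forall i w, y i w = f0 (xvec p X i w) + xi i w.

Variables (n k : nat) (t0 : (Kdim k p).-tuple R) (ms ss : Omega -> (Kdim k p).-tuple R).
Variables (nd C0 e eta eps G : R).
Local Notation K := (Kdim k p).
Local Notation N := (n%:R : R).
Local Notation kappa := (eta * eps * sigma0 ^+ 2 / 4).
Local Notation S0 := (\sum_(i < K) tnth t0 i ^+ 2).
Local Notation Q1 := ((zeta ^+ 2)^-1 + (1 + e^-1) * (4 * C0 ^+ 2) / sigma0 ^+ 2).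
Hypotheses (eps_gt0 : 0 < eps) (eta_gt0 : 0 < eta) (e_gt0 : 0 < e) (C0_gt0 : 0 < C0).
Hypothesis vp : forall w,
  is_variational_posterior sigma0 zeta p k n X y w (ms w) (ss w).
Hypotheses (N_ge3 : 3 <= N) (N_gez : zeta <= N) (N_gezi : zeta^-1 <= N)
  (N_gee : expR 1 <= N) (nd_range : 1 <= nd <= N) (K_le : K%:R <= C0 * N).
Hypothesis KlnN_le : nd * (K%:R * ln N) <= eta * eps / 288 * N.
Hypothesis KlnN_le' : 12 * (K%:R * ln N) <= eps / 8 * N.
Hypothesis S0_le : nd * S0 <= eta * eps * zeta ^+ 2 / 16 * N.
Hypothesis S0_leN : S0 <= N.
Hypothesis GE : cube_int p (fun x => (residual f0 k t0 x ^+ 2)%:E) = G%:E.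
Hypotheses (G_ge0 : 0 <= G) (G_le : nd * Num.sqrt G <= e).
Hypothesis N_ge1 : 2 * C0 * (2 + 4 * C0 + kappa * (1 + e^-1)) <= 2 * sigma0 ^+ 2 * N.
Hypothesis N_ge2 : 8 * Q1 * C0 <= eta * eps / 16 * N.
Hypothesis N_ge4 : 4 * zeta ^+ 2 * (eps / 2 + 2 * C0) <= N.

Let N0 : 0 < N. Proof. exact: lt_le_trans N_ge3. Qed.
Let N1 : 1 <= N. Proof. by apply: le_trans N_ge3; rewrite ler1n. Qed.
Let nd1 : 1 <= nd. Proof. by have /andP[] := nd_range. Qed.
Let ndN : nd <= N. Proof. by have /andP[] := nd_range. Qed.
Let nd0 : 0 < nd. Proof. exact: lt_le_trans nd1. Qed.
Let s2 : 0 < sigma0 ^+ 2. Proof. by rewrite exprn_gt0. Qed.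
Let z2 : 0 < zeta ^+ 2. Proof. by rewrite exprn_gt0. Qed.
Let kappa0 : 0 < kappa. Proof. by rewrite divr_gt0// !mulr_gt0. Qed.
Let ei0 : 0 < e^-1. Proof. by rewrite invr_gt0. Qed.
Let K1 : 1 <= K%:R :> R. Proof. by rewrite ler1n /Kdim add1n. Qed.
Let lnN0 : 0 <= ln N. Proof. exact: ln_ge0. Qed.

Let x := N^-1.
Let x0 : 0 < x. Proof. by rewrite invr_gt0. Qed.
Let xN : x * N = 1. Proof. by rewrite mulVf// gt_eqF. Qed.
Let x1 : x <= 1. Proof. by rewrite invf_le1. Qed.
Let xXn i : x ^+ i * N ^+ i = 1. Proof. by rewrite -exprMn xN expr1n. Qed.
Let Nx i j : N ^+ i * x ^+ (i + j) <= 1.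
Proof.
rewrite exprD mulrA [N ^+ i * _]mulrC xXn mul1r exprn_ile1// ltW//.
Qed.

(** Balances the two sides of [fit_term]: the noise costs nd * tau = e, and the approximation nd * G
    / tau = nd ^+ 2 * G / e <= e. *)
Let tau := e / nd.
Let tau0 : 0 < tau. Proof. by rewrite divr_gt0. Qed.
Let tauV : 1 + tau^-1 <= N * (1 + e^-1).
Proof.
rewrite invf_div mulrDr mulr1; apply: lerD => //.
by apply: ler_wpM2r => //; exact: ltW.
Qed.

Let sieve_t0 : sieve N t0.
Proof.
apply/forallP => i; rewrite -(@ler_sqr R)// ?nnegrE// ?(ltW N0)//.
rewrite real_normK ?num_real//; apply: (@le_trans _ _ N).
  apply: le_trans S0_leN; rewrite (bigD1 i)//= lerDl.
  by apply: sumr_ge0 => j _; exact: sqr_ge0.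
by rewrite expr2 ler_peMr// ltW.
Qed.

Let KN : K%:R * (1 + N) <= 2 * C0 * N ^+ 2.
Proof.
apply: (@le_trans _ _ (C0 * N * (2 * N))); last first.
  by rewrite le_eqVlt; apply/orP; left; apply/eqP; ring.
by apply: ler_pM => //; have := N1; lra.
Qed.

(** One power of [N] comes from the sample size, one from 1 + 1 / tau, and four from the square of K
    (1 + N). *)
Let slope_le : kl_slope p sigma0 zeta n k tau N <= Q1 * N ^+ 6.
Proof.
rewrite /kl_slope [leRHS]mulrDl; apply: lerD.
  by rewrite ler_peMr ?invr_ge0 ?(ltW z2)// exprn_ege1.
have -> : (1 + e^-1) * (4 * C0 ^+ 2) / sigma0 ^+ 2 * N ^+ 6 =
    N * (N * (1 + e^-1)) * (2 * (2 * C0 * N ^+ 2) ^+ 2) / (sigma0 ^+ 2 *+ 2).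
  by field; rewrite !gt_eqF.
apply: ler_wpM2r; first by rewrite invr_ge0 mulrn_wge0// ltW.
have t1 : 0 <= 1 + tau^-1 by rewrite addr_ge0// invr_ge0 ltW.
apply: ler_pM.
- by rewrite mulr_ge0.
- by rewrite mulr_ge0// sqr_ge0.
- exact: ler_wpM2l.
- apply: ler_wpM2l => //; rewrite lerXn2r// nnegrE.
    by rewrite mulr_ge0// addr_ge0.
  by rewrite !mulr_ge0// ?sqr_ge0// ltW.
Qed.

(** [nd] and [K%:R] add one power each to the six of [slope_le]; the variance x ^+ 16 absorbs all
    eight. *)
Let slope_term : nd * (kl_slope p sigma0 zeta n k tau N * (K%:R * (8 * (x ^+ 8) ^+ 2))) <=
  eta * eps / 16 * N.
Proof.
apply: le_trans N_ge2.
have Q0 : 0 <= Q1.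
  rewrite addr_ge0 ?invr_ge0 ?(ltW z2)//.
  by rewrite divr_ge0 ?(ltW s2)// mulr_ge0// ?addr_ge0// ?mulr_ge0 ?sqr_ge0// ltW.
have sl0 : 0 <= kl_slope p sigma0 zeta n k tau N by apply: kl_slope_ge0.
apply: (@le_trans _ _ (N * ((Q1 * N ^+ 6) * ((C0 * N) * (8 * (x ^+ 8) ^+ 2))))).
  have e16 : 0 <= 8 * (x ^+ 8) ^+ 2 by rewrite mulr_ge0// sqr_ge0.
  apply: ler_pM => //; first exact: ltW.
    by rewrite mulr_ge0// mulr_ge0.
  apply: ler_pM => //; first by rewrite mulr_ge0.
  exact: ler_wpM2r.
have -> : N * ((Q1 * N ^+ 6) * ((C0 * N) * (8 * (x ^+ 8) ^+ 2))) =
  8 * Q1 * C0 * (N ^+ 8 * x ^+ (8 + 8)) by rewrite -exprM; ring.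
rewrite -[leRHS]mulr1; apply: ler_wpM2l (Nx 8 8).
by rewrite mulr_ge0 ?(ltW C0_gt0)// mulr_ge0.
Qed.

(** The other factors grow like N ^+ 5 in all, against the mesh x ^+ 10; [N_ge1] takes care of the
    constant. *)
Let grid_fine : K%:R * (1 + N) * x ^+ 10 *
  (N * (2 + 4 * (K%:R * N)) + kappa * N / nd * (1 + tau^-1)) <= sigma0 ^+ 2 *+ 2.
Proof.
have t1 : 0 <= 1 + tau^-1 by rewrite addr_ge0// invr_ge0 ltW.
have e1 : 0 <= 1 + e^-1 by rewrite addr_ge0// ltW.
have h1 : N * (2 + 4 * (K%:R * N)) <= N ^+ 3 * (2 + 4 * C0).
  have -> : N ^+ 3 * (2 + 4 * C0) = N * (2 * N ^+ 2 + 4 * (C0 * N * N)) by ring.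
  apply: ler_wpM2l => //; apply: lerD.
    by rewrite ler_peMr// exprn_ege1.
  by apply: ler_wpM2l => //; exact: ler_wpM2r.
have h2 : kappa * N / nd * (1 + tau^-1) <= N ^+ 3 * (kappa * (1 + e^-1)).
  apply: (@le_trans _ _ (kappa * N * (N * (1 + e^-1)))).
    apply: ler_pM => //.
      by rewrite divr_ge0 ?(ltW nd0)// mulr_ge0// ltW.
    rewrite ler_pdivrMr// ler_peMr// mulr_ge0// ltW//.
  have -> : kappa * N * (N * (1 + e^-1)) = N ^+ 2 * (kappa * (1 + e^-1)) by ring.
  apply: ler_wpM2r; first by rewrite mulr_ge0// ltW.
  by rewrite ler_weXn2l.
apply: (@le_trans _ _ (2 * C0 * N ^+ 2 * x ^+ 10 *
    (N ^+ 3 * (2 + 4 * C0 + kappa * (1 + e^-1))))).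
  apply: ler_pM.
  - by rewrite mulr_ge0 ?exprn_ge0 ?(ltW x0)// mulr_ge0// addr_ge0.
  - apply: addr_ge0; first by apply: mulr_ge0 => //; apply: addr_ge0 => //; rewrite !mulr_ge0.
    by rewrite mulr_ge0// divr_ge0 ?(ltW nd0)// mulr_ge0// ltW.
  - by apply: ler_wpM2r => //; rewrite exprn_ge0// ltW.
  - by rewrite [N ^+ 3 * _]mulrDr; apply: lerD.
have -> : 2 * C0 * N ^+ 2 * x ^+ 10 * (N ^+ 3 * (2 + 4 * C0 + kappa * (1 + e^-1))) =
  (2 * C0 * (2 + 4 * C0 + kappa * (1 + e^-1))) * x * (N ^+ 5 * x ^+ (5 + 4)) by ring.
rewrite -[leRHS]mulr_natl -[leRHS]mulr1; apply: ler_pM (Nx 5 4) => //.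
- have k0 : 0 <= kappa * (1 + e^-1) by rewrite mulr_ge0// ltW.
  rewrite mulr_ge0 ?(ltW x0)// mulr_ge0 ?mulr_ge0 ?(ltW C0_gt0)//.
  by rewrite addr_ge0// addr_ge0// mulr_ge0// ltW.
- by rewrite mulr_ge0 ?exprn_ge0 ?(ltW x0).
- by rewrite /x ler_pdivrMr.
Qed.

(** The interval [-N, N] holds 2 N ^+ 11 boxes of side N ^- 10; one more makes [N_le_Mr] strict. *)
Let M := (2 * n ^ 11 + 1)%N.

Let ME : M%:R = 2 * N ^+ 11 + 1. Proof. by rewrite natrD natrM natrX. Qed.

Let N_le_Mr : 2 * N < M%:R * x ^+ 10.
Proof.
have -> : M%:R * x ^+ 10 = 2 * N * (x ^+ 10 * N ^+ 10) + x ^+ 10 by rewrite ME; ring.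
by rewrite xXn mulr1 ltrDl exprn_gt0.
Qed.

Let ln_zeta_le : ln (zeta / x ^+ 8) <= 9 * ln N.
Proof.
have x8 : (x ^+ 8)^-1 = N ^+ 8 by rewrite /x exprVn invrK.
rewrite x8 lnM ?posrE ?exprn_gt0// lnXn// -[ln N *+ 8]mulr_natl.
have : ln zeta <= ln N by rewrite ler_ln.
lra.
Qed.

Let ln_T_le : ln (N + expR 1) <= 2 * ln N.
Proof.
have -> : 2 * ln N = ln (N ^+ 2) by rewrite lnXn// mulr_natl.
rewrite ler_ln ?posrE ?exprn_gt0// ?addr_gt0 ?expR_gt0// expr2.
have : 3 * N <= N * N by exact: ler_wpM2r.
have := N_gee; have := N0; lra.
Qed.

(** In units of eta * eps * N / 288 the budget is 144, and the five terms take at most 9, 18, 36, 18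
    and 2. The value of [kappa] is what gives the third one. *)
Let rate : nd * (K%:R * ln (zeta / x ^+ 8) + S0 / zeta ^+ 2 +
  (kappa * N / nd) / (sigma0 ^+ 2 *+ 2) +
  kl_slope p sigma0 zeta n k tau N * (K%:R * (8 * (x ^+ 8) ^+ 2)) +
  ln (N + expR 1)) <= eta * (N * (eps / 2)).
Proof.
rewrite !mulrDr.
have h1 : nd * (K%:R * ln (zeta / x ^+ 8)) <= 9 * (eta * eps / 288 * N).
  apply: (@le_trans _ _ (9 * (nd * (K%:R * ln N)))); last exact: ler_wpM2l.
  have -> : 9 * (nd * (K%:R * ln N)) = nd * (K%:R * (9 * ln N)) by ring.
  by apply: ler_wpM2l; [exact: ltW|apply: ler_wpM2l].
have h2 : nd * (S0 / zeta ^+ 2) <= eta * eps / 16 * N.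
  rewrite mulrA ler_pdivrMr//; apply: le_trans S0_le _.
  by rewrite le_eqVlt; apply/orP; left; apply/eqP; ring.
have h3 : nd * (kappa * N / nd / (sigma0 ^+ 2 *+ 2)) = eta * eps / 8 * N.
  by field; rewrite !gt_eqF.
have h5 : nd * ln (N + expR 1) <= 2 * (eta * eps / 288 * N).
  apply: (@le_trans _ _ (nd * (2 * ln N))); first by apply: ler_wpM2l; first exact: ltW.
  apply: (@le_trans _ _ (2 * (nd * (K%:R * ln N)))); last exact: ler_wpM2l.
  have -> : nd * (2 * ln N) = 2 * (nd * ln N) by ring.
  apply: ler_wpM2l => //; apply: ler_wpM2l; first exact: ltW.
  by rewrite ler_peMl.
rewrite h3; have h4 := slope_term.
have pos : 0 < eta * eps * N by rewrite !mulr_gt0.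
have -> : eta * (N * (eps / 2)) = (eta * eps * N) / 2 by ring.
apply: (@le_trans _ _ (9 * (eta * eps / 288 * N) + eta * eps / 16 * N + eta * eps / 8 * N +
  eta * eps / 16 * N + 2 * (eta * eps / 288 * N))).
  by repeat apply: lerD.
have -> : 9 * (eta * eps / 288 * N) + eta * eps / 16 * N + eta * eps / 8 * N +
  eta * eps / 16 * N + 2 * (eta * eps / 288 * N) = (eta * eps * N) * (83 / 288) by field.
by apply: ler_wpM2l; [exact: ltW|lra].
Qed.

(** By [N_ge4] the Gaussian decay exp (- N^2 / (4 zeta^2)) outweighs both exp c and the
    dimension. *)
Let sieve_term : (1 + expR (N * (eps / 2)) *
  (K%:R * (expR (- (N ^+ 2 / (zeta ^+ 2 *+ 4))) * Num.sqrt 2))) / N <= 2 / N.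
Proof.
apply: ler_wpM2r; first by rewrite invr_ge0.
suff : expR (N * (eps / 2)) *
  (K%:R * (expR (- (N ^+ 2 / (zeta ^+ 2 *+ 4))) * Num.sqrt 2)) <= 1 by lra.
have r2 : Num.sqrt 2 <= 2 :> R.
  by rewrite -[leRHS]ger0_norm// -sqrtr_sqr ler_sqrt ?sqr_ge0//; lra.
have KE : K%:R * Num.sqrt 2 <= expR (2 * C0 * N).
  apply: (@le_trans _ _ (C0 * N * 2)); first by apply: ler_pM; rewrite ?sqrtr_ge0.
  by apply: le_trans (expR_ge1Dx _); lra.
have -> : expR (N * (eps / 2)) *
    (K%:R * (expR (- (N ^+ 2 / (zeta ^+ 2 *+ 4))) * Num.sqrt 2)) =
    expR (N * (eps / 2) - N ^+ 2 / (zeta ^+ 2 *+ 4)) * (K%:R * Num.sqrt 2).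
  by rewrite expRD; ring.
apply: (le_trans (ler_wpM2l _ KE)); first exact: expR_ge0.
rewrite -expRD -[leRHS]expR0 ler_expR.
have -> : N * (eps / 2) - N ^+ 2 / (zeta ^+ 2 *+ 4) + 2 * C0 * N =
  N * (4 * zeta ^+ 2 * (eps / 2 + 2 * C0) - N) / (zeta ^+ 2 *+ 4) by field; rewrite gt_eqF.
by rewrite pmulr_lle0 ?invr_gt0 ?pmulrn_lgt0// pmulr_rle0// subr_le0.
Qed.

(** Chernoff's bound leaves the exponent - N eps / 4; half of it pays for the M^K <= N^(12 K) <= exp
    (N eps / 8) cells. *)
Let center_term : (M ^ K)%:R * expR (N * (eps / 2) / 2 - N * (eps / 2)) <=
  expR (- (N * (eps / 8))).
Proof.
have MN : M%:R <= N ^+ 12.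
  rewrite ME exprS; apply: (@le_trans _ _ (3 * N ^+ 11)); last first.
    by apply: ler_wpM2r => //; rewrite exprn_ge0.
  by have := exprn_ege1 11 N1; lra.
have ME' : (M ^ K)%:R <= expR (eps / 8 * N).
  rewrite natrX; apply: (@le_trans _ _ ((N ^+ 12) ^+ K)).
    by apply: lerXn2r => //; rewrite nnegrE ?exprn_ge0.
  apply: (@le_trans _ _ (expR (12 * (K%:R * ln N)))); last by rewrite ler_expR.
  have -> : 12 * (K%:R * ln N) = K%:R * (12%:R * ln N) by ring.
  by rewrite !expRM_natl lnK.
apply: (le_trans (ler_wpM2r _ ME')); first exact: expR_ge0.
by rewrite -expRD ler_expR; lra.
Qed.

(** The sample size cancels in Markov's ratio. The three terms on the right come from the parts 1, 1
    / tau and tau of the weights. *)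
Let fit_term : N * ((1 + tau^-1) * (2 * G) + tau * (8 * sigma0 ^+ 2)) / (kappa * N / nd) <=
  (2 * e ^+ 2 + 2 * e + 8 * sigma0 ^+ 2 * e) / kappa.
Proof.
have G2 : nd ^+ 2 * G <= e ^+ 2.
  rewrite -[G]sqr_sqrtr// -exprMn lerXn2r// nnegrE.
    by rewrite mulr_ge0 ?sqrtr_ge0// ltW.
  exact: ltW.
have G1 : nd * G <= e ^+ 2.
  by apply: le_trans G2; apply: ler_wpM2r => //; rewrite expr2 ler_peMl// ltW.
have -> : N * ((1 + tau^-1) * (2 * G) + tau * (8 * sigma0 ^+ 2)) / (kappa * N / nd) =
    (2 * (nd * G) + 2 * ((nd ^+ 2 * G) / e) + 8 * sigma0 ^+ 2 * e) / kappa.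
  by rewrite /tau; field; rewrite !gt_eqF.
apply: ler_wpM2r; first by rewrite invr_ge0 ltW.
rewrite lerD2r; apply: lerD; apply: ler_wpM2l => //.
by rewrite ler_pdivrMr// -expr2.
Qed.

Lemma explicit_bound :
  (outer_prob P [set w | (eta%:E < nd%:E *
     mass_outside_hellinger sigma0 p f0 k eps (ms w) (ss w))%E] <=
   (2 / N + expR (- (N * (eps / 8))) +
    (2 * e ^+ 2 + 2 * e + 8 * sigma0 ^+ 2 * e) / kappa)%:E)%E.
Proof.
have s_range : 0 < x ^+ 8 <= zeta.
  rewrite exprn_gt0//=; apply: (@le_trans _ _ x); last first.
    by rewrite /x -[zeta]invrK lef_pV2 ?posrE ?invr_gt0.
  by rewrite exprS ger_pMr// exprn_ile1// ltW.
have c0 : 0 < N * (eps / 2) by rewrite mulr_gt0// divr_gt0.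
have v0 : 0 < kappa * N / nd by rewrite divr_gt0// mulr_gt0.
have GE' : (cube_int p (fun x => (residual f0 k t0 x ^+ 2)%:E) <= G%:E)%E by rewrite GE.
have := finite_sample_bound sigma0_gt0 zeta_gt0 mf0 ind lawX lawxi yE (ltW N0) tau0
  sieve_t0 GE' eps (exprn_gt0 10 x0) N_le_Mr v0 N0 grid_fine s_range vp (ltW nd0) c0 rate.
move/le_trans; apply; rewrite lee_fin; apply: lerD fit_term; apply: lerD center_term.
exact: sieve_term.
Qed.
End explicit_bound.

(** * Limits and growth rates *)

Section limits.
Context {R : realType}.

Lemma cvge0_near (u : nat -> \bar R) :
  (forall e, 0 < e -> \forall n \near \oo, (0 <= u n <= e%:E)%E) ->
  u @ \oo --> 0%E.
Proof.
move=> H; apply/fine_cvgP; split.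
  near=> n; have /andP[u0 u1] : (0 <= u n <= 1%:E)%E by near: n; exact: H.
  by rewrite ge0_fin_numE// (le_lt_trans u1)// ltry.
apply/cvgrPdist_le => e e0; near=> n.
have /andP[u0 u1] : (0 <= u n <= e%:E)%E by near: n; exact: H.
rewrite /= sub0r normrN ger0_norm ?fine_ge0//.
by rewrite -lee_fin fineK// ge0_fin_numE// (le_lt_trans u1)// ltry.
Unshelve. all: by end_near. Qed.

Lemma near_powR_ge (b A : R) : 0 < b -> \forall n \near \oo, A <= n%:R `^ b.
Proof.
move=> b0; pose A' := Num.max A 1; have A0 : 0 < A' by rewrite lt_max ltr01 orbT.
near=> n; apply: (@le_trans _ _ A'); first by rewrite le_max lexx.
rewrite -[leLHS]powRr1 ?(ltW A0)// -[X in A' `^ X](mulVf (lt0r_neq0 b0)) powRrM.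
apply: ge0_ler_powR; rewrite ?nnegrE ?powR_ge0// ?(ltW b0)//.
by near: n; exact: nbhs_infty_ger.
Unshelve. all: by end_near. Qed.

(** The gap 1 - g is halved: with b = (1 - g) / 2, one factor n^b dominates b ln n and the other one
    beats the constant. *)
Lemma near_powR_mul_ln_le (g e : R) : g < 1 -> 0 < e ->
  \forall n \near \oo, n%:R `^ g * ln n%:R <= e * n%:R.
Proof.
move=> g1 e0; pose b := (1 - g) / 2; have b0 : 0 < b by rewrite divr_gt0// subr_gt0.
near=> n.
have n1 : 1 <= n%:R :> R by near: n; exact: nbhs_infty_ger.
have n0 : 0 < n%:R :> R by exact: lt_le_trans n1.
have nb : (e * b)^-1 <= n%:R `^ b :> R by near: n; exact: near_powR_ge.
have lnb : ln n%:R <= b^-1 * n%:R `^ b :> R.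
  rewrite ler_pdivlMl// -ln_powR.
  have nb0 : 0 < n%:R `^ b :> R by rewrite powR_gt0.
  have h : -1 < n%:R `^ b - 1 :> R by lra.
  have := le_ln1Dx h; rewrite (_ : 1 + (n%:R `^ b - 1) = n%:R `^ b); last by ring.
  lra.
apply: (@le_trans _ _ (n%:R `^ g * (b^-1 * n%:R `^ b))).
  by apply: ler_wpM2l => //; exact: powR_ge0.
have -> : n%:R `^ g * (b^-1 * n%:R `^ b) = b^-1 * (n%:R `^ g * n%:R `^ b) :> R by ring.
rewrite -powRD ?(gt_eqF n0) ?implybT//.
have split1 : n%:R = n%:R `^ (g + b) * n%:R `^ b :> R.
  rewrite -powRD ?(gt_eqF n0) ?implybT// (_ : g + b + b = 1) ?powRr1// ?(ltW n0)//.
  by rewrite /b; field.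
rewrite [in leRHS]split1 mulrA [e * _]mulrC -mulrA [leLHS]mulrC.
apply: ler_wpM2l; first exact: powR_ge0.
by rewrite -ler_pdivrMl// -invfM.
Unshelve. all: by end_near. Qed.

Lemma iint_ge0 n (f : n.-tuple R -> \bar R) : (forall t, 0 <= f t)%E -> (0 <= iint n f)%E.
Proof.
elim: n f => [|n IH] f f0 /=; first exact: f0.
by apply: integral_ge0 => x _; apply: IH => t; exact: f0.
Qed.

(** A positive multiple of an infinite norm cannot lie below [e], so the bound also forces the
    integral to be finite. *)
Lemma L2cube_le p (g : p.-tuple R -> R) (c e : R) : 0 < c ->
  (c%:E * L2cube p g <= e%:E)%E ->
  exists G, [/\ cube_int p (fun x => (g x ^+ 2)%:E) = G%:E, 0 <= G & c * Num.sqrt G <= e].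
Proof.
move=> c0; rewrite /L2cube; set I := cube_int p _.
have I0 : (0 <= I)%E.
  by apply: iint_ge0 => t; case: ifP => // _; rewrite lee_fin sqr_ge0.
case: I I0 => [r|//|//] r0; last first.
  by rewrite poweRyr ?invr_neq0// gt0_muley ?lte_fin// leye_eq.
rewrite lee_fin in r0; rewrite poweR_EFin powR12_sqrt// -EFinM lee_fin => H.
by exists r.
Qed.

(** Eventually k_n <= 2 n^a and 1 <= n^a, whence 1 + k_n (p + 1) <= (2 p + 3) n^a. *)
Lemma near_Kdim_le (k : nat -> nat) (p : nat) (a : R) : 0 <= a ->
  (fun n : nat => (k n)%:R / n%:R `^ a) @ \oo --> (1 : R) ->
  \forall n \near \oo, (Kdim (k n) p)%:R <= (2 * p%:R + 3) * n%:R `^ a.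
Proof.
move=> a0 /cvgrPdist_le /(_ _ ltr01) H; near=> n.
have n1 : 1 <= n%:R :> R by near: n; exact: nbhs_infty_ger.
have na1 : 1 <= n%:R `^ a :> R by rewrite -[leLHS](powRr0 n%:R) ler_powR.
have na0 : 0 < n%:R `^ a :> R by exact: lt_le_trans na1.
have kn2 : (k n)%:R <= 2 * n%:R `^ a.
  rewrite -ler_pdivrMr//.
  have : `|1 - (k n)%:R / n%:R `^ a| <= 1 by near: n.
  by rewrite ler_norml => /andP[h _]; rewrite -subr_ge0; lra.
have h : (k n)%:R * (p%:R + 1) <= 2 * n%:R `^ a * (p%:R + 1).
  by apply: ler_wpM2r => //; rewrite addr_ge0.
rewrite /Kdim natrD natrM natrD; move: na1 h; set t := n%:R `^ a => na1 h.
by rewrite (_ : (2 * p%:R + 3) * t = 2 * t * (p%:R + 1) + t); [lra|ring].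
Unshelve. all: by end_near. Qed.

Lemma near_Kdim_ln_le (k : nat -> nat) (p : nat) (a delta c : R) :
  0 <= a -> delta + a < 1 -> 0 < c ->
  (fun n : nat => (k n)%:R / n%:R `^ a) @ \oo --> (1 : R) ->
  \forall n \near \oo,
    n%:R `^ delta * ((Kdim (k n) p)%:R * ln n%:R) <= c * n%:R.
Proof.
move=> a0 da c0 kna; pose C : R := 2 * p%:R + 3.
have C0 : 0 < C by rewrite ltr_wpDl// mulr_ge0.
have H1 := near_Kdim_le p a0 kna.
have H2 := near_powR_mul_ln_le da (divr_gt0 c0 C0).
near=> n.
have n1 : 1 <= n%:R :> R by near: n; exact: nbhs_infty_ger.
have n0 : n%:R != 0 :> R by rewrite gt_eqF// (lt_le_trans _ n1).
have h1 : (Kdim (k n) p)%:R <= C * n%:R `^ a by near: n; exact: H1.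
have h2 : n%:R `^ (delta + a) * ln n%:R <= c / C * n%:R by near: n; exact: H2.
have l0 : 0 <= ln n%:R :> R by exact: ln_ge0.
apply: (@le_trans _ _ (n%:R `^ delta * (C * n%:R `^ a * ln n%:R))).
  by apply: ler_wpM2l; [exact: powR_ge0|exact: ler_wpM2r].
rewrite powRD ?n0 ?implybT// in h2.
have -> : n%:R `^ delta * (C * n%:R `^ a * ln n%:R) =
  C * (n%:R `^ delta * n%:R `^ a * ln n%:R) by ring.
by rewrite -ler_pdivlMl// mulrA [C^-1 * c]mulrC.
Unshelve. all: by end_near. Qed.

Lemma near_powR_mul_le (S : nat -> R) (delta c : R) : 0 < c ->
  (fun n : nat => S n / n%:R `^ (1 - delta)) @ \oo --> (0 : R) ->
  \forall n \near \oo, n%:R `^ delta * S n <= c * n%:R.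
Proof.
move=> c0 /cvgrPdist_le /(_ _ c0) H; near=> n.
have n0 : 0 < n%:R :> R by near: n; exact: nbhs_infty_gtr.
have : `|0 - S n / n%:R `^ (1 - delta)| <= c by near: n; exact: H.
rewrite sub0r normrN => /(le_trans (ler_norm _)).
rewrite ler_pdivrMr ?powR_gt0// => h.
have -> : c * n%:R = n%:R `^ delta * (c * n%:R `^ (1 - delta)).
  rewrite mulrCA -powRD ?(gt_eqF n0) ?implybT//.
  by rewrite (_ : delta + (1 - delta) = 1) ?powRr1 ?(ltW n0)//; ring.
by apply: ler_wpM2l => //; exact: powR_ge0.
Unshelve. all: by end_near. Qed.

Lemma near_L2cube_le (p : nat) (g : nat -> p.-tuple R -> R) (delta e : R) : 0 < e ->
  (fun n : nat => (n%:R `^ delta)%:E * L2cube p (g n))%E @ \oo --> 0%E ->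
  \forall n \near \oo, exists G,
    [/\ cube_int p (fun x => (g n x ^+ 2)%:E) = G%:E, 0 <= G &
        n%:R `^ delta * Num.sqrt G <= e].
Proof.
move=> e0 /fine_cvgP[fin /cvgrPdist_le /(_ _ e0) H]; near=> n.
have n0 : 0 < n%:R :> R by near: n; exact: nbhs_infty_gtr.
apply: L2cube_le; first exact: powR_gt0.
have fn : ((n%:R `^ delta)%:E * L2cube p (g n))%E \is a fin_num by near: n; exact: fin.
rewrite -(fineK fn) lee_fin; apply: le_trans (ler_norm _) _; rewrite -normrN -sub0r.
by near: n; exact: H.
Unshelve. all: by end_near. Qed.

Lemma outer_prob_ge0 d (Omega : measurableType d) (P : probability Omega R) A :
  (0 <= outer_prob P A)%E.
Proof. by apply: le_ereal_inf_tmp => _ [E [mE _] <-]. Qed.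
End limits.

(** * From the explicit bound to the limit *)

Theorem theorem1 (R : realType) (d : measure_display) (Omega : measurableType d)
  (P : probability Omega R)
  (p : nat) (sigma0 zeta a delta : R) (k : nat -> nat)
  (f0 : p.-tuple R -> R)
  (X : nat -> 'I_p -> Omega -> R) (xi : nat -> Omega -> R)
  (y : nat -> Omega -> R)
  (mstar sstar : forall n : nat, Omega -> (Kdim (k n) p).-tuple R) :
  0 < sigma0 -> 0 < zeta ->
  measurable_fun setT f0 ->
  (* data: x_i ~ U(0,1)^p, xi_i ~ N(0, sigma0^2), all independent *)
  mutually_independent P (obs_family p X xi) ->
  (forall i h (B : set R), measurable B ->
     P (X i h @^-1` B) = lebesgue_measure (B `&` `[0, 1]%classic)) ->
  (forall i (B : set R), measurable B ->
     P (xi i @^-1` B) = normal_prob 0 sigma0 B) ->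
  (forall i w, y i w = f0 (xvec p X i w) + xi i w) ->
  (* k_n ~ n^a with 0 < a < 1 *)
  0 < a < 1 ->
  (fun n : nat => (k n)%:R / n%:R `^ a) @ \oo --> (1 : R) ->
  0 <= delta < 1 - a ->
  (* (A1) and (A2) *)
  (exists theta0 : forall n : nat, (Kdim (k n) p).-tuple R,
     ((fun n : nat => (n%:R `^ delta)%:E *
         L2cube p (fun x => (nnet (k n) p (theta0 n) x - f0 x)%R))%E
        @ \oo --> 0%E) /\
     ((fun n : nat => (\sum_(t <- theta0 n) t ^+ 2) / n%:R `^ (1 - delta))
        @ \oo --> (0 : R))) ->
  (* pi^* is the variational posterior (any KL minimizer over Q_n) *)
  (forall n w, is_variational_posterior sigma0 zeta p (k n) n X y w
                 (mstar n w) (sstar n w)) ->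
  forall eps : R, 0 < eps ->
  forall eta : R, 0 < eta ->
    (fun n : nat => outer_prob P
       [set w | (eta%:E < (n%:R `^ delta)%:E *
          mass_outside_hellinger sigma0 p f0 (k n) eps (mstar n w) (sstar n w))%E])
    @ \oo --> 0%E.
Proof.
move=> sigma0_gt0 zeta_gt0 mf0 ind lawX lawxi yE /andP[a0 a1] kna /andP[delta0 delta1].
move=> [theta0 [A1 A2]] vp eps eps0 eta eta0.
set kappa := eta * eps * sigma0 ^+ 2 / 4.
have kappa_gt0 : 0 < kappa by rewrite divr_gt0// !mulr_gt0 ?exprn_gt0.
apply: cvge0_near => rho rho0.
have s2 : 0 < sigma0 ^+ 2 by rewrite exprn_gt0.
have z2 : 0 < zeta ^+ 2 by rewrite exprn_gt0.
have B0 : 0 < 4 + 8 * sigma0 ^+ 2 by rewrite addr_gt0// mulr_gt0.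
(* The tolerance [rho] is shared among the three terms of [explicit_bound]. As e <= 1 gives e^2 <=
   e, the last one is at most e (4 + 8 sigma0^2) / kappa, hence at most rho / 3. *)
pose e := Num.min 1 (rho / 3 * kappa / (4 + 8 * sigma0 ^+ 2)).
have e0 : 0 < e by rewrite lt_min ltr01/= !(divr_gt0, mulr_gt0).
have e1 : e <= 1 by rewrite ge_min lexx.
have e_le : (2 * e ^+ 2 + 2 * e + 8 * sigma0 ^+ 2 * e) / kappa <= rho / 3.
  rewrite ler_pdivrMr//; apply: (@le_trans _ _ (e * (4 + 8 * sigma0 ^+ 2))).
    have : e ^+ 2 <= e by rewrite expr2 ger_pMl.
    lra.
  by rewrite -ler_pdivlMr// /e ge_min lexx orbT.
have p0 : 0 <= p%:R :> R by [].
pose C0 : R := 2 * p%:R + 3; have C00 : 0 < C0 by rewrite /C0; lra.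
have ad1 : delta + a < 1 by lra.
have d1 : delta <= 1 by lra.
have F1 := near_Kdim_le p (ltW a0) kna.
have F2 : \forall n \near \oo,
    n%:R `^ delta * ((Kdim (k n) p)%:R * ln n%:R) <= eta * eps / 288 * n%:R.
  apply: near_Kdim_ln_le kna; [exact: ltW|exact: ad1|].
  exact: (divr_gt0 (mulr_gt0 eta0 eps0) (ltr0Sn _ _)).
(* Here 96 = 12 * 8: the grid has at most n^(12 K) cells, to be bounded by exp (n eps / 8); the
   factor n^delta >= 1 is dropped later. *)
have F3 : \forall n \near \oo,
    n%:R `^ delta * ((Kdim (k n) p)%:R * ln n%:R) <= eps / 96 * n%:R.
  apply: near_Kdim_ln_le kna; [exact: ltW|exact: ad1|].
  exact: (divr_gt0 eps0 (ltr0Sn _ _)).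
have A2' : (fun n : nat => (\sum_(i < Kdim (k n) p) tnth (theta0 n) i ^+ 2) /
    n%:R `^ (1 - delta)) @ \oo --> (0 : R).
  have uE : (fun n : nat => (\sum_(i < Kdim (k n) p) tnth (theta0 n) i ^+ 2) /
      n%:R `^ (1 - delta)) = (fun n : nat => (\sum_(t <- theta0 n) t ^+ 2) / n%:R `^ (1 - delta)).
    by apply/funext => n; rewrite big_tuple.
  by rewrite uE.
have F4 : \forall n \near \oo, n%:R `^ delta *
    (\sum_(i < Kdim (k n) p) tnth (theta0 n) i ^+ 2) <= eta * eps * zeta ^+ 2 / 16 * n%:R.
  by apply: near_powR_mul_le A2'; rewrite divr_gt0// !mulr_gt0.
have F5 := near_powR_mul_le ltr01 A2'.
have F6 := near_L2cube_le e0 A1.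
(* Together with 3, the thresholds on n required by [explicit_bound]; the last two make 2 / n and
   exp (- n eps / 8) at most rho / 3. *)
pose big : R := \big[Num.max/3]_(u <- [:: zeta; zeta^-1; expR 1;
  2 * C0 * (2 + 4 * C0 + kappa * (1 + e^-1)) / (2 * sigma0 ^+ 2);
  8 * ((zeta ^+ 2)^-1 + (1 + e^-1) * (4 * C0 ^+ 2) / sigma0 ^+ 2) * C0 / (eta * eps / 16);
  4 * zeta ^+ 2 * (eps / 2 + 2 * C0); 2 / (rho / 3); (rho / 3)^-1 / (eps / 8)]) u.
suff det n : big <= n%:R -> (Kdim (k n) p)%:R <= C0 * n%:R `^ a ->
    n%:R `^ delta * ((Kdim (k n) p)%:R * ln n%:R) <= eta * eps / 288 * n%:R ->
    n%:R `^ delta * ((Kdim (k n) p)%:R * ln n%:R) <= eps / 96 * n%:R ->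
    n%:R `^ delta * (\sum_(i < Kdim (k n) p) tnth (theta0 n) i ^+ 2) <=
      eta * eps * zeta ^+ 2 / 16 * n%:R ->
    n%:R `^ delta * (\sum_(i < Kdim (k n) p) tnth (theta0 n) i ^+ 2) <= 1 * n%:R ->
    (exists G, [/\ cube_int p (fun x =>
        ((nnet (k n) p (theta0 n) x - f0 x) ^+ 2)%:E) = G%:E, 0 <= G &
        n%:R `^ delta * Num.sqrt G <= e]) ->
    (0 <= outer_prob P [set w | (eta%:E < (n%:R `^ delta)%:E *
       mass_outside_hellinger sigma0 p f0 (k n) eps (mstar n w) (sstar n w))%E] <= rho%:E)%E.
  near=> n; apply: det; near: n => //; exact: nbhs_infty_ger.
rewrite {}/big !big_cons big_nil !ge_max.
move=> /and5P[nz nzi ne g1 /and5P[g2 g4 r1 r2 n3]] h1 h2 h3 h4 h5 [G [GE G0 Ge]].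
rewrite outer_prob_ge0/=.
have n1 : 1 <= n%:R :> R by apply: le_trans n3; rewrite ler1n.
have n0 : 0 < n%:R :> R by exact: lt_le_trans n1.
have nd1 : 1 <= n%:R `^ delta :> R by rewrite -[leLHS](powRr0 n%:R) ler_powR.
have ndr : 1 <= n%:R `^ delta <= n%:R.
  by rewrite nd1; exact: (ler1_powR n1 d1).
have Kn : (Kdim (k n) p)%:R <= C0 * n%:R :> R.
  apply: (le_trans h1); apply: ler_wpM2l; first exact: ltW.
  by rewrite ler1_powR// ltW.
have nd_ge (u : R) : 0 <= u -> u <= n%:R `^ delta * u by move=> u0; rewrite ler_peMl.
have K2 : 12 * ((Kdim (k n) p)%:R * ln n%:R) <= eps / 8 * n%:R.
  have q0 : 0 <= (Kdim (k n) p)%:R * ln n%:R :> R by rewrite mulr_ge0// ln_ge0.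
  have := le_trans (nd_ge _ q0) h3; clear q0 h2 h3.
  set q := _ * ln _; clearbody q; move: q n%:R; clear => q N; lra.
have S2 : \sum_(i < Kdim (k n) p) tnth (theta0 n) i ^+ 2 <= n%:R.
  rewrite -[leRHS]mul1r; apply: le_trans h5; apply: nd_ge.
  by apply: sumr_ge0 => i _; exact: sqr_ge0.
have g1' : 2 * C0 * (2 + 4 * C0 + kappa * (1 + e^-1)) <= 2 * sigma0 ^+ 2 * n%:R.
  by move: g1; rewrite ler_pdivrMr ?mulr_gt0// [n%:R * _]mulrC.
have g2' : 8 * ((zeta ^+ 2)^-1 + (1 + e^-1) * (4 * C0 ^+ 2) / sigma0 ^+ 2) * C0 <=
    eta * eps / 16 * n%:R.
  by move: g2; rewrite ler_pdivrMr ?divr_gt0 ?mulr_gt0// [n%:R * _]mulrC.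
apply: le_trans (explicit_bound sigma0_gt0 zeta_gt0 mf0 ind lawX lawxi yE eps0 eta0 e0 C00
  (vp n) n3 nz nzi ne ndr Kn h2 K2 h4 S2 GE G0 Ge g1' g2' g4) _.
rewrite lee_fin (_ : rho = rho / 3 + rho / 3 + rho / 3); last by field.
apply: lerD e_le; apply: lerD.
  by move: r1; rewrite !ler_pdivrMr ?divr_gt0// [n%:R * _]mulrC.
have q : (rho / 3)^-1 <= n%:R * (eps / 8) by rewrite -ler_pdivrMr// divr_gt0.
rewrite expRN -[leRHS]invrK lef_pV2 ?posrE ?expR_gt0 ?invr_gt0 ?divr_gt0//.
apply: (le_trans q); apply: le_trans (expR_ge1Dx _); by rewrite lerDr.
Unshelve. all: by end_near. Qed.
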